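(* Let $P,Q,A_1,\dots,A_r,B_1,\dots,B_s\in\mathbb{C}^{N\times N}$ be pairwise commuting matrices with $\Re(P)>0$, $\Re(Q)>0$, $\Re(A_i)>0$ for $1\le i\le r$ and $\Re(B_j)>0$ for $1\le j\le s$, and let $x>0$. Then $${}_{r}E_{s}\left[(x,P,Q;z)\left|\begin{matrix}A_1,\dots,A_r\\ B_1,\dots,B_s\end{matrix}\right.\right]=\int_x^\infty t^{Q-I}e^{-t}\;{}_rR_s\left[\left.\begin{matrix}A_1,\dots,A_r\\ B_1,\dots,B_s\end{matrix}\right|P,Q;zt^{P}\right]dt$$ and $${}_{r}e_{s}\left[(x,P,Q;z)\left|\begin{matrix}A_1,\dots,A_r\\ B_1,\dots,B_s\end{matrix}\right.\right]=\int_0^x t^{Q-I}e^{-t}\;{}_rR_s\left[\left.\begin{matrix}A_1,\dots,A_r\\ B_1,\dots,B_s\end{matrix}\right|P,Q;zt^{P}\right]dt .$$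
   Context: $I$ is the identity matrix in $\mathbb{C}^{N\times N}$; $t^{M}=\exp(M\ln t)$ for $t>0$; $\Re(M)>0$ means that every eigenvalue of $M$ has positive real part. For $\Re(M)>0$ and $x>0$: $\gamma(M,x)=\int_0^x u^{M-I}e^{-u}du$, $\Gamma(M,x)=\int_x^\infty u^{M-I}e^{-u}du$, $\Gamma(M)=\int_0^\infty u^{M-I}e^{-u}du$, $\Gamma^{-1}(M)=\Gamma(M)^{-1}$. Pochhammer symbol: $(M)_0=I$, $(M)_\ell=M(M+I)\cdots(M+(\ell-1)I)$. Write $c_\ell=\frac{1}{\ell!}\prod_{i=1}^r(A_i)_\ell\big[\prod_{j=1}^s(B_j)_\ell\big]^{-1}$. The generalized incomplete exponential matrix functions are $${}_re_s\left[(x,P,Q;z)\left|\begin{matrix}A_1,\dots,A_r\\ B_1,\dots,B_s\end{matrix}\right.\right]=\sum_{\ell=0}^\infty c_\ell\,\gamma(\ell P+Q,x)\Gamma^{-1}(\ell P+Q)\,z^\ell,$$ $${}_rE_s\left[(x,P,Q;z)\left|\begin{matrix}A_1,\dots,A_r\\ B_1,\dots,B_s\end{matrix}\right.\right]=\sum_{\ell=0}^\infty c_\ell\,\Gamma(\ell P+Q,x)\Gamma^{-1}(\ell P+Q)\,z^\ell,$$ and $${}_rR_s\left[\left.\begin{matrix}A_1,\dots,A_r\\ B_1,\dots,B_s\end{matrix}\right|P,Q;zt^P\right]=\sum_{\ell=0}^\infty c_\ell\,\Gamma^{-1}(\ell P+Q)\,z^\ell t^{\ell P}.$$ The identities are understood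 for those $z\in\mathbb{C}$ for which the series and integrals involved converge. *)

(* Defs.v *)
From HB Require Import structures.
From mathcomp Require Import all_boot all_order all_algebra.
From mathcomp Require Import all_classical all_reals all_analysis.
From mathcomp Require Import complex.

Set Implicit Arguments.
Unset Strict Implicit.
Unset Printing Implicit Defensive.

Import Order.TTheory GRing.Theory Num.Theory.
Import numFieldNormedType.Exports.

Local Open Scope classical_set_scope.
Local Open Scope ring_scope.
Local Open Scope complex_scope.

(* The complex field is R[i].  As a numClosedFieldType it has a canonical norm,
   which the library turns into a topology on abstract fields only; the copies
   below attach it to R[i] itself, so that 'M[R[i]]_N gets its sup norm. *)
#[non_forgetful_inheritance]
HB.instance Definition _ (R : realType) :=
  PseudoPointedMetric.copy R[i] R[i]^o.
#[non_forgetful_inheritance]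
HB.instance Definition _ (R : realType) := NormedModule.copy R[i] R[i]^o.

Definition mx_Re_gt0 (R : realType) (N : nat) (M : 'M[R[i]]_N) : Prop :=
  forall a : R[i], eigenvalue M a -> 0 < complex.Re a.

Definition mx_exp (R : realType) (N : nat) (M : 'M[R[i]]_N) : 'M[R[i]]_N :=
  limn (series (fun k : nat => (k`!%:R^-1 : R[i]) *: M ^+ k)).

Definition real_powmx (R : realType) (N : nat) (t : R) (M : 'M[R[i]]_N) :
    'M[R[i]]_N :=
  mx_exp ((ln t)%:C *: M).

Definition pochhammer_mx (R : realType) (N : nat) (M : 'M[R[i]]_N) (l : nat) :
    'M[R[i]]_N :=
  \prod_(k < l) (M + (k%:R)%:M).

Definition mx_integrable (R : realType) (N : nat) (D : set R)
    (f : R -> 'M[R[i]]_N) : Prop :=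
  forall i j : 'I_N,
    (@lebesgue_measure R).-integrable D
      (fun t => (complex.Re (f t i j))%:E) /\
    (@lebesgue_measure R).-integrable D
      (fun t => (complex.Im (f t i j))%:E).

Definition mx_Rintegral (R : realType) (N : nat) (D : set R)
    (f : R -> 'M[R[i]]_N) : 'M[R[i]]_N :=
  \matrix_(i, j)
    ((\int[@lebesgue_measure R]_(t in D) complex.Re (f t i j)) +i*
     (\int[@lebesgue_measure R]_(t in D) complex.Im (f t i j))).

(* Improper integrals: the limit of the integrals over [c, d] as the endpoints
   c and d tend, independently, along the filters F and G.  The integral from
   a to b uses F := a^'+ and G := b^'-, or G := +oo for an infinite bound. *)
Definition improper_cvg (R : realType) (N : nat) (F G : set_system R)
    (f : R -> 'M[R[i]]_N) : Prop :=
  (\forall cd \near filter_prod F G, mx_integrable `[cd.1, cd.2] f) /\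
  cvg (mx_Rintegral `[cd.1, cd.2] f @[cd --> filter_prod F G]).

Definition improper_integral (R : realType) (N : nat) (F G : set_system R)
    (f : R -> 'M[R[i]]_N) : 'M[R[i]]_N :=
  lim (mx_Rintegral `[cd.1, cd.2] f @[cd --> filter_prod F G]).

Definition gamma_integrand (R : realType) (N : nat) (M : 'M[R[i]]_N) (u : R) :
    'M[R[i]]_N :=
  (expR (- u))%:C *: real_powmx u (M - 1%:M).

Definition Gamma_mx (R : realType) (N : nat) (M : 'M[R[i]]_N) : 'M[R[i]]_N :=
  improper_integral 0^'+ +oo (gamma_integrand M).

Definition lower_gamma_mx (R : realType) (N : nat) (M : 'M[R[i]]_N) (x : R) :
    'M[R[i]]_N :=
  improper_integral 0^'+ x^'- (gamma_integrand M).

Definition upper_gamma_mx (R : realType) (N : nat) (M : 'M[R[i]]_N) (x : R) :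
    'M[R[i]]_N :=
  improper_integral x^'+ +oo (gamma_integrand M).

Definition hyp_coef (R : realType) (N r s : nat)
    (A : 'I_r -> 'M[R[i]]_N) (B : 'I_s -> 'M[R[i]]_N) (l : nat) :
    'M[R[i]]_N :=
  (l`!%:R^-1 : R[i]) *:
    ((\prod_(i < r) pochhammer_mx (A i) l) *m
     invmx (\prod_(j < s) pochhammer_mx (B j) l)).

Definition res_term (R : realType) (N r s : nat)
    (A : 'I_r -> 'M[R[i]]_N) (B : 'I_s -> 'M[R[i]]_N)
    (x : R) (P Q : 'M[R[i]]_N) (z : R[i]) (l : nat) : 'M[R[i]]_N :=
  z ^+ l *: (hyp_coef A B l *m lower_gamma_mx (P *+ l + Q) x *m
             invmx (Gamma_mx (P *+ l + Q))).

Definition rEs_term (R : realType) (N r s : nat)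
    (A : 'I_r -> 'M[R[i]]_N) (B : 'I_s -> 'M[R[i]]_N)
    (x : R) (P Q : 'M[R[i]]_N) (z : R[i]) (l : nat) : 'M[R[i]]_N :=
  z ^+ l *: (hyp_coef A B l *m upper_gamma_mx (P *+ l + Q) x *m
             invmx (Gamma_mx (P *+ l + Q))).

(* The argument z t^P of rRs is represented by the pair (z, t): its l-th power
   is z^l t^(lP). *)
Definition rRs_term (R : realType) (N r s : nat)
    (A : 'I_r -> 'M[R[i]]_N) (B : 'I_s -> 'M[R[i]]_N)
    (P Q : 'M[R[i]]_N) (z : R[i]) (t : R) (l : nat) : 'M[R[i]]_N :=
  z ^+ l *: (hyp_coef A B l *m invmx (Gamma_mx (P *+ l + Q)) *m
             real_powmx t (P *+ l)).

Definition res (R : realType) (N r s : nat)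
    (A : 'I_r -> 'M[R[i]]_N) (B : 'I_s -> 'M[R[i]]_N)
    (x : R) (P Q : 'M[R[i]]_N) (z : R[i]) : 'M[R[i]]_N :=
  limn (series (res_term A B x P Q z)).

Definition rEs (R : realType) (N r s : nat)
    (A : 'I_r -> 'M[R[i]]_N) (B : 'I_s -> 'M[R[i]]_N)
    (x : R) (P Q : 'M[R[i]]_N) (z : R[i]) : 'M[R[i]]_N :=
  limn (series (rEs_term A B x P Q z)).

Definition rRs (R : realType) (N r s : nat)
    (A : 'I_r -> 'M[R[i]]_N) (B : 'I_s -> 'M[R[i]]_N)
    (P Q : 'M[R[i]]_N) (z : R[i]) (t : R) : 'M[R[i]]_N :=
  limn (series (rRs_term A B P Q z t)).

Definition rRs_integrand (R : realType) (N r s : nat)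
    (A : 'I_r -> 'M[R[i]]_N) (B : 'I_s -> 'M[R[i]]_N)
    (P Q : 'M[R[i]]_N) (z : R[i]) (t : R) : 'M[R[i]]_N :=
  (expR (- t))%:C *: (real_powmx t (Q - 1%:M) *m rRs A B P Q z t).

(* Main.v *)
(** Put M_l = l P + Q and D_l = z^l c_l Gamma^-1(M_l), so that the integrand is
    g(t) = e^(-t) sum_l D_l t^(M_l - 1).  Convergence of the R-series at a larger
    argument gives geometric decay of D_l t^(lP), which makes A(d) = int_0^d g
    well defined; the hypothesis on the improper integral says that A has a limit.

    For the lower function, replace the l-th term by D_l q^(M_l) gamma(M_l, x)
    with q < 1.  The regularized series may be integrated termwise and, by parts,
    equals a mean of A that tends to the limit of A at x as q tends to 1; the
    regularized series itself tends to the e-series by Abel's theorem.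

    For the upper function it suffices to add the (absolutely convergent) lower
    series and show sum_l D_l Gamma(M_l) = lim A at infinity.  The identity
    s int_0^oo A(t) e^(-s t) dt = sum_l D_l Gamma(M_l) (1 + s)^(-M_l) holds for
    large s by termwise integration: D_l Gamma(M_l) is bounded, and on each joint
    spectral block of P and Q a lower bound |Gamma(u + i v)| >= c^(u + 1) Gamma(u)
    for |v| <= C u turns this into a bound on D_l.  It extends to every s > 0 by
    finitely many Taylor expansions, since both sides are real analytic with
    explicit derivatives; then s -> 0 by Abel's theorem on both sides. *)

From HB Require Import structures.
From mathcomp Require Import all_boot all_order all_algebra.
From mathcomp Require Import all_classical all_reals all_analysis.
From mathcomp Require Import measurable_realfun.
From mathcomp Require Import complex ring lra.
Require Import Defs.

Set Implicit Arguments.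
Unset Strict Implicit.
Unset Printing Implicit Defensive.

Import Order.TTheory GRing.Theory Num.Theory.
Import numFieldNormedType.Exports.

Local Open Scope classical_set_scope.
Local Open Scope ring_scope.
Local Open Scope complex_scope.

(** * Series and integrals of real functions *)

(** The given series and integrals may converge only conditionally: at [x] in the lower case, at
    infinity in the upper one. Exchange of sum and integral is therefore available only after
    damping, and one damping must act on both sides. Inserting [q^(M_l)] does so: it is a summation
    weight for the series and a dilation [t -> q t] for the integral. Working with the primitive of
    [g] turns convergence of the improper integral into boundedness, which is all that dominated
    convergence needs.

    In the upper case damping alone is too weak. If [P] has non-real eigenvalues, [|Gamma(z_l)|] may
    be exponentially smaller than [Gamma(Re z_l)], so a bound on [D_l Gamma(M_l)] can leave [D_l]
    too large for termwise integration at small [s]; hence the continuation from large [s]. It stays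
    on the real line: passing from [M_l] to [M_l + k] costs a rising factorial whose base grows
    linearly in [l], and the resulting exponential loss in [l] is paid by the decay of
    [(1 + s)^(-M_l)]. The admissible Taylor step is thus a fixed proportion of [1 + s], and finitely
    many steps reach any positive [s]. *)

Section RealSeries.
Context {R : realType}.
Implicit Types u v b : nat -> R.

Lemma dominated_cvg_series u b :
  (forall n, `|u n| <= b n) -> cvgn (series b) -> cvgn (series u).
Proof.
move=> ub cb; apply: normed_cvg; apply: series_le_cvg cb => n //=.
exact: le_trans (normr_ge0 _) (ub n).
Qed.

Lemma bounded_sum_cvg_series b (K : R) :
  (forall n, 0 <= b n) -> (forall n, series b n <= K) -> cvgn (series b).
Proof.
move=> b0 bK; apply: nondecreasing_is_cvgn.
  by apply: nondecreasing_series => n _ _; exact: b0.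
by exists K => _ [n _ <-].
Qed.

Lemma series_le_lim b n :
  (forall n, 0 <= b n) -> cvgn (series b) -> series b n <= limn (series b).
Proof.
move=> b0 cb; apply: nondecreasing_cvgn_le => //.
by apply: nondecreasing_series => k _ _; exact: b0.
Qed.

Lemma lim_series_tail u b N :
  (forall n, `|u n| <= b n) -> cvgn (series b) ->
  `|limn (series u) - series u N| <= limn (series b) - series b N.
Proof.
move=> ub cb; have cu := dominated_cvg_series ub cb.
have c1 : (series u n - series u N) @[n --> \oo] --> limn (series u) - series u N.
  by apply: cvgB => //; exact: cvg_cst.
have c2 : (series b n - series b N) @[n --> \oo] --> limn (series b) - series b N.
  by apply: cvgB => //; exact: cvg_cst.
apply: (ler_cvg_to (cvg_norm c1) c2).
near=> n; have Nn : (N <= n)%N by near: n; exact: nbhs_infty_ge.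
rewrite !sub_series_geq//; apply: le_trans (ler_norm_sum _ _ _) _.
exact: ler_sum.
Unshelve. all: by end_near. Qed.

(** The common majorant makes all tails uniformly small, so only a finite head has to converge. The
    filter is arbitrary because the parameter is sometimes an index and sometimes a real point. *)
Lemma tannery (T : Type) (F : set_system T) (FF : ProperFilter F)
    (u : T -> nat -> R) v b :
  (\forall x \near F, forall n, `|u x n| <= b n) -> cvgn (series b) ->
  (forall n, u x n @[x --> F] --> v n) ->
  limn (series (u x)) @[x --> F] --> limn (series v).
Proof.
move=> ub cb uv.
have vb n : `|v n| <= b n.
  apply: (cvgr_to_le (cvg_norm (uv n))).
  by apply: filterS ub => x /(_ n).
apply/cvgrPdist_lt => e e0.
have e4 : 0 < e / 4 by rewrite divr_gt0.
have /cvgrPdist_lt/(_ _ e4) [N _ HN] : series b @ \oo --> limn (series b) by [].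
have {HN} HN : limn (series b) - series b N < e / 4.
  by apply: le_lt_trans (ler_norm _) (HN N _); rewrite /=.
have cs : series (u x) N @[x --> F] --> series v N.
  elim: (N) => [|m IH].
    under eq_cvg do rewrite /series/= big_geq//.
    by rewrite /series/= big_geq//; exact: cvg_cst.
  under eq_cvg do rewrite seriesSr.
  by rewrite seriesSr; apply: cvgD.
have {}cs : \forall x \near F, `|series v N - series (u x) N| < e / 4.
  by move/cvgrPdist_lt : cs => /(_ _ e4).
apply: filterS2 ub cs => x ux cx.
have h1 := lim_series_tail N vb cb.
have h2 := lim_series_tail N ux cb.
have -> : limn (series v) - limn (series (u x)) =
  (limn (series v) - series v N) + (series v N - series (u x) N)
  - (limn (series (u x)) - series (u x) N) by ring.
apply: le_lt_trans (ler_normB _ _) _.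
apply: le_lt_trans (lerD (ler_normD _ _) (lexx _)) _.
by lra.
Qed.

Lemma cvg_geometric_dom (C q : R) : 0 <= q < 1 ->
  cvgn (series (fun n => C * q ^+ n)).
Proof.
by move=> /andP[q0 q1]; apply: is_cvg_geometric_series; rewrite ger0_norm.
Qed.

Lemma geometric_le (C q : R) n : 0 <= C -> 0 <= q < 1 ->
  series (fun n => C * q ^+ n) n <= C / (1 - q).
Proof.
move=> C0 /andP[q0 q1].
have -> : (fun n => C * q ^+ n) = geometric C q by [].
rewrite geometric_seriesE ?lt_eqF//= ler_pM2r ?invr_gt0 ?subr_gt0//.
by rewrite ler_piMr// gerBl exprn_ge0.
Qed.

Lemma cvg_series_exp_dom (K x : R) :
  cvgn (series (fun n => K * (x ^+ n / n`!%:R))).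
Proof.
have -> : (fun n => K * (x ^+ n / n`!%:R)) = K *: exp_coeff x by [].
by apply: is_cvg_seriesZ; exact: is_cvg_series_exp_coeff.
Qed.

End RealSeries.

(** * Dominated convergence and termwise integration *)

Section RealIntegral.
Context d (T : measurableType d) {R : realType} (mu : {measure set T -> \bar R}).
Implicit Types (D : set T) (f g : T -> R).

Lemma Rdominated_convergence D (f_ : nat -> T -> R) f g :
  measurable D -> (forall n, measurable_fun D (f_ n)) ->
  (forall x, D x -> f_ ^~ x @ \oo --> f x) ->
  mu.-integrable D (EFin \o g) ->
  (forall n x, D x -> `|f_ n x| <= g x) ->
  mu.-integrable D (EFin \o f) /\
  \int[mu]_(x in D) f_ n x @[n --> \oo] --> \int[mu]_(x in D) f x.
Proof.
move=> mD mf_ ff ig fg.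
have mf : measurable_fun D f by exact: measurable_fun_cvg ff.
have [||||i1 _ i3] := @dominated_convergence _ _ _ mu D mD
  (fun n => EFin \o f_ n) (EFin \o f) (EFin \o g) _ _ _ ig.
- by move=> n; exact/measurable_EFinP.
- exact/measurable_EFinP.
- apply: aeW => x Dx; apply: cvg_EFin; first exact: nearW.
  exact: ff.
- by apply: aeW => x n Dx; rewrite lee_fin; exact: fg.
split => //.
have -> : \int[mu]_(x in D) f x = fine (\int[mu]_(x in D) (EFin \o f) x)%E by [].
apply: fine_cvg; rewrite fineK//; exact: integrable_fin_num.
Qed.

Lemma integrable_sumR D (I : Type) (s : seq I) (f : I -> T -> R) :
  measurable D -> (forall i, mu.-integrable D (EFin \o f i)) ->
  mu.-integrable D (EFin \o (fun x => \sum_(i <- s) f i x)).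
Proof.
move=> mD fi.
rewrite (_ : _ \o _ = fun x => \sum_(i <- s) (f i x)%:E)%E.
  apply: (@integrable_sum _ _ _ mu _ mD _ _ xpredT (fun i => EFin \o f i)) => i _.
  exact: fi.
by apply/funext => x /=; rewrite sumEFin.
Qed.

Lemma Rintegral_sum D (I : Type) (s : seq I) (f : I -> T -> R) :
  measurable D -> (forall i, mu.-integrable D (EFin \o f i)) ->
  \int[mu]_(x in D) (\sum_(i <- s) f i x) =
  \sum_(i <- s) \int[mu]_(x in D) f i x.
Proof.
move=> mD fi; elim: s => [|i s IH].
  under eq_Rintegral do rewrite big_nil.
  by rewrite big_nil Rintegral_cst// mul0r.
under eq_Rintegral do rewrite big_cons.
rewrite RintegralD// ?big_cons ?IH//.
exact: integrable_sumR.
Qed.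

(** By monotone convergence the bounds [b] make the sum of the absolute values integrable, and this
    sum then dominates all partial sums. Absolute convergence is asked at every point, so that
    [limn] is the true sum everywhere on [D]. *)
Lemma Rintegral_series D (u : nat -> T -> R) (b : nat -> R) :
  measurable D -> (forall n, mu.-integrable D (EFin \o u n)) ->
  (forall x, D x -> cvgn (series (fun n => `|u n x|))) ->
  (forall n, \int[mu]_(x in D) `|u n x| <= b n) -> cvgn (series b) ->
  mu.-integrable D (EFin \o (fun x => limn (series (u ^~ x)))) /\
  \int[mu]_(x in D) limn (series (u ^~ x)) =
  limn (series (fun n => \int[mu]_(x in D) u n x)).
Proof.
move=> mD ui cu ub cb.
have ui' n : mu.-integrable D (EFin \o (fun x => `|u n x|)) by exact: integrable_norm.
pose G n x := series (fun k => `|u k x|) n.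
pose g x := limn (series (fun k => `|u k x|)).
have Gi n : mu.-integrable D (EFin \o G n) by exact: integrable_sumR.
have mG n : measurable_fun D (G n).
  by apply/measurable_EFinP; exact: measurable_int (Gi n).
have G0 n x : 0 <= G n x by apply: sumr_ge0.
have Gg x : D x -> G ^~ x @ \oo --> g x by move=> /cu.
have mg : measurable_fun D g by exact: measurable_fun_cvg Gg.
have g0 x : D x -> 0 <= g x.
  by move=> Dx; apply: limr_ge; [exact: cu|apply: nearW => n; exact: G0].
have Gn n : \int[mu]_(x in D) G n x <= limn (series b).
  rewrite Rintegral_sum//.
  apply: (@le_trans _ _ (series b n)); first exact: ler_sum.
  apply: series_le_lim => // k.
  by apply: le_trans (ub k); apply: Rintegral_ge0.
have gi : mu.-integrable D (EFin \o g).
  apply/integrableP; split; first exact/measurable_EFinP.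
  have -> : (\int[mu]_(x in D) `|(EFin \o g) x| = \int[mu]_(x in D) (g x)%:E)%E.
    by apply: eq_integral => x /[!inE] Dx; rewrite /= ger0_norm// g0.
  rewrite [X in (X < _)%E](_ : _ = \int[mu]_(x in D) limn (fun n => (G n x)%:E))%E; last first.
    apply: eq_integral => x /[!inE] Dx; apply/esym/cvg_lim => //.
    by apply: cvg_EFin; [exact: nearW|exact: Gg].
  rewrite monotone_convergence//; last 3 first.
  - by move=> n; exact/measurable_EFinP.
  - by move=> n x Dx; rewrite lee_fin.
  - move=> x Dx m n mn; rewrite lee_fin.
    by apply: (nondecreasing_series (u_ := fun k => `|u k x|) (P := xpredT)).
  apply: (@le_lt_trans _ _ (limn (series b))%:E); last exact: ltry.
  apply: lime_le.
    apply: ereal_nondecreasing_is_cvgn => m n mn.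
    apply: ge0_le_integral.
    - by [].
    - by move=> x Dx; rewrite lee_fin.
    - exact/measurable_EFinP.
    - exact/measurable_EFinP.
    - move=> x Dx; rewrite lee_fin.
      by apply: (nondecreasing_series (u_ := fun k => `|u k x|) (P := xpredT)).
  apply: nearW => n; rewrite -(@fineK _ (\int[mu]_(x in D) (G n x)%:E)%E).
    by rewrite lee_fin; exact: Gn.
  exact: (integrable_fin_num mD (Gi n)).
have cvu x : D x -> series (u ^~ x) @ \oo --> limn (series (u ^~ x)).
  by move=> /cu; exact: normed_cvg.
have [||i1 i2] := @Rdominated_convergence D (fun n x => series (u ^~ x) n) _ g mD _ cvu gi.
- move=> n; apply: measurable_sum => k.
  by apply/measurable_EFinP; exact: measurable_int (ui k).
- move=> n x Dx; apply: le_trans (ler_norm_sum _ _ _) _.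
  by apply: (series_le_lim (b := fun k => `|u k x|)) => //; exact: cu.
split => //; apply/esym/cvg_lim => //.
suff <- : (fun n => \int[mu]_(x in D) series (u ^~ x) n) =
  series (fun n => \int[mu]_(x in D) u n x) by [].
by apply/funext => n; rewrite /series/= Rintegral_sum.
Qed.

Lemma norm_Rintegral_le D f g : measurable D ->
  mu.-integrable D (EFin \o f) -> mu.-integrable D (EFin \o g) ->
  (forall x, D x -> `|f x| <= g x) ->
  `|\int[mu]_(x in D) f x| <= \int[mu]_(x in D) g x.
Proof.
move=> mD fi gi fg; apply: le_trans (le_normr_Rintegral mD fi) _.
by apply: le_Rintegral => //; exact: integrable_norm.
Qed.

Lemma le_integrableR D f g : measurable D -> measurable_fun D f ->
  mu.-integrable D (EFin \o g) -> (forall x, D x -> `|f x| <= g x) ->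
  mu.-integrable D (EFin \o f).
Proof.
move=> mD mf gi fg; apply: le_integrable gi => //; first exact/measurable_EFinP.
by move=> x Dx; rewrite lee_fin; apply: le_trans (fg _ Dx) _; exact: ler_norm.
Qed.

Lemma integrableZR D c f : measurable D -> mu.-integrable D (EFin \o f) ->
  mu.-integrable D (EFin \o (fun x => c * f x)).
Proof. by move=> mD fi; have := integrableZl mD c fi; exact: eq_integrable. Qed.

Lemma integrableDR D f g : measurable D -> mu.-integrable D (EFin \o f) ->
  mu.-integrable D (EFin \o g) ->
  mu.-integrable D (EFin \o (fun x => f x + g x)).
Proof. by move=> mD fi gi; have := integrableD mD fi gi; exact: eq_integrable. Qed.

Lemma integrableBR D f g : measurable D -> mu.-integrable D (EFin \o f) ->
  mu.-integrable D (EFin \o g) ->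
  mu.-integrable D (EFin \o (fun x => f x - g x)).
Proof. by move=> mD fi gi; have := integrableB mD fi gi; exact: eq_integrable. Qed.

End RealIntegral.

(** * Exhaustion of intervals and improper integrals *)

Section PosLine.
Context {R : realType}.
Implicit Types (h F f g : R -> R) (c d t : R).
Local Notation mu := (@lebesgue_measure R).
Local Notation RT := (measurableTypeR R).

Lemma mitv (i : interval R) : measurable ([set` i] : set RT).
Proof. exact: measurable_itv. Qed.

Lemma eq_Rint (i : interval R) f g : (forall t, t \in i -> f t = g t) ->
  \int[mu]_(t in [set` i]) f t = \int[mu]_(t in [set` i]) g t.
Proof. by move=> fg; apply: eq_Rintegral => t /[!inE] /= /fg. Qed.

Lemma eq_integrable_itv (i : interval R) f g : (forall t, t \in i -> f t = g t) ->
  mu.-integrable [set` i] (EFin \o f) -> mu.-integrable [set` i] (EFin \o g).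
Proof.
move=> fg; apply: eq_integrable; first exact: mitv.
by move=> t /[!inE] /= /fg ->.
Qed.

Lemma contM f g t : {for t, continuous f} -> {for t, continuous g} ->
  {for t, continuous (fun t => f t * g t)}.
Proof. by move=> cf cg; apply: cvgM. Qed.

Lemma contD f g t : {for t, continuous f} -> {for t, continuous g} ->
  {for t, continuous (fun t => f t + g t)}.
Proof. by move=> cf cg; apply: cvgD. Qed.

Lemma contB f g t : {for t, continuous f} -> {for t, continuous g} ->
  {for t, continuous (fun t => f t - g t)}.
Proof. by move=> cf cg; apply: cvgB. Qed.

Lemma contZ k f t : {for t, continuous f} ->
  {for t, continuous (fun t => k * f t)}.
Proof. by move=> cf; apply: cvgMl_tmp. Qed.

Lemma is_derive_continuous F t (y : R) : is_derive t 1 F y -> {for t, continuous F}.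
Proof.
by case=> dF _; apply: differentiable_continuous; apply/derivable1_diffP.
Qed.

Lemma within_continuousP h (D : set R) :
  (forall t, D t -> {for t, continuous h}) -> {within D, continuous h}.
Proof.
move=> ch; apply/continuous_in_subspaceT => t /[!inE]; exact: ch.
Qed.

Lemma integrable_cc h c d :
  (forall t, c <= t <= d -> {for t, continuous h}) ->
  mu.-integrable `[c, d] (EFin \o h).
Proof.
move=> ch; apply: continuous_compact_integrable; first exact: segment_compact.
by apply: within_continuousP => t /=; rewrite in_itv/=; exact: ch.
Qed.

Lemma measurable_open_continuous h (D : set R) : open D ->
  (forall t, D t -> {for t, continuous h}) -> @measurable_fun _ _ RT RT D h.
Proof.
by move=> oD ch; apply: open_continuous_measurable_fun => // t /[!inE] /ch.
Qed.

Lemma FTC F f c d : c <= d ->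
  (forall t, c <= t <= d -> is_derive t 1 F (f t)) ->
  (forall t, c <= t <= d -> {for t, continuous f}) ->
  \int[mu]_(t in `[c, d]) f t = F d - F c.
Proof.
rewrite le_eqVlt => /predU1P[<- _ _|cd dF cf].
  by rewrite set_itv1 Rintegral_set1 subrr.
rewrite /Rintegral (@continuous_FTC2 _ f F)//.
- by apply: within_continuousP => t /=; rewrite in_itv/=; exact: cf.
- split.
  + move=> t /[!in_itv]/= /andP[ct td]; have [] // := dF t.
    by rewrite !ltW.
  + apply: cvg_at_right_filter; apply: (is_derive_continuous (y := f c)).
    by apply: dF; rewrite lexx ltW.
  + apply: cvg_at_left_filter; apply: (is_derive_continuous (y := f d)).
    by apply: dF; rewrite lexx ltW.
- move=> t /[!in_itv]/= /andP[ct td]; rewrite derive1E.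
  by have [] // := dF t; rewrite !ltW.
Qed.

Lemma ge0_derive_le F f c d : c <= d ->
  (forall t, c <= t <= d -> is_derive t 1 F (f t)) ->
  (forall t, c <= t <= d -> 0 <= f t) -> F c <= F d.
Proof.
move=> cd dF f0.
apply: (@ger0_derive1_le_cc _ F c d) => //.
- move=> t /[!in_itv]/= /andP[ct td]; have [] // := dF t.
  by rewrite !ltW.
- move=> t /[!in_itv]/= /andP[ct td]; rewrite derive1E.
  have [_ ->] := dF t (ltac:(by rewrite !ltW)).
  by apply: f0; rewrite !ltW.
- apply: within_continuousP => t /=; rewrite in_itv/= => /dF.
  exact: is_derive_continuous.
- by rewrite in_itv/= lexx.
- by rewrite in_itv/= lexx andbT.
Qed.

Lemma near_le_natS (x : R) : \forall n \near \oo, x <= n.+1%:R.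
Proof.
near=> n; apply: (@le_trans _ _ n%:R); last by rewrite ler_nat.
by near: n; exact: nbhs_infty_ger.
Unshelve. all: by end_near. Qed.

(** Once [[c, d]] contains [[p n, q n]], the error is at most the integral of [|h|] off
    [[p n, q n]], which tends to 0 by dominated convergence. This handles two independent endpoints
    through a single sequence. *)
Lemma improper_exhaustion (D : set RT) (p q : nat -> R) h (F G : set_system R)
    (FF : ProperFilter F) (GG : ProperFilter G) :
  measurable D -> mu.-integrable D (EFin \o h) ->
  (forall x, D x -> \forall n \near \oo, p n <= x <= q n) ->
  (forall n, \forall c \near F, c <= p n) ->
  (forall n, \forall d \near G, q n <= d) ->
  (\forall cd \near filter_prod F G, `[cd.1, cd.2] `<=` D) ->
  \int[mu]_(t in `[cd.1, cd.2]) h t @[cd --> filter_prod F G] -->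
  \int[mu]_(t in D) h t.
Proof.
move=> mD hi Dpq Fp Gq FGD.
have hni : mu.-integrable D (EFin \o (fun x => `|h x|)) by exact: integrable_norm.
have mh : measurable_fun D h by apply/measurable_EFinP; exact: measurable_int hi.
pose f_ n x := `|h x| * \1_(~` `[p n, q n]) x.
have f_le n x : `|f_ n x| <= `|h x|.
  by rewrite /f_ normrM normr_id ler_piMr// ger0_norm// indicE; case: (_ \in _).
have mf n : measurable_fun D (f_ n).
  apply: measurable_funM; first exact: measurableT_comp.
  by apply: measurable_indic; apply: measurableC.
have [|_ cf] := @Rdominated_convergence _ _ _ mu D f_ (cst 0) (fun x => `|h x|) mD mf _ hni (fun n x _ => f_le n x).
  move=> x Dx; apply: cvg_near_cst; near=> n.
  have pxq : p n <= x <= q n by near: n; exact: Dpq.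
  by rewrite /f_ indicE memNset ?mulr0//= in_itv/= pxq.
rewrite Rintegral_cst// mul0r in cf.
apply/cvgrPdist_lt => e e0.
have /cvgrPdist_lt/(_ _ e0) [n _ /(_ n (leqnn n))/=] := cf.
rewrite sub0r normrN => Hn.
have FGn : \forall cd \near filter_prod F G, cd.1 <= p n /\ q n <= cd.2.
  by exists ([set c | c <= p n], [set d | q n <= d]); [split; [exact: Fp|exact: Gq]|].
apply: filterS2 FGD FGn => -[c d]/= cdD [cp qd].
pose hc : R -> R := h \_ `[c, d].
have -> : \int[mu]_(t in `[c, d]) h t = \int[mu]_(t in D) hc t.
  by rewrite -Rintegral_mkcondr; congr Rintegral; apply/esym/setIidr.
have hci : mu.-integrable D (EFin \o hc).
  apply: le_integrableR hni _ => //; last first.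
    by move=> x Dx; rewrite /hc patchE; case: ifP => // _; rewrite normr0.
  apply/measurable_restrict => //.
  apply: measurable_funS mh => //; exact: subIsetl.
rewrite -RintegralB//.
apply: le_lt_trans (le_lt_trans (ler_norm _) Hn).
apply: norm_Rintegral_le => //.
- exact: integrableBR.
- exact: le_integrableR hni _.
- move=> x Dx; rewrite /f_ /hc patchE indicE.
  case: ifPn => [_|]; first by rewrite subrr normr0 mulr_ge0.
  rewrite notin_setE/= in_itv/= => /negP; rewrite negb_and => xcd.
  rewrite subr0 mem_set ?mulr1//= in_itv/= => /andP[px xq].
  by move: xcd; rewrite (le_trans cp px) (le_trans xq qd).
Unshelve. all: by end_near. Qed.

(** Monotone convergence along the compact intervals [[1/(n+1), n+1]], which exhaust the
    half-line. *)
Lemma ge0_integrable_pos h (K : R) :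
  (forall t, 0 < t -> {for t, continuous h}) -> (forall t, 0 < t -> 0 <= h t) ->
  (forall c d, 0 < c -> c <= d -> \int[mu]_(t in `[c, d]) h t <= K) ->
  mu.-integrable `]0, +oo[ (EFin \o h).
Proof.
move=> ch h0 hK.
have mh : @measurable_fun _ _ RT RT `]0, +oo[ h.
  apply: measurable_open_continuous; first exact: interval_open.
  by move=> t /=; rewrite in_itv/= andbT; exact: ch.
apply/integrableP; split; first exact/measurable_EFinP.
pose S n : set RT := `[(n.+1%:R^-1 : R), n.+1%:R]%classic.
pose g n t := ((h \_ (S n)) t)%:E.
have Spos n t : S n t -> 0 < t.
  rewrite /S/= in_itv/= => /andP[nt _]; apply: lt_le_trans nt.
  by rewrite invr_gt0.
have -> : (\int[mu]_(t in `]0%R, +oo[) `|(EFin \o h) t| =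
    \int[mu]_(t in `]0%R, +oo[) limn (g ^~ t))%E.
  apply: eq_integral => t /[!inE]/=; rewrite in_itv/= andbT => t0.
  rewrite ger0_norm ?h0//; apply/esym/cvg_lim => //.
  apply: cvg_near_cst; near=> n; rewrite /g patchE mem_set//.
  rewrite /S/= in_itv/=; apply/andP; split.
    rewrite -[leRHS]invrK lef_pV2 ?posrE ?invr_gt0//.
    by near: n; exact: near_le_natS.
  by near: n; exact: near_le_natS.
have g0 n t : (0 <= g n t)%E.
  by rewrite lee_fin patchE; case: ifPn => // /[!inE] /Spos /h0.
have mg n : @measurable_fun _ _ RT _ `]0, +oo[ (g n).
  have mS : measurable (S n) by exact: measurable_itv.
  apply/measurable_EFinP; apply/measurable_restrict => //.
  by apply: measurable_funS mh => //; exact: subIsetl.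
have nd t : nondecreasing_seq (g ^~ t).
  move=> m n mn; rewrite lee_fin !patchE; case: ifPn => [/[!inE] tm|_]; last first.
    by case: ifPn => // /[!inE] /Spos /h0.
  rewrite mem_set//; move: tm; rewrite /S/= !in_itv/= => /andP[a b].
  rewrite (le_trans _ a) ?(le_trans b)// ?ler_nat//.
  by rewrite lef_pV2 ?posrE// ler_nat.
rewrite monotone_convergence//.
apply: (@le_lt_trans _ _ K%:E); last exact: ltry.
apply: lime_le.
  apply: ereal_nondecreasing_is_cvgn => m n mn.
  by apply: ge0_le_integral => // t _; exact: nd.
apply: nearW => n.
have -> : (\int[mu]_(t in `]0%R, +oo[) g n t = \int[mu]_(t in S n) (h t)%:E)%E.
  rewrite (_ : g n = (EFin \o h) \_ (S n)); last by rewrite restrict_EFin.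
  rewrite -integral_mkcondr; congr (integral _ _ _).
  by apply: setIidr => t /Spos; rewrite /= in_itv/= andbT.
have hSi : mu.-integrable (S n) (EFin \o h).
  apply: integrable_cc => t tn; apply: ch; apply: (Spos n).
  by rewrite /S/= in_itv.
have mS : measurable (S n) by exact: measurable_itv.
rewrite -(fineK (integrable_fin_num mS hSi)).
rewrite lee_fin; apply: hK; first by rewrite invr_gt0.
apply: (@le_trans _ _ 1); last by rewrite ler1n.
by rewrite invf_le1// ler1n.
Unshelve. all: by end_near. Qed.

End PosLine.

(** * Dilations, real powers and the real Gamma integral *)

Section PosLineGamma.
Context {R : realType}.
Implicit Types (h F f : R -> R) (c d t s u : R).
Local Notation mu := (@lebesgue_measure R).
Local Notation RT := (measurableTypeR R).

Lemma improper_seq (D : set RT) (p q : nat -> R) h :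
  measurable D -> mu.-integrable D (EFin \o h) ->
  (forall x, D x -> \forall n \near \oo, p n <= x <= q n) ->
  (forall n, `[p n, q n] `<=` D) ->
  \int[mu]_(t in `[p n, q n]) h t @[n --> \oo] --> \int[mu]_(t in D) h t.
Proof.
move=> mD hi Dpq pqD.
have hni : mu.-integrable D (EFin \o (fun x => `|h x|)) by exact: integrable_norm.
have mh : measurable_fun D h by apply/measurable_EFinP; exact: measurable_int hi.
pose f_ n : R -> R := h \_ `[p n, q n].
have mf n : measurable_fun D (f_ n).
  apply/measurable_restrict => //.
  by apply: measurable_funS mh => //; exact: subIsetl.
have f_le n x : D x -> `|f_ n x| <= `|h x|.
  by move=> Dx; rewrite /f_ patchE; case: ifP => // _; rewrite normr0.
have [|_ cf] := @Rdominated_convergence _ _ _ mu D f_ h (fun x => `|h x|) mD mf _ hni f_le.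
  move=> x Dx; apply: cvg_near_cst; near=> n.
  have pxq : p n <= x <= q n by near: n; exact: Dpq.
  by rewrite /f_ patchE mem_set//= in_itv/= pxq.
suff <- : (fun n => \int[mu]_(t in D) f_ n t) =
  (fun n => \int[mu]_(t in `[p n, q n]) h t) by [].
apply/funext => n; rewrite -Rintegral_mkcondr; congr Rintegral.
exact/setIidr.
Unshelve. all: by end_near. Qed.

Lemma improper_pos_seq h : mu.-integrable `]0, +oo[ (EFin \o h) ->
  \int[mu]_(t in `[n.+1%:R^-1, n.+1%:R]) h t @[n --> \oo] -->
  \int[mu]_(t in `]0, +oo[) h t.
Proof.
move=> hi; apply: improper_seq => //.
- move=> x /=; rewrite in_itv/= andbT => x0; near=> n; apply/andP; split.
    rewrite -[leRHS]invrK lef_pV2 ?posrE ?invr_gt0//.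
    by near: n; exact: near_le_natS.
  by near: n; exact: near_le_natS.
- move=> n x /=; rewrite !in_itv/= andbT => /andP[+ _]; apply: lt_le_trans.
  by rewrite invr_gt0.
Unshelve. all: by end_near. Qed.

Lemma improper_pos h : mu.-integrable `]0, +oo[ (EFin \o h) ->
  \int[mu]_(t in `[cd.1, cd.2]) h t @[cd --> filter_prod 0^'+ +oo] -->
  \int[mu]_(t in `]0, +oo[) h t.
Proof.
move=> hi.
apply: (@improper_exhaustion _ _ (fun n => n.+1%:R^-1) (fun n => n.+1%:R)) => //.
- move=> x /=; rewrite in_itv/= andbT => x0; near=> n; apply/andP; split.
    rewrite -[leRHS]invrK lef_pV2 ?posrE ?invr_gt0//.
    by near: n; exact: near_le_natS.
  by near: n; exact: near_le_natS.
- by move=> n; near=> c; near: c; apply: nbhs_right_le; rewrite invr_gt0.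
- by move=> n; near=> d; near: d; apply: nbhs_pinfty_ge; rewrite num_real.
- exists ([set c | 0 < c], setT) => /=.
    split; last exact: filterT.
    exact: nbhs_right_gt.
  move=> [c d]/= [c0 _] x /=; rewrite !in_itv/= andbT => /andP[+ _].
  exact: lt_le_trans.
Unshelve. all: by end_near. Qed.

Lemma improper_above x h : mu.-integrable `]x, +oo[ (EFin \o h) ->
  \int[mu]_(t in `[cd.1, cd.2]) h t @[cd --> filter_prod x^'+ +oo] -->
  \int[mu]_(t in `]x, +oo[) h t.
Proof.
move=> hi.
apply: (@improper_exhaustion _ _ (fun n => x + n.+1%:R^-1) (fun n => n.+1%:R)) => //.
- move=> y /=; rewrite in_itv/= andbT => x0; near=> n; apply/andP; split.
    rewrite -lerBrDl -[leRHS]invrK lef_pV2 ?posrE ?invr_gt0 ?subr_gt0//.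
    by near: n; exact: near_le_natS.
  by near: n; exact: near_le_natS.
- by move=> n; near=> c; near: c; apply: nbhs_right_le; rewrite ltrDl invr_gt0.
- by move=> n; near=> d; near: d; apply: nbhs_pinfty_ge; rewrite num_real.
- exists ([set c | x < c], setT) => /=.
    split; last exact: filterT.
    exact: nbhs_right_gt.
  move=> [c d]/= [c0 _] y /=; rewrite !in_itv/= andbT => /andP[+ _].
  exact: lt_le_trans.
Unshelve. all: by end_near. Qed.

Lemma improper_below x h : 0 < x -> mu.-integrable `]0, x[ (EFin \o h) ->
  \int[mu]_(t in `[cd.1, cd.2]) h t @[cd --> filter_prod 0^'+ x^'-] -->
  \int[mu]_(t in `]0, x[) h t.
Proof.
move=> x0 hi.
apply: (@improper_exhaustion _ _ (fun n => n.+1%:R^-1) (fun n => x - n.+1%:R^-1)) => //.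
- move=> y /=; rewrite in_itv/= => /andP[y0 yx]; near=> n; apply/andP; split.
    rewrite -[leRHS]invrK lef_pV2 ?posrE ?invr_gt0//.
    by near: n; exact: near_le_natS.
  rewrite lerBrDr -lerBrDl -[leRHS]invrK lef_pV2 ?posrE ?invr_gt0 ?subr_gt0//.
  by near: n; exact: near_le_natS.
- by move=> n; near=> c; near: c; apply: nbhs_right_le; rewrite invr_gt0.
- by move=> n; near=> d; near: d; apply: nbhs_left_ge; rewrite gtrBl invr_gt0.
- exists ([set c | 0 < c], [set d | d < x]) => /=.
    split; [exact: nbhs_right_gt|exact: nbhs_left_lt].
  move=> [c d]/= [c0 dx] y /=; rewrite !in_itv/= => /andP[cy yd].
  by rewrite (lt_le_trans c0 cy) (le_lt_trans yd dx).
Unshelve. all: by end_near. Qed.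

Lemma natSV_cvg0 : (n.+1%:R^-1 : R) @[n --> \oo] --> (0 : R)^'+.
Proof.
move=> A [e /= e0 He]; change (\forall n \near \oo, A (n.+1%:R^-1)).
near=> n; apply: He; last by rewrite /= invr_gt0.
rewrite /= sub0r normrN ger0_norm ?invr_ge0// -[ltRHS]invrK ltf_pV2 ?posrE ?invr_gt0//.
apply: (@lt_le_trans _ _ (e^-1 + 1)); first by rewrite ltrDl.
by near: n; exact: near_le_natS.
Unshelve. all: by end_near. Qed.

Lemma natS_cvgy : (n.+1%:R : R) @[n --> \oo] --> +oo.
Proof.
move=> A [M [Mr HM]]; change (\forall n \near \oo, A (n.+1%:R)).
near=> n; apply: HM.
apply: (@lt_le_trans _ _ (M + 1)); first by rewrite ltrDl.
by near: n; exact: near_le_natS.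
Unshelve. all: by end_near. Qed.

Lemma FTC_pos F f (l0 ly : R) :
  (forall t, 0 < t -> is_derive t 1 F (f t)) ->
  (forall t, 0 < t -> {for t, continuous f}) ->
  mu.-integrable `]0, +oo[ (EFin \o f) ->
  F t @[t --> 0^'+] --> l0 -> F t @[t --> +oo] --> ly ->
  \int[mu]_(t in `]0, +oo[) f t = ly - l0.
Proof.
move=> dF cf fi F0 Fy; have /cvg_lim <- // := improper_pos_seq fi.
apply: cvg_lim => //.
have -> : (fun n => \int[mu]_(t in `[n.+1%:R^-1, n.+1%:R]) f t) =
  (fun n => F n.+1%:R - F n.+1%:R^-1).
  apply/funext => n; apply: (@FTC _ F f) => [|t /andP[nt _]|t /andP[nt _]].
  - by apply: (@le_trans _ _ 1); rewrite ?invf_le1// ler1n.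
  - by apply: dF; apply: lt_le_trans nt; rewrite invr_gt0.
  - by apply: cf; apply: lt_le_trans nt; rewrite invr_gt0.
apply: cvgB; first exact: (cvg_comp _ _ natS_cvgy Fy).
exact: (cvg_comp _ _ natSV_cvg0 F0).
Qed.

(** The substitution is made on compact intervals; these and their images under the dilation both
    exhaust the half-line. *)
Lemma Rintegral_scale h s : 0 < s ->
  (forall t, 0 < t -> {for t, continuous h}) ->
  mu.-integrable `]0, +oo[ (EFin \o h) ->
  mu.-integrable `]0, +oo[ (EFin \o (fun t => h (s * t))) ->
  \int[mu]_(t in `]0, +oo[) h (s * t) = s^-1 * \int[mu]_(t in `]0, +oo[) h t.
Proof.
move=> s0 ch hi hsi; have := improper_pos_seq hsi; move/cvg_lim => <- //.
apply: cvg_lim => //.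
have -> : (fun n => \int[mu]_(t in `[n.+1%:R^-1, n.+1%:R]) h (s * t)) =
    (fun n => s^-1 * \int[mu]_(t in `[s * n.+1%:R^-1, s * n.+1%:R]) h t).
  apply/funext => n; set c := n.+1%:R^-1; set d := n.+1%:R.
  have c0 : 0 < c by rewrite invr_gt0.
  have cd : c <= d by apply: (@le_trans _ _ 1); rewrite ?invf_le1// ler1n.
  have dM t : is_derive t 1 (fun t => s * t) s.
    have -> : (fun t => s * t) = s \*: (@id R) by [].
    by apply: is_derive_eq; rewrite scaler1.
  have d1 : (fun t : R => s * t)^`()%classic = fun=> s.
    by apply/funext => t; rewrite derive1E; have [_ ->] := dM t.
  rewrite /Rintegral (@integration_by_substitution_increasing _ (fun t => s * t) h c d)//.
  - rewrite d1 [X in s^-1 * fine X](_ : _ = (\int[mu]_(x in `[c, d]) ((h (s * x) * s)%:E))%E)//.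
    have i1 : mu.-integrable `[c, d] (EFin \o (fun t => h (s * t))).
      apply: integrableS hsi => // t /=; rewrite !in_itv/= andbT => /andP[+ _].
      exact: lt_le_trans.
    have mcd : measurable (`[c, d]%classic : set RT) by exact: measurable_itv.
    have := RintegralZr s mcd i1; rewrite /Rintegral => ->.
    by rewrite mulrCA mulVf ?mulr1// gt_eqF.
  - by move=> x y _ _; rewrite ltr_pM2l.
  - by rewrite d1 => x _; exact: cvg_cst.
  - by rewrite d1; exact: is_cvg_cst.
  - by rewrite d1; exact: is_cvg_cst.
  - split; first by move=> x _; have [] := dM x.
      by apply: cvg_at_right_filter; apply: (is_derive_continuous (dM c)).
    by apply: cvg_at_left_filter; apply: (is_derive_continuous (dM d)).
  - apply: within_continuousP => t /=; rewrite in_itv/= => /andP[ct _].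
    by apply: ch; apply: lt_le_trans ct; rewrite mulr_gt0.
apply: cvgMl_tmp; apply: improper_seq => //.
- move=> x /=; rewrite in_itv/= andbT => x0; near=> n; apply/andP; split.
    rewrite -ler_pdivlMl// -[leRHS]invrK lef_pV2 ?posrE ?invr_gt0 ?mulr_gt0 ?invr_gt0//.
    by near: n; exact: near_le_natS.
  rewrite -ler_pdivrMl//.
  by near: n; exact: near_le_natS.
- move=> n x /=; rewrite !in_itv/= andbT => /andP[+ _]; apply: lt_le_trans.
  by rewrite mulr_gt0 ?invr_gt0.
Unshelve. all: by end_near. Qed.

(** The power [t^u], built from [ln] exactly as [real_powmx], so that the two agree on real scalar
    matrices for every [t] ([real_powmx_real]). *)
Definition pw u t : R := expR (u * ln t).

Lemma pw_gt0 u t : 0 < pw u t. Proof. exact: expR_gt0. Qed.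

Lemma pw_ge0 u t : 0 <= pw u t. Proof. exact: expR_ge0. Qed.

Lemma pwD u v t : pw (u + v) t = pw u t * pw v t.
Proof. by rewrite /pw mulrDl expRD. Qed.

Lemma pw1 t : 0 < t -> pw 1 t = t.
Proof. by move=> t0; rewrite /pw mul1r lnK. Qed.

Lemma pwN1 t : 0 < t -> pw (- 1) t = t^-1.
Proof. by move=> t0; rewrite /pw mulN1r expRN lnK. Qed.

Lemma pwM u s t : 0 < s -> 0 < t -> pw u (s * t) = pw u s * pw u t.
Proof. by move=> s0 t0; rewrite /pw lnM ?posrE// mulrDr expRD. Qed.

Lemma is_derive_pw u t : 0 < t -> is_derive t 1 (pw u) (u * pw (u - 1) t).
Proof.
move=> t0; have dl := is_derive1_ln t0.
have -> : pw u = expR \o (u \*: @ln R) by [].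
apply: is_derive_eq.
rewrite pwD pwN1// /GRing.scale/= mulrCA.
by rewrite [X in u * X]mulrC.
Qed.

Lemma is_derive_expRNM s t :
  is_derive t 1 (fun t => expR (- (s * t))) (- s * expR (- (s * t))).
Proof.
have -> : (fun t => expR (- (s * t))) = expR \o (- s \*: @id R).
  by apply/funext => y /=; rewrite /GRing.scale/= mulNr.
apply: is_derive_eq; rewrite /GRing.scale/= mulr1 mulrC.
by rewrite -mulNr.
Qed.

(** A single term of the exponential series at [s t], of index at least [u], already dominates the
    power. *)
Lemma pw_le_exp u s : 0 < s ->
  exists2 C, 0 < C & forall t, 1 <= t -> pw u t <= C * expR (s * t).
Proof.
move=> s0; have [n un] : exists n : nat, u <= n.+1%:R.
  by have [n _ /(_ n (leqnn _))] := near_le_natS u; exists n.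
exists (n.+1`!%:R / s ^+ n.+1); first by rewrite divr_gt0// exprn_gt0.
move=> t t1; have t0 : 0 < t by exact: lt_le_trans t1.
apply: (@le_trans _ _ (t ^+ n.+1)).
  rewrite /pw -[in leRHS](lnK t0) -expRM_natl ler_expR ler_wpM2r//.
  exact: ln_ge0.
have := expR_ge1Dxn n (mulr_ge0 (ltW s0) (ltW t0)).
rewrite -lerBrDl => h; rewrite mulrAC ler_pdivlMr ?exprn_gt0//.
rewrite -exprMn mulrC -ler_pdivrMl ?ltr0n ?fact_gt0//.
rewrite mulrC [t * s]mulrC [leLHS]mulrC; apply: le_trans h _.
by rewrite gerBl.
Qed.

Lemma pw_le1 u t : 0 <= u -> 0 < t <= 1 -> pw u t <= 1.
Proof.
move=> u0 /andP[t0 t1]; rewrite /pw -expR0 ler_expR mulr_ge0_le0//.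
exact: ln_le0.
Qed.

Lemma pw_ge1 u t : 0 <= u -> 1 <= t -> 1 <= pw u t.
Proof. by move=> u0 t1; rewrite /pw -expR0 ler_expR mulr_ge0// ln_ge0. Qed.

Lemma continuous_pw u t : 0 < t -> {for t, continuous (pw u)}.
Proof. by move=> t0; apply: is_derive_continuous (is_derive_pw u t0). Qed.

Lemma continuous_expRNM s t : {for t, continuous (fun t => expR (- (s * t)))}.
Proof. exact: is_derive_continuous (is_derive_expRNM s t). Qed.

(** The integrand lies below [dH], the derivative of the bounded function
    [H = - (K / u) / (1 + t^u)], so its integrals over compact intervals are at most [K / u]. One
    majorant serves both ends of the half-line. *)
Lemma integrable_gamma u s : 0 < u -> 0 < s ->
  mu.-integrable `]0, +oo[ (EFin \o (fun t => pw (u - 1) t * expR (- (s * t)))).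
Proof.
move=> u0 s0; have [C C0 HC] := pw_le_exp (u + u) s0.
(* For [t <= 1] one has [(1 + t^u)^2 <= 4]; for [t > 1] it is at most [4 t^(2u) <= 4 C e^(s t)]. The
   constant covers both cases. *)
pose K := 4 + 4 * C.
have bound t : 0 < t -> expR (- (s * t)) * (1 + pw u t) ^+ 2 <= K.
  move=> t0; have [t1|t1] := leP t 1.
    have e1 : expR (- (s * t)) <= 1.
      by rewrite -expR0 ler_expR oppr_le0 mulr_ge0// ltW.
    have p1 : pw u t <= 1 by apply: pw_le1; [exact: ltW|rewrite t0].
    have p0 := pw_gt0 u t.
    apply: (@le_trans _ _ (1 * 4)); last by rewrite mul1r lerDl mulr_ge0// ltW.
    by apply: ler_pM => //; [exact: sqr_ge0|nra].
  have p1 : 1 <= pw u t by apply: pw_ge1; exact: ltW.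
  have := HC t (ltW t1); rewrite pwD expRN => h.
  rewrite ler_pdivrMl ?expR_gt0//.
  apply: (@le_trans _ _ (4 * (pw u t * pw u t))); first by nra.
  have := expR_gt0 (s * t) => e0.
  by rewrite /K; nra.
have K0 : 0 < K by rewrite /K; lra.
pose H t := - (K / u) * (1 + pw u t)^-1.
pose dH t := K * pw (u - 1) t * (1 + pw u t) ^- 2.
have p0 t : 0 < 1 + pw u t by rewrite addr_gt0// pw_gt0.
have isH t : 0 < t -> is_derive t 1 H (dH t).
  move=> t0; have d1 := is_derive_pw u t0.
  have d2 : is_derive t 1 (fun t => 1 + pw u t) (u * pw (u - 1) t).
    have -> : (fun t => 1 + pw u t) = cst 1 + pw u by [].
    by apply: is_derive_eq; rewrite add0r.
  have nz : (fun t => 1 + pw u t) t != 0 by rewrite gt_eqF.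
  have d3 := is_deriveV (f := (fun t => 1 + pw u t)) nz d2.
  have -> : H = - (K / u) \*: (fun t => (1 + pw u t)^-1) by [].
  apply: is_derive_eq.
  rewrite /GRing.scale/= /dH; field.
  by rewrite !gt_eqF.
have contdH t : 0 < t -> {for t, continuous dH}.
  move=> t0; have c1 := continuous_pw (u := u - 1) t0; have c2 := continuous_pw (u := u) t0.
  rewrite /dH; apply: cvgM; first by apply: cvgMl_tmp.
  apply: cvgV; first by rewrite expf_eq0/= gt_eqF.
  have -> : (fun t => (1 + pw u t) ^+ 2) = (fun t => (1 + pw u t) * (1 + pw u t)) by [].
  by apply: cvgM; apply: cvgD => //; exact: cvg_cst.
have conth t : 0 < t -> {for t, continuous (fun t => pw (u - 1) t * expR (- (s * t)))}.
  move=> t0; apply: cvgM; first exact: continuous_pw.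
  exact: continuous_expRNM.
have h_le t : 0 < t -> pw (u - 1) t * expR (- (s * t)) <= dH t.
  move=> t0; rewrite /dH -mulrA mulrCA ler_wpM2l ?pw_ge0//.
  by rewrite ler_pdivlMr ?exprn_gt0//; exact: bound.
apply: (@ge0_integrable_pos _ _ (K / u)) => //.
  by move=> t t0; rewrite mulr_ge0 ?expR_ge0 ?pw_ge0.
move=> c d c0 cd.
apply: (@le_trans _ _ (\int[mu]_(t in `[c, d]) dH t)).
  apply: le_Rintegral => //.
  - by apply: integrable_cc => t /andP[ct _]; apply: conth; exact: lt_le_trans ct.
  - by apply: integrable_cc => t /andP[ct _]; apply: contdH; exact: lt_le_trans ct.
  - by move=> t /=; rewrite in_itv/= => /andP[ct _]; apply: h_le; exact: lt_le_trans ct.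
have -> : \int[mu]_(t in `[c, d]) dH t = H d - H c.
  apply: (@FTC _ H dH c d cd) => t /andP[ct _].
    by apply: isH; exact: lt_le_trans ct.
  by apply: contdH; exact: lt_le_trans ct.
have Ku : 0 < K / u by rewrite divr_gt0.
have i1 : (1 + pw u c)^-1 <= 1 by rewrite invf_le1// lerDl ltW// pw_gt0.
have i2 : 0 <= (1 + pw u d)^-1 by rewrite invr_ge0 ltW.
by rewrite /H; nra.
Qed.

(** Equal to [Gamma(u) s^(-u)], see [Rgamma_scale]; [Rgamma u 1] is the real Gamma function. *)
Definition Rgamma u s : R :=
  \int[mu]_(t in `]0, +oo[) (pw (u - 1) t * expR (- (s * t))).

Lemma Rgamma_scale u s : 0 < u -> 0 < s -> Rgamma u s = pw (- u) s * Rgamma u 1.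
Proof.
move=> u0 s0; pose h t := pw (u - 1) t * expR (- (1 * t)).
have E t : t \in `]0, +oo[ -> h (s * t) = pw (u - 1) s * (pw (u - 1) t * expR (- (s * t))).
  rewrite in_itv/= andbT => t0.
  by rewrite /h pwM// mul1r mulrA.
have ig := integrable_gamma u0 s0.
have ch t : 0 < t -> {for t, continuous h}.
  move=> t0; apply: cvgM; first exact: continuous_pw.
  exact: continuous_expRNM.
have hi : mu.-integrable `]0, +oo[ (EFin \o h) by apply: integrable_gamma.
have hsi : mu.-integrable `]0, +oo[ (EFin \o (fun t => h (s * t))).
  have hsi' : mu.-integrable `]0, +oo[ (EFin \o (fun t => pw (u - 1) s * (pw (u - 1) t * expR (- (s * t))))).
    exact: integrableZR (mitv _) ig.
  by apply: eq_integrable_itv hsi' => t /E.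
have := Rintegral_scale s0 ch hi hsi.
rewrite (eq_Rint E) RintegralZl//=.
move=> hE; apply: (mulfI (lt0r_neq0 (pw_gt0 (u - 1) s))).
have uu : u - 1 + - u = -1 by ring.
by rewrite hE mulrA -pwD uu pwN1.
Qed.

Lemma Rgamma_rec u : 0 < u -> Rgamma (u + 1) 1 = u * Rgamma u 1.
Proof.
move=> u0; pose F t := pw u t * expR (- (1 * t)).
pose f t := u * (pw (u - 1) t * expR (- (1 * t))) - pw u t * expR (- (1 * t)).
have u10 : 0 < u + 1 by rewrite addr_gt0.
have i1 := integrable_gamma u0 ltr01; have i2 := integrable_gamma u10 ltr01.
rewrite addrK in i2.
have i3 : mu.-integrable `]0, +oo[ (EFin \o (fun t => u * (pw (u - 1) t * expR (- (1 * t))))).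
  exact: integrableZR (mitv _) i1.
have fi : mu.-integrable `]0, +oo[ (EFin \o f).
  exact: integrableBR (mitv _) i3 i2.
have cexp t := @continuous_expRNM 1 t.
have := @FTC_pos F f 0 0 _ _ fi.
rewrite subrr RintegralB// RintegralZl// -/(Rgamma u 1) => H.
apply/esym/eqP; rewrite -subr_eq0 /Rgamma addrK; apply/eqP; apply: H.
- move=> t t0; have d1 := is_derive_pw u t0; have d2 := is_derive_expRNM 1 t.
  have -> : F = pw u * (fun t => expR (- (1 * t))) by [].
  by apply: is_derive_eq; rewrite /GRing.scale/= /f; ring.
- move=> t t0; rewrite /f.
  by apply: contB; [apply: contZ|]; apply: contM => //; exact: continuous_pw.
- apply: (@squeeze_cvgr _ _ _ _ (cst 0) (pw u)).
  + near=> t; have t0 : 0 < t by near: t; exact: nbhs_right_gt.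
    rewrite /F mulr_ge0 ?expR_ge0//= ?pw_ge0// ler_piMr// ?pw_ge0//.
    by rewrite expR_le1 oppr_le0 mul1r ltW.
  + exact: cvg_cst.
  + have := powR_cvg0 u0; apply: cvg_trans; apply: near_eq_cvg; near=> t.
    have t0 : 0 < t by near: t; exact: nbhs_right_gt.
    by rewrite /powR gt_eqF.
- have [C C0 HC] := @pw_le_exp u (2^-1) (ltac:(by rewrite invr_gt0)).
  apply: (@squeeze_cvgr _ _ _ _ (cst 0) (fun t => C * expR (- (2^-1 * t)))).
  + near=> t; have t1 : 1 <= t by near: t; exact: nbhs_pinfty_ge.
    rewrite /F mulr_ge0 ?expR_ge0//= ?pw_ge0//.
    have -> : - (1 * t) = - (2^-1 * t) + - (2^-1 * t) by field.
    rewrite expRD mulrA ler_wpM2r ?expR_ge0// expRN ler_pdivrMr ?expR_gt0//.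
    exact: HC.
  + exact: cvg_cst.
  + rewrite -[X in _ --> X](mulr0 C); apply: cvgMl_tmp.
    have := @cvgr_expR R; apply: (cvg_comp (fun t => 2^-1 * t)).
    apply: gt0_cvgMry => //; exact: cvg_id.
Unshelve. all: by end_near. Qed.

Lemma Rgamma_gt0 u : 0 < u -> 0 < Rgamma u 1.
Proof.
move=> u0; have i1 := integrable_gamma u0 ltr01.
(* A lower bound of the integrand on [[1, 2]], where [0 <= ln t <= 1]. *)
pose m := expR (- `|u - 1|) * expR (- 2).
have m0 : 0 < m by rewrite mulr_gt0 ?expR_gt0.
have -> : Rgamma u 1 = \int[mu]_(t in `]0, +oo[) (pw (u - 1) t * expR (- (1 * t))) by [].
have sub : `[1, 2]%classic `<=` (`]0, +oo[%classic : set R).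
  by move=> t /=; rewrite !in_itv/= andbT => /andP[+ _]; exact: lt_le_trans.
apply: (@lt_le_trans _ _ (\int[mu]_(t in `[1, 2]) m)).
  rewrite Rintegral_cst//= mulr_gt0// lebesgue_measure_itv/= lte_fin ltr1n/=.
  by rewrite subr_gt0 ltr1n.
apply: (@le_trans _ _ (\int[mu]_(t in `[1, 2]) (pw (u - 1) t * expR (- (1 * t))))).
  apply: le_Rintegral => //.
  - by apply: integrable_cc => t _; exact: cvg_cst.
  - by apply: integrableS i1.
  - move=> t /=; rewrite in_itv/= => /andP[t1 t2].
    have t0 : 0 < t by exact: lt_le_trans t1.
    apply: ler_pM; rewrite ?expR_ge0// ler_expR; last by rewrite lerN2 mul1r.
    have l0 : 0 <= ln t by exact: ln_ge0.
    have l1 : ln t <= 1.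
      have := @le_ln1Dx R (t - 1) ltac:(by lra); rewrite addrC subrK => h; lra.
    have := lerNnormlW (lexx `|u - 1|) => h.
    by have := normr_ge0 (u - 1); nra.
have nn t : 0 <= pw (u - 1) t * expR (- (1 * t)).
  by rewrite mulr_ge0 ?expR_ge0 ?pw_ge0.
rewrite /Rintegral fine_le//.
- by apply: integrable_fin_num => //; apply: integrableS i1.
- exact: integrable_fin_num.
- apply: ge0_subset_integral => //.
  + by have /measurable_int := i1.
  + by move=> t _; rewrite lee_fin.
Qed.

End PosLineGamma.

(** * Norms and real-linear functionals on complex matrices *)

Lemma cvg_bigsum (R : realType) (T I : Type) (F : set_system T) {FF : Filter F}
    (s : seq I) (f : I -> T -> R) (l : I -> R) :
  (forall i, f i x @[x --> F] --> l i) ->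
  \sum_(i <- s) f i x @[x --> F] --> \sum_(i <- s) l i.
Proof.
move=> hf; elim: s => [|i s IH].
  by under eq_cvg do rewrite big_nil; rewrite big_nil; exact: cvg_cst.
under eq_cvg do rewrite big_cons.
by rewrite big_cons; apply: cvgD.
Qed.

Section ComplexModulus.
Context {R : realType}.
Implicit Types z w : R[i].

(** The norm of [R[i]] takes its values in [R[i]]; this is the same modulus as a real number. *)
Definition cmod z : R := ComplexField.Normc.normc z.

Lemma cmodE z : `|z| = (cmod z)%:C.
Proof. by case: z => a b; rewrite normc_def. Qed.

Lemma cmod_ge0 z : 0 <= cmod z.
Proof. by case: z => a b; rewrite /cmod/= sqrtr_ge0. Qed.

Lemma cmodM z w : cmod (z * w) = cmod z * cmod w.
Proof. exact: ComplexField.Normc.normcM. Qed.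

Lemma cmodD z w : cmod (z + w) <= cmod z + cmod w.
Proof. exact: le_normcD. Qed.

Lemma cmodN z : cmod (- z) = cmod z.
Proof. exact: normcN. Qed.

Lemma cmod0 : cmod 0 = 0. Proof. exact: ComplexField.Normc.normc0. Qed.

Lemma cmod_real (x : R) : cmod x%:C = `|x|.
Proof. by rewrite /cmod/= expr0n/= addr0 sqrtr_sqr. Qed.

Lemma Re_le_cmod z : `|complex.Re z| <= cmod z.
Proof. by have := normc_ge_Re z; rewrite cmodE lecR. Qed.

Lemma Im_le_cmod z : `|complex.Im z| <= cmod z.
Proof.
case: z => a b; rewrite /cmod/= -sqrtr_sqr ler_wsqrtr// lerDr.
exact: sqr_ge0.
Qed.

Lemma cmod_le z : cmod z <= `|complex.Re z| + `|complex.Im z|.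
Proof.
rewrite {1}[z]complexE.
apply: le_trans (cmodD _ _) _; rewrite cmodM !cmod_real.
by rewrite [X in _ + X * _](_ : _ = 1) ?mul1r// /cmod/= expr0n/= add0r expr1n sqrtr1.
Qed.

Lemma cmod_natr n : cmod (n%:R : R[i]) = n%:R.
Proof. by rewrite -(rmorph_nat (real_complex R)) cmod_real ger0_norm. Qed.

Lemma cmodV z : cmod z^-1 = (cmod z)^-1.
Proof. exact: ComplexField.Normc.normcV. Qed.

End ComplexModulus.

Section MatrixNorm.
Context {R : realType} {N : nat}.
Local Notation M := 'M[R[i]]_N.
Implicit Types (A B X Y : M) (psi : M -> R).

(** Equivalent to the sup norm that defines the topology ([cvg_nrmP]), but real-valued and
    submultiplicative. The identity has norm [N], whence the factors [nrm 1%:M] below. *)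
Definition nrm A : R := \sum_i \sum_j cmod (A i j).

Lemma nrm_ge0 A : 0 <= nrm A.
Proof. by apply: sumr_ge0 => i _; apply: sumr_ge0 => j _; exact: cmod_ge0. Qed.

Lemma nrm0 : nrm 0 = 0.
Proof. by rewrite /nrm !big1// => i _; rewrite big1// => j _; rewrite mxE cmod0. Qed.

Lemma nrmD A B : nrm (A + B) <= nrm A + nrm B.
Proof.
rewrite /nrm -big_split; apply: ler_sum => i _.
by rewrite -big_split; apply: ler_sum => j _; rewrite mxE cmodD.
Qed.

Lemma nrmN A : nrm (- A) = nrm A.
Proof. by apply: eq_bigr => i _; apply: eq_bigr => j _; rewrite mxE cmodN. Qed.

Lemma nrmB A B : nrm (A - B) <= nrm A + nrm B.
Proof. by rewrite -(nrmN B); exact: nrmD. Qed.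

Lemma nrmZ (c : R[i]) A : nrm (c *: A) = cmod c * nrm A.
Proof.
rewrite /nrm mulr_sumr; apply: eq_bigr => i _.
by rewrite mulr_sumr; apply: eq_bigr => j _; rewrite mxE cmodM.
Qed.

Lemma entry_le_nrm A i j : cmod (A i j) <= nrm A.
Proof.
rewrite /nrm (bigD1 i)//= (bigD1 j)//= -addrA lerDl addr_ge0//.
  by apply: sumr_ge0 => k _; exact: cmod_ge0.
by apply: sumr_ge0 => k _; apply: sumr_ge0 => l _; exact: cmod_ge0.
Qed.

Lemma nrm_sum (I : Type) (s : seq I) (P : pred I) (F : I -> M) :
  nrm (\sum_(i <- s | P i) F i) <= \sum_(i <- s | P i) nrm (F i).
Proof.
elim/big_ind2 : _ => //; first by rewrite nrm0.
by move=> A a B b Aa Bb; apply: le_trans (nrmD _ _) _; exact: lerD.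
Qed.

Lemma cmod_sum (I : Type) (s : seq I) (P : pred I) (F : I -> R[i]) :
  cmod (\sum_(i <- s | P i) F i) <= \sum_(i <- s | P i) cmod (F i).
Proof.
elim/big_ind2 : _ => //; first by rewrite cmod0.
by move=> A a B b Aa Bb; apply: le_trans (cmodD _ _) _; exact: lerD.
Qed.

Lemma nrmM A B : nrm (A *m B) <= nrm A * nrm B.
Proof.
rewrite {1}/nrm.
apply: (@le_trans _ _ (\sum_i \sum_k cmod (A i k) * nrm B)).
  apply: ler_sum => i _.
  apply: (@le_trans _ _ (\sum_j \sum_k cmod (A i k) * cmod (B k j))).
    apply: ler_sum => j _; rewrite mxE; apply: le_trans (cmod_sum _ _ _) _.
    by apply: ler_sum => k _; rewrite cmodM.
  rewrite exchange_big; apply: ler_sum => k _; rewrite -mulr_sumr.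
  apply: ler_wpM2l; first exact: cmod_ge0.
  rewrite /nrm [leRHS](bigD1 k)//= lerDl.
  by apply: sumr_ge0 => i' _; apply: sumr_ge0 => l _; exact: cmod_ge0.
by rewrite /nrm mulr_suml; apply: ler_sum => i _; rewrite mulr_suml.
Qed.

Lemma nrmMX A X n : nrm (X *m A ^+ n) <= nrm X * nrm A ^+ n.
Proof.
elim: n => [|n IH]; first by rewrite expr0 mulmx1 mulr1.
rewrite exprSr mulmxA exprSr mulrA; apply: le_trans (nrmM _ _) _.
by apply: ler_wpM2r => //; exact: nrm_ge0.
Qed.

Lemma nrmX A n : nrm (A ^+ n) <= nrm (1%:M : M) * nrm A ^+ n.
Proof. by have := nrmMX A 1%:M n; rewrite mul1mx. Qed.

(* Limits, series and integrals of matrices are reduced to real ones through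
   these functionals, which separate points (RlinP). *)
Definition Rlin psi := (forall A B, psi (A + B) = psi A + psi B) /\
  (forall (c : R) A, psi (c%:C *: A) = c * psi A).

Lemma RlinD psi A B : Rlin psi -> psi (A + B) = psi A + psi B.
Proof. by case. Qed.

Lemma RlinZ psi (c : R) A : Rlin psi -> psi (c%:C *: A) = c * psi A.
Proof. by case. Qed.

Lemma Rlin0 psi : Rlin psi -> psi 0 = 0.
Proof. by case=> _ h; rewrite -(scale0r 0) -(rmorph0 (real_complex R)) h mul0r. Qed.

Lemma RlinN psi A : Rlin psi -> psi (- A) = - psi A.
Proof. by move=> h; rewrite -scaleN1r -(rmorphN1 (real_complex R)) RlinZ// mulN1r. Qed.

Lemma RlinB psi A B : Rlin psi -> psi (A - B) = psi A - psi B.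
Proof. by move=> h; rewrite RlinD// RlinN. Qed.

Lemma Rlin_sum psi (I : Type) (s : seq I) (P : pred I) (F : I -> M) : Rlin psi ->
  psi (\sum_(i <- s | P i) F i) = \sum_(i <- s | P i) psi (F i).
Proof.
move=> h; elim/big_rec2 : _ => [|i A a _ <-]; first exact: Rlin0.
by rewrite RlinD.
Qed.

Lemma Rlin_Re i j : Rlin (fun A => complex.Re (A i j)).
Proof.
by split => [A B|c A]; rewrite !mxE ?raddfD//; case: (A i j) => a b /=; rewrite mul0r subr0.
Qed.

Lemma Rlin_Im i j : Rlin (fun A => complex.Im (A i j)).
Proof.
by split => [A B|c A]; rewrite !mxE ?raddfD//; case: (A i j) => a b /=; rewrite mul0r addr0.
Qed.

Lemma Rlin_mull psi X : Rlin psi -> Rlin (fun A => psi (X *m A)).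
Proof.
by move=> h; split => [A B|c A]; rewrite ?mulmxDr ?RlinD// -scalemxAr RlinZ.
Qed.

Lemma Rlin_mulr psi X : Rlin psi -> Rlin (fun A => psi (A *m X)).
Proof.
by move=> h; split => [A B|c A]; rewrite ?mulmxDl ?RlinD// -scalemxAl RlinZ.
Qed.

Lemma RlinP A B : (forall psi, Rlin psi -> psi A = psi B) -> A = B.
Proof.
move=> h; apply/matrixP => i j; apply/eqP; rewrite eq_complex.
by rewrite (h _ (Rlin_Re i j)) (h _ (Rlin_Im i j)) !eqxx.
Qed.

Lemma Rlin_decomp psi A : Rlin psi -> psi A = \sum_i \sum_j
  (complex.Re (A i j) * psi (delta_mx i j) + complex.Im (A i j) * psi ('i *: delta_mx i j)).
Proof.
move=> h; rewrite {1}[A]matrix_sum_delta Rlin_sum//; apply: eq_bigr => i _.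
rewrite Rlin_sum//; apply: eq_bigr => j _.
rewrite {1}[A i j]complexE scalerDl RlinD// RlinZ//; congr (_ + _).
by rewrite mulrC -scalerA RlinZ.
Qed.

Lemma Rlin_bound psi : Rlin psi ->
  exists2 K, 0 <= K & forall A, `|psi A| <= K * nrm A.
Proof.
move=> h; exists (\sum_i \sum_j (`|psi (delta_mx i j)| + `|psi ('i *: delta_mx i j)|)).
  by apply: sumr_ge0 => i _; apply: sumr_ge0 => j _; rewrite addr_ge0.
move=> A; rewrite (Rlin_decomp _ h) mulr_suml.
apply: le_trans (ler_norm_sum _ _ _) _; apply: ler_sum => i _.
rewrite mulr_suml.
apply: le_trans (ler_norm_sum _ _ _) _; apply: ler_sum => j _.
apply: le_trans (ler_normD _ _) _; rewrite mulrDl !normrM.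
apply: lerD; rewrite mulrC ler_wpM2l//.
  exact: le_trans (Re_le_cmod _) (entry_le_nrm _ _ _).
exact: le_trans (Im_le_cmod _) (entry_le_nrm _ _ _).
Qed.

Lemma nrm_le A : nrm A <= \sum_i \sum_j (`|complex.Re (A i j)| + `|complex.Im (A i j)|).
Proof. by apply: ler_sum => i _; apply: ler_sum => j _; exact: cmod_le. Qed.

Section Limits.
Context {T : Type} (F : set_system T) {FF : ProperFilter F}.
Implicit Types (u : T -> M) (L : M).

Lemma cvg_nrmP u L : u x @[x --> F] --> L <-> nrm (u x - L) @[x --> F] --> (0 : R).
Proof.
split => [/cvg_ballP uL|uL].
  apply/cvgrPdist_lt => e e0.
  (* The [N * N] entries together contribute strictly less than [e]; the successor also keeps the
     denominator nonzero when [N = 0]. *)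
  pose e' : R[i] := (e / (N * N).+1%:R)%:C.
  have e'0 : 0 < e' by rewrite ltcR divr_gt0.
  apply: filterS (uL _ e'0) => x [_ bx].
  rewrite sub0r normrN ger0_norm ?nrm_ge0//.
  apply: (@le_lt_trans _ _ (\sum_(i < N) \sum_(j < N) (e / (N * N).+1%:R))).
    apply: ler_sum => i _; apply: ler_sum => j _; rewrite !mxE.
    have := bx i j; rewrite /ball/= cmodE ltcR -cmodN opprB => /ltW.
    by [].
  rewrite !sumr_const !card_ord -mulrnA -[X in X < _]mulr_natr mulrAC ltr_pdivrMr//.
  by rewrite ltr_pM2l// ltr_nat.
apply/cvg_ballP => e e0.
have eE : e = (complex.Re e)%:C by rewrite RRe_real// gtr0_real.
have e'0 : 0 < complex.Re e by rewrite -ltcR -eE.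
move/cvgrPdist_lt : uL => /(_ _ e'0); apply: filterS => x.
rewrite sub0r normrN ger0_norm ?nrm_ge0// => h; split=> // i j.
rewrite /ball/= cmodE eE ltcR; apply: le_lt_trans h.
by rewrite -cmodN opprB; have := entry_le_nrm (u x - L) i j; rewrite !mxE.
Qed.

Lemma Rlin_cvg u L psi : Rlin psi -> u x @[x --> F] --> L ->
  psi (u x) @[x --> F] --> psi L.
Proof.
move=> h /cvg_nrmP uL; have [K K0 hK] := Rlin_bound h.
apply/cvgrPdist_lt => e e0.
have K1 : 0 < K + 1 by rewrite ltr_wpDl.
have eK : 0 < e / (K + 1) by rewrite divr_gt0.
move/cvgrPdist_lt : uL => /(_ _ eK); apply: filterS => x.
rewrite sub0r normrN ger0_norm ?nrm_ge0// => hx.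
rewrite distrC -RlinB//.
apply: le_lt_trans (hK _) _; rewrite ltr_pdivlMr// in hx.
by apply: le_lt_trans hx; rewrite mulrC ler_wpM2l ?nrm_ge0// lerDl.
Qed.

Lemma cvg_RlinP u L : (forall psi, Rlin psi -> psi (u x) @[x --> F] --> psi L) ->
  u x @[x --> F] --> L.
Proof.
move=> h; apply/cvg_nrmP.
pose b x := \sum_i \sum_j (`|complex.Re ((u x - L) i j)| + `|complex.Im ((u x - L) i j)|).
apply: (@squeeze_cvgr _ _ _ _ (cst 0) b).
- by apply: nearW => x; rewrite nrm_ge0 nrm_le.
- exact: cvg_cst.
have term psi : Rlin psi -> `|psi (u x - L)| @[x --> F] --> 0.
  move=> hp; rewrite -(normr0 R); apply: cvg_norm.
  under eq_cvg do rewrite RlinB//.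
  have c : psi (u x) - psi L @[x --> F] --> psi L - psi L.
    by apply: cvgB; [exact: h|exact: cvg_cst].
  by rewrite subrr in c.
have z0 : (0 : R) = \sum_(i < N) \sum_(j < N) 0 by rewrite !big1.
rewrite z0; apply: cvg_bigsum => i; apply: cvg_bigsum => j.
have := cvgD (term _ (Rlin_Re i j)) (term _ (Rlin_Im i j)).
by rewrite addr0; apply.
Qed.

Lemma cvg_mx_lim u L : u x @[x --> F] --> L -> lim (u x @[x --> F]) = L.
Proof. by move=> h; apply: cvg_lim h; exact: norm_hausdorff. Qed.

Lemma Rlin_lim u psi : Rlin psi -> cvg (u x @[x --> F]) ->
  psi (u x) @[x --> F] --> psi (lim (u x @[x --> F])).
Proof. by move=> h cu; apply: Rlin_cvg. Qed.

End Limits.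

Lemma Rlin_series psi (u : nat -> M) n : Rlin psi ->
  psi (series u n) = series (psi \o u) n.
Proof. by move=> h; rewrite /series/= Rlin_sum. Qed.

Lemma Rlin_lim_series psi (u : nat -> M) : Rlin psi -> cvgn (series u) ->
  cvgn (series (psi \o u)) /\ limn (series (psi \o u)) = psi (limn (series u)).
Proof.
move=> h cu.
have c : series (psi \o u) n @[n --> \oo] --> psi (limn (series u)).
  by under eq_cvg do rewrite -Rlin_series//; exact: Rlin_lim.
split; first by apply/cvg_ex; eexists; exact: c.
exact: cvg_lim c.
Qed.

(** Every functional of the series converges absolutely; the limit matrix is assembled from the real
    and imaginary parts of the entries. *)
Lemma cvg_series_nrm (u : nat -> M) (b : nat -> R) :
  (forall n, nrm (u n) <= b n) -> cvgn (series b) -> cvgn (series u).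
Proof.
move=> ub cb.
have cpsi psi : Rlin psi -> cvgn (series (psi \o u)).
  move=> h; have [K K0 hK] := Rlin_bound h.
  apply: (@dominated_cvg_series _ _ (fun n => K * b n)) => [n|].
    by apply: le_trans (hK _) _; exact: ler_wpM2l.
  have -> : (fun n => K * b n) = K *: b by [].
  exact: is_cvg_seriesZ.
pose L : M := \matrix_(i, j)
  ((limn (series ((fun A : M => complex.Re (A i j)) \o u))) +i*
   (limn (series ((fun A : M => complex.Im (A i j)) \o u)))).
apply/cvg_ex; exists L; apply: cvg_RlinP => psi h.
have cij i j : complex.Re (series u n i j) @[n --> \oo] --> complex.Re (L i j).
  rewrite /L mxE/=.
  under eq_cvg do rewrite (Rlin_series _ _ (Rlin_Re i j)).
  exact: cpsi (Rlin_Re i j).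
have cij' i j : complex.Im (series u n i j) @[n --> \oo] --> complex.Im (L i j).
  rewrite /L mxE/=.
  under eq_cvg do rewrite (Rlin_series _ _ (Rlin_Im i j)).
  exact: cpsi (Rlin_Im i j).
under eq_cvg do rewrite (Rlin_decomp _ h).
rewrite (Rlin_decomp _ h).
apply: cvg_bigsum => i; apply: cvg_bigsum => j.
by apply: cvgD; apply: cvgMr_tmp; [exact: cij|exact: cij'].
Qed.

End MatrixNorm.

(** * Matrix exponential and powers *)

Section MatrixExp.
Context {R : realType} {N : nat}.
Local Notation M := 'M[R[i]]_N.
Implicit Types (A B X Y : M) (psi : M -> R).

Lemma nrm_lim_le (T : Type) (F : set_system T) {FF : ProperFilter F}
    (u : T -> M) L (K : R) : u x @[x --> F] --> L ->
  (\forall x \near F, nrm (u x) <= K) -> nrm L <= K.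
Proof.
move=> /cvg_nrmP uL uK; apply/ler_addgt0Pr => e e0.
move/cvgrPdist_lt : uL => /(_ _ e0) h.
have [x [h1 h2]] := filter_ex (filterI h uK).
rewrite sub0r normrN ger0_norm ?nrm_ge0// in h1.
have -> : L = u x - (u x - L) by rewrite opprB addrCA subrr addr0.
by apply: le_trans (nrmB _ _) _; apply: lerD => //; exact: ltW.
Qed.

Lemma cvg_mulmx (T : Type) (F : set_system T) {FF : ProperFilter F}
    (u v : T -> M) A B : u x @[x --> F] --> A -> v x @[x --> F] --> B ->
  u x *m v x @[x --> F] --> A *m B.
Proof.
move=> uA vB; apply/cvg_nrmP.
have /cvg_nrmP uA' := uA; have /cvg_nrmP vB' := vB.
have c : nrm (u x - A) * (nrm (v x - B) + nrm B) + nrm A * nrm (v x - B)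
    @[x --> F] --> 0 * (0 + nrm B) + nrm A * 0.
  apply: cvgD; last by apply: cvgMl_tmp.
  by apply: cvgM => //; apply: cvgD => //; exact: cvg_cst.
rewrite mul0r mulr0 addr0 in c.
apply: (squeeze_cvgr _ (cvg_cst 0) c); apply: nearW => x.
rewrite nrm_ge0/=.
have -> : u x *m v x - A *m B = (u x - A) *m (v x - B + B) + A *m (v x - B).
  by rewrite subrK mulmxBl mulmxBr addrA subrK.
apply: le_trans (nrmD _ _) _; apply: lerD; apply: le_trans (nrmM _ _) _ => //.
by apply: ler_wpM2l; [exact: nrm_ge0|exact: nrmD].
Qed.

Lemma exprZmx (c : R[i]) A n : (c *: A) ^+ n = c ^+ n *: A ^+ n.
Proof.
elim: n => [|n IH]; first by rewrite !expr0 scale1r.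
by rewrite !exprS IH -!mulmxE -scalemxAl -scalemxAr scalerA.
Qed.

Lemma comm_mxX A B n : comm_mx A B -> comm_mx A (B ^+ n).
Proof.
move=> AB; elim: n => [|n IH]; first by rewrite expr0; exact: comm_mx1.
by rewrite exprS -mulmxE; exact: comm_mxM.
Qed.

Lemma factC (k : nat) : (k`!%:R^-1 : R[i]) = (k`!%:R^-1 : R)%:C.
Proof. by rewrite fmorphV/= rmorph_nat. Qed.

Lemma cmod_fact (k : nat) : cmod (k`!%:R^-1 : R[i]) = k`!%:R^-1.
Proof. by rewrite cmodV cmod_natr. Qed.

Definition exp_coefmx A (k : nat) : M := (k`!%:R^-1 : R[i]) *: A ^+ k.

Lemma nrm_exp_coefmx A k : nrm (exp_coefmx A k) <= nrm (1%:M : M) * (nrm A ^+ k / k`!%:R).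
Proof.
rewrite nrmZ cmod_fact mulrC mulrA ler_wpM2r ?invr_ge0//; exact: nrmX.
Qed.

Lemma cvg_exp_coefmx A : series (exp_coefmx A) n @[n --> \oo] --> mx_exp A.
Proof.
apply: (cvg_series_nrm (nrm_exp_coefmx A)); exact: cvg_series_exp_dom.
Qed.

Lemma Rlin_mx_exp psi A : Rlin psi ->
  series (fun k => psi (A ^+ k) / k`!%:R) n @[n --> \oo] --> psi (mx_exp A).
Proof.
move=> h; have -> : series (fun k => psi (A ^+ k) / k`!%:R) = psi \o series (exp_coefmx A).
  apply/funext => n /=; rewrite Rlin_series//; apply: eq_bigr => k _.
  by rewrite /= /exp_coefmx factC RlinZ// mulrC.
by apply: Rlin_cvg => //; exact: cvg_exp_coefmx.
Qed.

Lemma nrm_mx_exp X A : nrm (X *m mx_exp A) <= nrm X * expR (nrm A).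
Proof.
apply: (@nrm_lim_le _ \oo _ (fun n => X *m series (exp_coefmx A) n)).
  by apply: cvg_mulmx; [exact: cvg_cst|exact: cvg_exp_coefmx].
apply: nearW => n; rewrite /series/= mulmx_sumr.
apply: le_trans (nrm_sum _ _ _) _.
have h : series (exp_coeff (nrm A)) n <= expR (nrm A).
  rewrite /expR; apply: series_le_lim; last exact: is_cvg_series_exp_coeff.
  by move=> k; rewrite exp_coeff_ge0// nrm_ge0.
apply: le_trans (ler_wpM2l (nrm_ge0 X) h).
rewrite /series/= mulr_sumr; apply: ler_sum => k _.
rewrite /exp_coefmx -scalemxAr nrmZ cmod_fact mulrC /exp_coeff/= mulrA.
by rewrite ler_wpM2r ?invr_ge0//; exact: nrmMX.
Qed.

Lemma comm_mx_exp X A : comm_mx X A -> comm_mx X (mx_exp A).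
Proof.
move=> XA; apply: RlinP => psi h.
have h1 := Rlin_mx_exp (A := A) (Rlin_mull X h); have h2 := Rlin_mx_exp (A := A) (Rlin_mulr X h).
rewrite -(cvg_lim (@Rhausdorff R) h1) -(cvg_lim (@Rhausdorff R) h2).
congr (limn (series _)); apply/funext => k; congr (psi _ / _).
exact: comm_mxX.
Qed.

Lemma triangular_sum (p q : nat -> M) n :
  series (fun k => \sum_(i < k.+1) p (k - i)%N *m q i) n =
  \sum_(j < n) (series p (n - j)%N) *m q j.
Proof.
elim: n => [|n IH]; first by rewrite /series/= big_geq// big_ord0.
rewrite seriesSr IH [RHS]big_ord_recr/= subSn// subnn.
rewrite big_ord_recr/= subnn addrA; congr (_ + _); last first.
  by rewrite /series/= big_nat1.
rewrite -big_split/=; apply: eq_bigr => j _.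
by rewrite subSn ?seriesSr ?mulmxDl// ltnW.
Qed.

(** The product of the partial sums minus the triangular sum is the sum over [j] of
    [(S_n - S_(n-j)) q_j], where [S] are the partial sums of [p]. Each term tends to 0 and is
    dominated by a multiple of [c j], so Tannery's theorem applies. *)
Lemma cauchy_product (p q : nat -> M) (b c : nat -> R) :
  (forall n, nrm (p n) <= b n) -> (forall n, nrm (q n) <= c n) ->
  cvgn (series b) -> cvgn (series c) ->
  series (fun k => \sum_(i < k.+1) p (k - i)%N *m q i) n @[n --> \oo] -->
  limn (series p) *m limn (series q).
Proof.
move=> pb qc cb cc.
have b0 n : 0 <= b n by apply: le_trans (pb n); exact: nrm_ge0.
have c0 n : 0 <= c n by apply: le_trans (qc n); exact: nrm_ge0.
have cp : series p n @[n --> \oo] --> limn (series p) by exact: cvg_series_nrm cb.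
have cq : series q n @[n --> \oo] --> limn (series q) by exact: cvg_series_nrm cc.
pose d n j := if (j < n)%N then nrm (series p n - series p (n - j)%N) * c j else 0.
have sp n : nrm (series p n) <= limn (series b).
  apply: le_trans (nrm_sum _ _ _) _; apply: le_trans (series_le_lim n b0 cb).
  exact: ler_sum.
have d_le n j : `|d n j| <= (limn (series b) + limn (series b)) * c j.
  rewrite /d; case: ifPn => _; last first.
    rewrite normr0 mulr_ge0// addr_ge0//; apply: le_trans (series_le_lim 0 b0 cb); exact: sumr_ge0.
  rewrite ger0_norm ?mulr_ge0 ?nrm_ge0// ler_wpM2r//.
  by apply: le_trans (nrmB _ _) _; exact: lerD.
have d0 j : d n j @[n --> \oo] --> 0.
  have h : nrm (series p n - series p (n - j)%N) * c j @[n --> \oo] --> 0 * c j.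
    apply: cvgMr_tmp.
    have /cvg_nrmP c1 := cp.
    have c2 : nrm (series p (n - j)%N - limn (series p)) @[n --> \oo] --> 0.
      apply: (@cvg_comp _ _ _ (fun n => (n - j)%N) (fun n => nrm (series p n - limn (series p))) _ _ _ _ c1).
      exact: cvg_subnr.
    have c12 := cvgD c1 c2; rewrite addr0 in c12.
    apply: (squeeze_cvgr _ (cvg_cst 0) (c12 _)); apply: nearW => n; rewrite nrm_ge0/=.
    have -> : series p n - series p (n - j)%N = (series p n - limn (series p)) - (series p (n - j)%N - limn (series p)).
      by rewrite opprB addrA subrK.
    exact: nrmB.
  rewrite mul0r in h; apply: cvg_trans h; apply: near_eq_cvg; near=> n.
  rewrite /d ifT//; near: n; exact: nbhs_infty_gt.
have cvc : cvgn (series (fun j => (limn (series b) + limn (series b)) * c j)).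
  have -> : (fun j => (limn (series b) + limn (series b)) * c j) = (limn (series b) + limn (series b)) *: c by [].
  exact: is_cvg_seriesZ.
have tan : limn (series (d n)) @[n --> \oo] --> limn (series (fun=> 0 : R)).
  by apply: (@tannery R nat \oo _ d (fun=> 0) (fun j => (limn (series b) + limn (series b)) * c j)) => //; apply: nearW.
have z : limn (series (fun=> 0 : R)) = 0.
  by apply/cvg_lim => //; rewrite /series/=; apply: cvg_near_cst; apply: nearW => n; rewrite big1.
rewrite z in tan.
have E n : series (fun k => \sum_(i < k.+1) p (k - i)%N *m q i) n =
    series p n *m series q n - \sum_(j < n) (series p n - series p (n - j)%N) *m q j.
  rewrite triangular_sum; apply/esym/eqP; rewrite subr_eq -big_split/=.
  rewrite [series q n](_ : _ = \sum_(j < n) q j); last by rewrite /series/= big_mkord.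
  rewrite mulmx_sumr; apply/eqP; apply: eq_bigr => j _.
  by rewrite -mulmxDl addrC subrK.
suff cE : series p n *m series q n - \sum_(j < n) (series p n - series p (n - j)%N) *m q j
    @[n --> \oo] --> limn (series p) *m limn (series q) - 0.
  rewrite subr0 in cE; apply: cvg_trans cE.
  by apply: near_eq_cvg; apply: nearW => n; rewrite E.
have c1 : series p n *m series q n @[n --> \oo] --> limn (series p) *m limn (series q).
  exact: cvg_mulmx cp cq.
suff c2 : \sum_(j < n) (series p n - series p (n - j)%N) *m q j @[n --> \oo] --> (0 : M).
  exact: cvgB c1 c2.
apply/cvg_nrmP; apply: (squeeze_cvgr _ (cvg_cst 0) tan); apply: nearW => n.
rewrite nrm_ge0 subr0/=; apply: le_trans (nrm_sum _ _ _) _.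
have dn0 k : 0 <= d n k by rewrite /d; case: ifP => // _; rewrite mulr_ge0// nrm_ge0.
have cd : cvgn (series (d n)) by exact: dominated_cvg_series (d_le n) cvc.
apply: le_trans (series_le_lim n dn0 cd).
rewrite [leRHS](_ : _ = \sum_(j < n) d n j); last by rewrite /series/= big_mkord.
apply: ler_sum => j _.
rewrite /d ltn_ord; apply: le_trans (nrmM _ _) _.
by apply: ler_wpM2l => //; exact: nrm_ge0.
Unshelve. all: by end_near. Qed.

Lemma mx_expD A B : comm_mx A B -> mx_exp (A + B) = mx_exp A *m mx_exp B.
Proof.
move=> AB; have := @cauchy_product (exp_coefmx A) (exp_coefmx B) _ _
  (nrm_exp_coefmx A) (nrm_exp_coefmx B) (@cvg_series_exp_dom _ _ _)
  (@cvg_series_exp_dom _ _ _).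
move/cvg_mx_lim => <-; congr (limn (series _)); apply/funext => k.
have AB' : GRing.comm A B by rewrite /GRing.comm -!mulmxE.
rewrite /= exprDn_comm// scaler_sumr; apply: eq_bigr => i _.
rewrite /exp_coefmx -scalemxAl -scalemxAr -mulmxE -[_ *+ 'C(k, i)]scaler_nat !scalerA; congr (_ *: _).
have ik : (i <= k)%N by rewrite -ltnS.
have n0 m : (m`!%:R : R[i]) != 0 by rewrite pnatr_eq0 -lt0n fact_gt0.
apply: (mulfI (n0 k)); rewrite mulrA mulfV// mul1r.
rewrite -(bin_fact ik) !natrM; field.
by rewrite !n0.
Qed.

Lemma mx_exp0 : mx_exp (0 : M) = 1%:M.
Proof.
apply: cvg_mx_lim; apply: cvg_near_cst; near=> n.
have /prednK <- : (0 < n)%N by near: n; exact: nbhs_infty_gt.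
rewrite /series/= big_nat_recl// big1 ?addr0 => [|k _].
  by rewrite expr0 fact0 invr1 scale1r.
by rewrite expr0n/= scaler0.
Unshelve. all: by end_near. Qed.

(** The function is a real power series with coefficients [psi (A^k) / k!]. Differentiation replaces
    [psi] by [psi] after left multiplication by [A], again such a functional, so one convergence
    statement covers all derived series. *)
Lemma is_derive_mx_exp psi A (t : R) : Rlin psi ->
  is_derive t 1 (fun t : R => psi (mx_exp (t%:C *: A))) (psi (A *m mx_exp (t%:C *: A))).
Proof.
move=> h.
have cE phi (x : R) : Rlin phi ->
    pseries (fun k => phi (A ^+ k) / k`!%:R) x n @[n --> \oo] --> phi (mx_exp (x%:C *: A)).
  move=> hp; have := Rlin_mx_exp (A := x%:C *: A) hp.
  suff <- : pseries (fun k => phi (A ^+ k) / k`!%:R) x =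
    series (fun k => phi ((x%:C *: A) ^+ k) / k`!%:R) by [].
  apply/funext => n; apply: eq_bigr => k _.
  by rewrite /= exprZmx -rmorphXn/= RlinZ// mulrC mulrA.
have dE phi : Rlin phi -> pseries_diffs (fun k => phi (A ^+ k) / k`!%:R) =
    (fun k => phi (A *m A ^+ k) / k`!%:R).
  move=> hp; apply/funext => k; rewrite /pseries_diffs exprS -mulmxE factS natrM invfM.
  by rewrite mulrCA mulVKf// pnatr_eq0.
have hA := Rlin_mull A h; have hAA := Rlin_mull A hA.
have -> : (fun t : R => psi (mx_exp (t%:C *: A))) =
    (fun t => limn (pseries (fun k => psi (A ^+ k) / k`!%:R) t)).
  by apply/funext => x; apply/esym/cvg_lim => //; exact: cE.
have -> : psi (A *m mx_exp (t%:C *: A)) =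
    limn (pseries (pseries_diffs (fun k => psi (A ^+ k) / k`!%:R)) t).
  by apply/esym/cvg_lim => //; rewrite dE//; exact: cE hA.
apply: (@pseries_snd_diffs _ _ (`|t| + 1)).
- by apply/cvg_ex; eexists; exact: cE h.
- by rewrite dE//; apply/cvg_ex; eexists; exact: cE hA.
- by rewrite dE// (dE _ hA); apply/cvg_ex; eexists; exact: cE hAA.
- by rewrite [ltRHS]ger0_norm ?ltrDl// addr_ge0.
Qed.

End MatrixExp.

(** * Primary decomposition by polynomials *)

Section Primary.
Variable F : closedFieldType.

(** The Chinese remainder idempotents, kept as unreduced polynomials: [g] is the error modulo the
    full product. A root is added by a Bezout relation between its factor and the product of the
    others. *)
Lemma primary_partition_poly (m : F -> nat) (s : seq F) : uniq s ->
  exists (f : F -> {poly F}) (g : {poly F}),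
    [/\ \sum_(z <- s) f z + g = 1,
        \prod_(z <- s) ('X - z%:P) ^+ m z %| g &
        forall z, z \in s ->
          \prod_(w <- s) ('X - w%:P) ^+ m w %| ('X - z%:P) ^+ m z * f z].
Proof.
elim: s => [|z s IH] /=.
  by move=> _; exists (fun=> 0), 1; split; rewrite ?big_nil ?add0r ?dvd1p.
move=> /andP[zs /IH[f [g [fg Pg Pf]]]].
set P := \prod_(w <- s) _ in Pg Pf.
have cop : coprimep (('X - z%:P) ^+ m z) P.
  apply: coprimep_expl; rewrite coprimep_sym coprimep_XsubC /root /P.
  rewrite horner_prod prodf_seq_neq0; apply/allP => w ws /=.
  rewrite horner_exp hornerXsubC expf_neq0// subr_eq0.
  by apply: contraNneq zs => ->.
have /Bezout_eq1_coprimepP[[u v] /= uv] := cop.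
(* Multiply the old partition of 1 by the first Bezout term; the second one, [v * P], becomes the
   piece of [z]. *)
exists (fun w => if w == z then v * P else u * ('X - z%:P) ^+ m z * f w).
exists (u * ('X - z%:P) ^+ m z * g); split.
- rewrite big_cons eqxx -uv -[in RHS](mulr1 (u * _)) -fg mulrDr mulr_sumr.
  rewrite [RHS]addrC -!addrA; congr (_ + (_ + _)).
  by apply: eq_big_seq => w ws; rewrite ifN//; apply: contraNneq zs => <-.
- by rewrite big_cons -/P -mulrA dvdp_mull// dvdp_mul.
- move=> w; rewrite inE big_cons -/P => /predU1P[->|ws].
    by rewrite eqxx dvdp_mul// dvdp_mull.
  rewrite ifN; last by apply: contraNneq zs => <-.
  have -> : ('X - w%:P) ^+ m w * (u * ('X - z%:P) ^+ m z * f w) =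
    u * (('X - z%:P) ^+ m z * (('X - w%:P) ^+ m w * f w)) by ring.
  by rewrite dvdp_mull// dvdp_mul// Pf.
Qed.

End Primary.

Section PrimaryMatrix.
Context {R : realType} {N : nat}.
Local Notation M := 'M[R[i]]_N.

(** Evaluating the previous polynomials at [A] gives, by Cayley-Hamilton, the projections onto the
    generalized eigenspaces. Being polynomials in [A], they commute with whatever commutes with [A],
    which is what lets blocks of [P] and [Q] be combined. The exponent [N] bounds every
    multiplicity. *)
Lemma primary_partition (A : M) : exists s : seq (R[i] * M),
  \sum_(pe <- s) pe.2 = 1%:M /\
  forall pe, pe \in s -> [/\ eigenvalue A pe.1,
    (forall Y, comm_mx Y A -> comm_mx Y pe.2) &
    (A - pe.1%:M) ^+ N *m pe.2 = 0].
Proof.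
case: N A => [|n] A.
  (* In dimension 0 the empty sum is already the identity. *)
  by exists [::]; split => //; rewrite big_nil; apply/matrixP => -[].
have [rs charE] := closed_field_poly_normal (char_poly A).
rewrite (monicP (char_poly_monic A)) scale1r in charE.
have size_rs : size rs = n.+1.
  by have := size_char_poly A; rewrite charE size_prod_XsubC => -[].
pose m (z : R[i]) := count_mem z rs.
have [f [g [fg Pg Pf]]] := primary_partition_poly m (undup_uniq rs).
have PE : \prod_(z <- undup rs) ('X - z%:P) ^+ m z = char_poly A.
  by rewrite charE -(@big_undup_iterop_count _ _ _ _ rs).
have CH p : \prod_(z <- undup rs) ('X - z%:P) ^+ m z %| p -> horner_mx A p = 0.
  by rewrite PE => /dvdpP[q ->]; rewrite rmorphM/= Cayley_Hamilton mulr0.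
exists [seq (z, horner_mx A (f z)) | z <- undup rs]; split.
  rewrite big_map/= -rmorph_sum/=.
  have -> : \sum_(z <- undup rs) f z = 1 - g by rewrite -fg addrK.
  by rewrite rmorphB/= rmorph1 (CH g)// subr0.
move=> _ /mapP[z zs ->] /=; split.
- by rewrite eigenvalue_root_char charE root_prod_XsubC -mem_undup.
- by move=> Y; exact: comm_mx_horner.
- have := CH _ (Pf z zs); rewrite rmorphM rmorphXn rmorphB/= horner_mx_X horner_mx_C.
  move=> h; have mz : (m z <= n.+1)%N by rewrite -size_rs count_size.
  suff key k : (m z <= k)%N -> (A - z%:M) ^+ k *m horner_mx A (f z) = 0 by exact: key.
  by move=> /subnK <-; rewrite exprD mulmxE -mulrA h mulr0.
Qed.

End PrimaryMatrix.

(** * Scalar exponentials, matrix powers and their decay *)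

Section ScalarExp.
Context {R : realType}.
Implicit Types z w : R[i].

Definition cexp z : R[i] := (expR (complex.Re z))%:C * (cos (complex.Im z) +i* sin (complex.Im z)).

Lemma cmod_cexp z : cmod (cexp z) = expR (complex.Re z).
Proof.
by rewrite /cexp cmodM cmod_real ger0_norm ?expR_ge0// /cmod/= cos2Dsin2 sqrtr1 mulr1.
Qed.

(** Written in the shape of [cos_coeff] and [sin_coeff], against which it is matched in
    [mx_exp_imag]. *)
Lemma iX (b : R) k : ('i * b%:C : R[i]) ^+ k =
  ((~~ odd k)%:R * (-1) ^+ k./2 * b ^+ k) +i* ((odd k)%:R * (-1) ^+ k.-1./2 * b ^+ k).
Proof.
elim: k => [|k IH].
  by apply/eqP; rewrite eq_complex/= !mul0r !mul1r !expr0 !eqxx.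
rewrite exprS IH; case: (boolP (odd k)) => ok /=.
  have -> : uphalf k = (k.-1./2).+1.
    by case: (k) ok.
  by apply/eqP; rewrite eq_complex/= ok/= !exprS; apply/andP; split; apply/eqP; ring.
by apply/eqP; rewrite eq_complex/= (negbTE ok)/= !exprS; apply/andP; split; apply/eqP; ring.
Qed.

End ScalarExp.

Section MatrixPower.
Context {R : realType} {N : nat}.
Local Notation M := 'M[R[i]]_N.
Implicit Types (A B X Y P Q : M) (psi : M -> R) (s t : R).

Lemma Rlin_scalar psi (z : R[i]) A : Rlin psi ->
  psi (z *: A) = complex.Re z * psi A + complex.Im z * psi ('i *: A).
Proof.
move=> h; rewrite {1}[z]complexE scalerDl RlinD// RlinZ//; congr (_ + _).
by rewrite mulrC -scalerA RlinZ.
Qed.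

Lemma scalar_mxX (z : R[i]) k : (z%:M : M) ^+ k = (z ^+ k)%:M.
Proof. by elim: k => // k IH; rewrite !exprS IH -mulmxE -scalar_mxM. Qed.

Lemma mx_exp_real (a : R) : mx_exp ((a%:C)%:M : M) = ((expR a)%:C)%:M.
Proof.
apply: RlinP => psi h; have h1 := Rlin_mx_exp (A := (a%:C)%:M) h.
rewrite -(cvg_lim (@Rhausdorff R) h1) -(scalemx1 _ (expR a)%:C) RlinZ//.
apply/cvg_lim => //.
have -> : series (fun k => psi ((a%:C)%:M ^+ k) / k`!%:R) =
    (fun n => series (exp_coeff a) n * psi 1%:M).
  apply/funext => n; rewrite /series/= mulr_suml; apply: eq_bigr => k _.
  by rewrite scalar_mxX -rmorphXn/= -scalemx1 RlinZ// /exp_coeff/= mulrAC.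
apply: cvgMr_tmp; exact: is_cvg_series_exp_coeff.
Qed.

Lemma mx_exp_imag (b : R) : mx_exp (('i * b%:C)%:M : M) = (cos b +i* sin b)%:M.
Proof.
apply: RlinP => psi h; have h1 := Rlin_mx_exp (A := ('i * b%:C)%:M) h.
rewrite -(cvg_lim (@Rhausdorff R) h1) -(scalemx1 _ (cos b +i* sin b)) (Rlin_scalar _ _ h)/=.
apply/cvg_lim => //.
have -> : series (fun k => psi (('i * b%:C)%:M ^+ k) / k`!%:R) =
    (fun n => series (cos_coeff b) n * psi 1%:M + series (sin_coeff b) n * psi ('i *: 1%:M)).
  apply/funext => n; rewrite /series/= !mulr_suml -big_split; apply: eq_bigr => k _.
  rewrite scalar_mxX iX -scalemx1 (Rlin_scalar _ _ h)/= /cos_coeff /sin_coeff/= -?exprnP; ring.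
rewrite cos.unlock sin.unlock.
apply: cvgD; apply: cvgMr_tmp; first exact: is_cvg_series_cos_coeff.
exact: is_cvg_series_sin_coeff.
Qed.

Lemma mx_exp_scalar (z : R[i]) : mx_exp (z%:M : M) = (cexp z)%:M.
Proof.
rewrite {1}[z]complexE raddfD/= mx_expD ?mx_exp_real ?mx_exp_imag.
  by rewrite -scalar_mxM.
exact: comm_scalar_mx.
Qed.

Lemma mx_exp_nilp (A X : M) (m : nat) (u : R) : A ^+ m *m X = 0 ->
  mx_exp (u%:C *: A) *m X = \sum_(k < m) (u ^+ k / k`!%:R)%:C *: (A ^+ k *m X).
Proof.
move=> AX; apply: RlinP => psi h.
have h1 := Rlin_mx_exp (A := u%:C *: A) (Rlin_mulr X h).
rewrite -(cvg_lim (@Rhausdorff R) h1); apply/cvg_lim => //.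
apply: cvg_near_cst; near=> n.
have mn : (m <= n)%N by near: n; exact: nbhs_infty_ge.
rewrite Rlin_sum// /series/= (big_cat_nat (leq0n m) mn)/= [X in _ + X]big1_seq ?addr0.
  rewrite big_mkord; apply: eq_bigr => k _.
  by rewrite exprZmx -rmorphXn/= -scalemxAl !RlinZ// mulrAC.
move=> k; rewrite mem_index_iota => /andP[_ /andP[mk _]].
have Ak : A ^+ k *m X = 0 by rewrite -(subnK mk) exprD -mulmxE -mulmxA AX mulmx0.
rewrite exprZmx -scalemxAl Ak scaler0.
by rewrite Rlin0// mul0r.
Unshelve. all: by end_near. Qed.

(** Split off the scalar part [p]; the exponential series of the rest stops after [m] terms on
    [X]. *)
Lemma mx_exp_block (A X : M) (p : R[i]) (m : nat) (u : R) : (A - p%:M) ^+ m *m X = 0 ->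
  mx_exp (u%:C *: A) *m X = cexp (u%:C * p) *:
    \sum_(k < m) (u ^+ k / k`!%:R)%:C *: ((A - p%:M) ^+ k *m X).
Proof.
move=> AX; rewrite -(mx_exp_nilp _ AX).
have -> : u%:C *: A = (u%:C * p)%:M + u%:C *: (A - p%:M).
  by rewrite scalerBr scale_scalar_mx addrCA subrr addr0.
rewrite mx_expD; last exact: comm_scalar_mx.
by rewrite mx_exp_scalar -mulmxA mul_scalar_mx.
Qed.

Lemma expR_bound (k : nat) (d u : R) : 0 < d -> 0 <= u ->
  u ^+ k / k`!%:R <= d ^- k * expR (d * u).
Proof.
move=> d0 u0; rewrite ler_pdivlMl ?exprn_gt0// mulrA -exprMn.
have du : 0 <= d * u by rewrite mulr_ge0// ltW.
case: k => [|k]; first by rewrite expr0 fact0 divr1 -expR0 ler_expR.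
by have := expR_ge1Dxn k du; apply: le_trans; rewrite lerDr.
Qed.

(** On each generalized eigenspace the exponential is a scalar of modulus [e^(- u Re p)] times a
    polynomial in [u]. The number of blocks is finite, so the smallest rate serves all of them. *)
Lemma mx_exp_decay P : mx_Re_gt0 P -> exists a C : R, [/\ 0 < a, 0 <= C &
  forall u : R, 0 <= u -> nrm (mx_exp ((- u)%:C *: P)) <= C * expR (- (a * u))].
Proof.
move=> hP; have [s [s1 sP]] := primary_partition P.
suff : exists a C : R, [/\ 0 < a, 0 <= C & forall u : R, 0 <= u ->
    nrm (mx_exp ((- u)%:C *: P) *m \sum_(pe <- s) pe.2) <= C * expR (- (a * u))].
  by move=> [a [C [a0 C0 H]]]; exists a, C; split=> // u /H; rewrite s1 mulmx1.
elim: s sP {s1} => [|[p e] s IH] sP.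
  exists 1, 0; split => // u u0.
  by rewrite big_nil mulmx0 nrm0 mul0r.
have [|a [C [a0 C0 HC]]] := IH; first by move=> pe pes; apply: sP; rewrite inE pes orbT.
have [/hP p0 _ nil] := sP _ (mem_head _ _); rewrite /= in p0 nil.
set rp := complex.Re p in p0.
(* Half of the decay pays for the polynomial factor through [expR_bound]; the other half remains. *)
pose d := rp / 2; have d0 : 0 < d by rewrite divr_gt0.
pose C1 := \sum_(k < N) d ^- k * nrm ((P - p%:M) ^+ k *m e).
have C10 : 0 <= C1.
  by apply: sumr_ge0 => k _; rewrite mulr_ge0 ?nrm_ge0// invr_ge0 exprn_ge0// ltW.
exists (Num.min a d), (C1 + C); split; [by rewrite lt_min a0| exact: addr_ge0|].
move=> u u0; rewrite big_cons mulmxDr; apply: le_trans (nrmD _ _) _; rewrite mulrDl.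
apply: lerD; last first.
  apply: le_trans (HC _ u0) _; apply: ler_wpM2l => //.
  by rewrite ler_expR lerN2 ler_wpM2r// ge_min lexx.
apply: (@le_trans _ _ (C1 * expR (- (d * u)))); last first.
  by apply: ler_wpM2l => //; rewrite ler_expR lerN2 ler_wpM2r// ge_min lexx orbT.
rewrite (mx_exp_block _ nil) nrmZ cmod_cexp.
have -> : complex.Re ((- u)%:C * p) = - (d * u) + - (d * u).
  by case: (p) @rp @d {p0 d0 C1 C10 nil sP} => x y /=; field.
rewrite expRD mulrC mulrA ler_wpM2r ?expR_ge0// expRN ler_pdivrMr ?expR_gt0//.
apply: le_trans (nrm_sum _ _ _) _; rewrite /C1 mulr_suml; apply: ler_sum => k _.
rewrite nrmZ cmod_real mulrAC ler_wpM2r ?nrm_ge0//.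
rewrite normrM normrX normrN (ger0_norm u0) normfV normr_nat.
exact: expR_bound.
Qed.

(* Stands in for mx_Re_gt0: it is visibly stable under sums of commuting
   matrices. *)
Definition posmx A := exists b C : R, [/\ 0 < b, 0 <= C &
  forall t, 0 < t <= 1 -> nrm (real_powmx t A) <= C * pw b t].

Lemma posmx_Re P : mx_Re_gt0 P -> posmx P.
Proof.
move=> /mx_exp_decay[a [C [a0 C0 HC]]]; exists a, C; split=> // t /andP[t0 t1].
have l0 : 0 <= - ln t by rewrite oppr_ge0 ln_le0.
by have := HC _ l0; rewrite opprK mulrN opprK.
Qed.

Lemma real_powmxD t A B : comm_mx A B ->
  real_powmx t (A + B) = real_powmx t A *m real_powmx t B.
Proof.
move=> AB; rewrite /real_powmx scalerDr mx_expD//.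
by rewrite /comm_mx -!scalemxAl -!scalemxAr AB.
Qed.

Lemma real_powmxM s t A : 0 < s -> 0 < t ->
  real_powmx (s * t) A = real_powmx s A *m real_powmx t A.
Proof.
move=> s0 t0; have e : ln (s * t) = ln s + ln t by rewrite lnM ?posrE.
rewrite /real_powmx e (rmorphD (real_complex R)) scalerDl mx_expD; first by [].
by rewrite /comm_mx -!scalemxAl -!scalemxAr !scalerA mulrC.
Qed.

Lemma real_powmx1 A : real_powmx 1 A = 1%:M.
Proof. by rewrite /real_powmx ln1 scale0r mx_exp0. Qed.

Lemma comm_real_powmx X t A : comm_mx X A -> comm_mx X (real_powmx t A).
Proof.
move=> XA; apply: comm_mx_exp.
by rewrite /comm_mx -!scalemxAl -!scalemxAr XA.
Qed.

Lemma real_powmx_real t (c : R) : real_powmx t ((c%:C)%:M : M) = ((pw c t)%:C)%:M.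
Proof. by rewrite /real_powmx scale_scalar_mx -rmorphM/= mx_exp_real /pw mulrC. Qed.

Lemma real_powmx_shift t (c : R) A :
  real_powmx t (A + (c%:C)%:M) = (pw c t)%:C *: real_powmx t A.
Proof.
rewrite real_powmxD; last exact: comm_mx_scalar.
by rewrite real_powmx_real mul_mx_scalar.
Qed.

Lemma real_powmxB1 t A : 0 < t -> real_powmx t (A - 1%:M) = (t^-1)%:C *: real_powmx t A.
Proof.
move=> t0; rewrite -pwN1// -real_powmx_shift; congr (real_powmx _ (_ + _)).
by rewrite rmorphN rmorph1 raddfN.
Qed.

Lemma real_powmxMn t A (l : nat) : 0 < t -> real_powmx t (A *+ l) = real_powmx (t ^+ l) A.
Proof.
move=> t0; have -> : A *+ l = (l%:R : R)%:C *: A.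
  by rewrite (rmorph_nat (real_complex R)) scaler_nat.
have e : ln (t ^+ l) = ln t * l%:R by rewrite lnXn// mulr_natr.
rewrite /real_powmx scalerA e; congr (mx_exp (_ *: A)).
exact/esym/(rmorphM (real_complex R)).
Qed.

Lemma real_powmx_inv t A : 0 < t -> real_powmx t^-1 A *m real_powmx t A = 1%:M.
Proof. by move=> t0; rewrite -real_powmxM ?invr_gt0// mulVf ?gt_eqF// real_powmx1. Qed.

Lemma nrm_real_powmx t A : 1 <= t -> nrm (real_powmx t A) <= nrm (1%:M : M) * pw (nrm A) t.
Proof.
move=> t1; rewrite -[real_powmx t A]mul1mx; apply: le_trans (nrm_mx_exp _ _) _.
by rewrite nrmZ cmod_real ger0_norm ?ln_ge0// [ln t * _]mulrC.
Qed.

Lemma is_derive_real_powmx psi A t : 0 < t -> Rlin psi ->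
  is_derive t 1 (fun t => psi (real_powmx t A)) (psi (A *m real_powmx t (A - 1%:M))).
Proof.
move=> t0 h; have dl := is_derive1_ln t0.
have de := is_derive_mx_exp A (ln t) h.
have -> : (fun t => psi (real_powmx t A)) = (fun u : R => psi (mx_exp (u%:C *: A))) \o @ln R by [].
suff -> : psi (A *m real_powmx t (A - 1%:M)) = psi (A *m mx_exp ((ln t)%:C *: A)) * t^-1.
  exact: is_derive1_comp.
by rewrite real_powmxB1// -scalemxAr RlinZ// mulrC.
Qed.

Lemma continuous_real_powmx psi A t : 0 < t -> Rlin psi ->
  {for t, continuous (fun t => psi (real_powmx t A))}.
Proof. by move=> t0 h; apply: is_derive_continuous (is_derive_real_powmx A t0 h). Qed.

Lemma posmxD A B : comm_mx A B -> posmx A -> posmx B -> posmx (A + B).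
Proof.
move=> AB [a [C [a0 C0 HC]]] [b [D [b0 D0 HD]]].
exists (a + b), (C * D); split; [exact: addr_gt0|exact: mulr_ge0|].
move=> t t01; rewrite real_powmxD//; apply: le_trans (nrmM _ _) _.
rewrite pwD [leRHS]mulrACA; apply: ler_pM; [exact: nrm_ge0|exact: nrm_ge0|exact: HC|exact: HD].
Qed.

Lemma comm_mxMn A B l : comm_mx A B -> comm_mx A (B *+ l).
Proof.
move=> AB; elim: l => [|l IH]; first by rewrite mulr0n; exact: comm_mx0.
by rewrite mulrS; exact: comm_mxD.
Qed.

Lemma posmxMnD P Q l : comm_mx P Q -> posmx P -> posmx Q -> posmx (P *+ l + Q).
Proof.
move=> PQ hP hQ; elim: l => [|l IH]; first by rewrite mulr0n add0r.
rewrite mulrS -addrA; apply: posmxD => //.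
by apply: comm_mxD => //; apply: comm_mxMn; exact: comm_mx_refl.
Qed.

Lemma posmx_shift A (c : R) : 0 <= c -> posmx A -> posmx (A + (c%:C)%:M).
Proof.
move=> c0 [a [C [a0 C0 HC]]]; exists (a + c), C; split=> //; first by rewrite ltr_wpDr.
move=> t t01; rewrite real_powmx_shift nrmZ cmod_real ger0_norm ?pw_ge0//.
by rewrite pwD mulrA mulrC ler_wpM2r ?pw_ge0// HC.
Qed.

Lemma posmx_bound A : posmx A -> exists b c C : R, [/\ 0 < b, 0 < c, 0 <= C &
  forall t, 0 < t -> nrm (real_powmx t (A - 1%:M)) <= C * (pw (b - 1) t + pw (c - 1) t)].
Proof.
move=> [b [C [b0 C0 HC]]].
(* The exponent [b] serves [t <= 1] and [nrm A + 1] serves [t >= 1]; the added 1 makes the latter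
   positive, so that [t^(c - 1)] is integrable at 0. *)
exists b, (nrm A + 1), (C + nrm (1%:M : M)); split => //.
- by rewrite ltr_wpDl ?nrm_ge0.
- by rewrite addr_ge0 ?nrm_ge0.
move=> t t0; rewrite real_powmxB1// nrmZ cmod_real ger0_norm ?invr_ge0 ?(ltW t0)//.
rewrite -pwN1// [pw (b - 1) t]pwD [pw (nrm A + 1 - 1) t]pwD -mulrDl mulrCA mulrA mulrC.
rewrite ler_wpM2r ?pw_ge0//.
have n0 : 0 <= nrm (1%:M : M) by exact: nrm_ge0.
have [t1|/ltW t1] := leP t 1.
  have := HC t; rewrite t0 t1 => /(_ isT).
  have := pw_ge0 b t; have := pw_ge0 (nrm A + 1) t; nra.
have := nrm_real_powmx A t1.
have p1 : pw (nrm A) t <= pw (nrm A + 1) t.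
  by rewrite pwD ler_peMr ?pw_ge0// pw1.
have := pw_ge0 b t; have := pw_ge0 (nrm A) t; nra.
Qed.

End MatrixPower.

(** * Matrix integrals and the matrix Gamma function *)

Section MatrixIntegral.
Context {R : realType} {N : nat}.
Local Notation M := 'M[R[i]]_N.
Local Notation mu := (@lebesgue_measure R).
Local Notation RT := (measurableTypeR R).
Implicit Types (A B X Y : M) (psi : M -> R) (f : R -> M) (s t : R) (D : set RT).

Definition mxI D f := forall psi, Rlin psi -> mu.-integrable D (EFin \o (fun t => psi (f t))).

Lemma mx_integrable_mxI D f : measurable D -> mx_integrable D f -> mxI D f.
Proof.
move=> mD fi psi h.
have -> : (fun t => psi (f t)) = (fun t => \sum_(i <- index_enum 'I_N) \sum_(j <- index_enum 'I_N)
  (psi (delta_mx i j) * complex.Re (f t i j) + psi ('i *: delta_mx i j) * complex.Im (f t i j))).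
  apply/funext => t; rewrite (Rlin_decomp _ h); apply: eq_bigr => i _.
  by apply: eq_bigr => j _; congr (_ + _); rewrite mulrC.
apply: integrable_sumR => // i; apply: integrable_sumR => // j.
have [i1 i2] := fi i j.
by apply: integrableDR => //; apply: integrableZR.
Qed.

Lemma mxIS D E f : measurable D -> measurable E -> E `<=` D -> mxI D f -> mxI E f.
Proof. by move=> mD mE ED fi psi h; apply: integrableS (fi psi h). Qed.

Lemma Rlin_Rintegral D f psi : measurable D -> mxI D f -> Rlin psi ->
  psi (mx_Rintegral D f) = \int[mu]_(t in D) psi (f t).
Proof.
move=> mD fi h.
have iRe i j : mu.-integrable D (EFin \o (fun t => complex.Re (f t i j))) by exact: fi _ (Rlin_Re i j).
have iIm i j : mu.-integrable D (EFin \o (fun t => complex.Im (f t i j))) by exact: fi _ (Rlin_Im i j).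
have i1 i j : mu.-integrable D (EFin \o (fun t => psi (delta_mx i j) * complex.Re (f t i j))).
  exact: integrableZR.
have i2 i j : mu.-integrable D (EFin \o (fun t => psi ('i *: delta_mx i j) * complex.Im (f t i j))).
  exact: integrableZR.
have -> : (fun t => psi (f t)) = (fun t => \sum_(i <- index_enum 'I_N) \sum_(j <- index_enum 'I_N)
  (psi (delta_mx i j) * complex.Re (f t i j) + psi ('i *: delta_mx i j) * complex.Im (f t i j))).
  apply/funext => t; rewrite (Rlin_decomp _ h); apply: eq_bigr => i _.
  by apply: eq_bigr => j _; congr (_ + _); rewrite mulrC.
rewrite (Rlin_decomp _ h) Rintegral_sum//; last first.
  by move=> i; apply: integrable_sumR => // j; exact: integrableDR.
apply: eq_bigr => i _; rewrite Rintegral_sum//; last by move=> j; exact: integrableDR.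
apply: eq_bigr => j _; rewrite RintegralD// !RintegralZl//.
by rewrite /mx_Rintegral mxE/= mulrC [X in _ + X]mulrC.
Qed.

(** The constant counts the real and imaginary parts of the [N * N] entries, each bounded by the
    integral of [w]. *)
Lemma nrm_Rintegral_le D f (w : R -> R) : measurable D -> mxI D f ->
  mu.-integrable D (EFin \o w) -> (forall t, D t -> nrm (f t) <= w t) ->
  nrm (mx_Rintegral D f) <= (2 * (N * N)%:R) * \int[mu]_(t in D) w t.
Proof.
move=> mD fi wi fw; apply: le_trans (nrm_le _) _.
set W := \int[mu]_(t in D) w t.
have hRe i j : `|complex.Re (mx_Rintegral D f i j)| <= W.
  rewrite (Rlin_Rintegral mD fi (Rlin_Re i j)); apply: norm_Rintegral_le => //.
    exact: fi _ (Rlin_Re i j).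
  move=> t Dt; apply: le_trans (fw t Dt).
  exact: le_trans (Re_le_cmod _) (entry_le_nrm _ _ _).
have hIm i j : `|complex.Im (mx_Rintegral D f i j)| <= W.
  rewrite (Rlin_Rintegral mD fi (Rlin_Im i j)); apply: norm_Rintegral_le => //.
    exact: fi _ (Rlin_Im i j).
  move=> t Dt; apply: le_trans (fw t Dt).
  exact: le_trans (Im_le_cmod _) (entry_le_nrm _ _ _).
apply: (@le_trans _ _ (\sum_(i < N) \sum_(j < N) (W + W))).
  by apply: ler_sum => i _; apply: ler_sum => j _; exact: lerD.
rewrite !sumr_const !card_ord -mulrnA -mulr2n -mulrnA -[leLHS]mulr_natl natrM.
by rewrite [2 * _]mulrC.
Qed.

Lemma mxI_dom (i : interval R) f (w : R -> R) : open [set` i] ->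
  (forall psi t, Rlin psi -> t \in i -> {for t, continuous (fun t => psi (f t))}) ->
  mu.-integrable [set` i] (EFin \o w) -> (forall t, t \in i -> nrm (f t) <= w t) ->
  mxI [set` i] f.
Proof.
move=> oi cf wi fw psi h; have [K K0 hK] := Rlin_bound h.
have wi' : mu.-integrable [set` i] (EFin \o (fun t => K * w t)).
  exact: integrableZR (mitv i) wi.
apply: le_integrableR wi' _; first exact: mitv.
  by apply: measurable_open_continuous => // t ti; exact: cf.
move=> t ti; apply: le_trans (hK _) _.
by apply: ler_wpM2l => //; exact: fw.
Qed.

Lemma improper_integralE (F G : set_system R) {FF : ProperFilter F} {GG : ProperFilter G}
    D f : measurable D -> mxI D f ->
  (\forall cd \near filter_prod F G, `[cd.1, cd.2] `<=` D) ->
  (forall h : R -> R, mu.-integrable D (EFin \o h) ->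
    \int[mu]_(t in `[cd.1, cd.2]) h t @[cd --> filter_prod F G] --> \int[mu]_(t in D) h t) ->
  improper_integral F G f = mx_Rintegral D f.
Proof.
move=> mD fi FGD H; apply: cvg_mx_lim; apply: cvg_RlinP => psi h.
rewrite (Rlin_Rintegral mD fi h).
apply: cvg_trans (H _ (fi psi h)); apply: near_eq_cvg.
apply: filterS FGD => -[c d]/= cdD; apply/esym.
by apply: Rlin_Rintegral => //; exact: mxIS cdD fi.
Qed.

Lemma improper_posE f : mxI `]0, +oo[ f ->
  improper_integral 0^'+ +oo f = mx_Rintegral `]0, +oo[ f.
Proof.
move=> fi; apply: improper_integralE => //; last exact: improper_pos.
exists ([set c | 0 < c], setT) => /=; first by split; [exact: nbhs_right_gt|exact: filterT].
move=> [c d]/= [c0 _] x /=; rewrite !in_itv/= andbT => /andP[+ _].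
exact: lt_le_trans.
Qed.

Lemma improper_aboveE x f : mxI `]x, +oo[ f ->
  improper_integral x^'+ +oo f = mx_Rintegral `]x, +oo[ f.
Proof.
move=> fi; apply: improper_integralE => //; last exact: improper_above.
exists ([set c | x < c], setT) => /=; first by split; [exact: nbhs_right_gt|exact: filterT].
move=> [c d]/= [c0 _] y /=; rewrite !in_itv/= andbT => /andP[+ _].
exact: lt_le_trans.
Qed.

Lemma improper_belowE x f : 0 < x -> mxI `]0, x[ f ->
  improper_integral 0^'+ x^'- f = mx_Rintegral `]0, x[ f.
Proof.
move=> x0 fi; apply: improper_integralE => //.
  exists ([set c | 0 < c], [set d | d < x]) => /=.
    by split; [exact: nbhs_right_gt|exact: nbhs_left_lt].
  move=> [c d]/= [c0 dx] y /=; rewrite !in_itv/= => /andP[cy yd].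
  by rewrite (lt_le_trans c0 cy) (le_lt_trans yd dx).
by move=> h; exact: improper_below.
Qed.

End MatrixIntegral.

Section MatrixGamma.
Context {R : realType} {N : nat}.
Local Notation M := 'M[R[i]]_N.
Local Notation mu := (@lebesgue_measure R).
Local Notation RT := (measurableTypeR R).
Implicit Types (A B X Y : M) (psi : M -> R) (s t u : R).

Lemma pw_cvg0 u : 0 < u -> pw u t @[t --> 0^'+] --> 0.
Proof.
move=> u0; have := @powR_cvg0 R u u0; apply: cvg_trans; apply: near_eq_cvg; near=> t.
have t0 : 0 < t by near: t; exact: nbhs_right_gt.
by rewrite /powR gt_eqF.
Unshelve. all: by end_near. Qed.

Lemma real_powmx_cvg0 A psi : posmx A -> Rlin psi ->
  psi (real_powmx t A) @[t --> 0^'+] --> 0.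
Proof.
move=> [b [C [b0 C0 HC]]] h; have [K K0 hK] := Rlin_bound h.
have c0 : K * (C * pw b t) @[t --> 0^'+] --> 0.
  rewrite -[X in _ --> X](mulr0 K) -[X in _ --> K * X](mulr0 C).
  by apply: cvgMl_tmp; apply: cvgMl_tmp; exact: pw_cvg0.
apply/norm_cvg0P; apply: (squeeze_cvgr _ (cvg_cst 0) c0).
near=> t; rewrite normr_ge0/=; apply: le_trans (hK _) _; apply: ler_wpM2l => //.
apply: HC; apply/andP; split; first by near: t; exact: nbhs_right_gt.
by near: t; exact: nbhs_right_le.
Unshelve. all: by end_near. Qed.

(** The Gamma integrand with a Laplace variable [s]; the value [s = 1] is [gamma_integrand]. *)
Definition gterm A s t : M := (expR (- (s * t)))%:C *: real_powmx t (A - 1%:M).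

Lemma gamma_integrandE A : gamma_integrand A = gterm A 1.
Proof. by apply/funext => t; rewrite /gamma_integrand /gterm mul1r. Qed.

Lemma continuous_gterm A s psi t : Rlin psi -> 0 < t ->
  {for t, continuous (fun t => psi (gterm A s t))}.
Proof.
move=> h t0; have -> : (fun t => psi (gterm A s t)) =
    (fun t => expR (- (s * t)) * psi (real_powmx t (A - 1%:M))).
  by apply/funext => x; rewrite /gterm RlinZ.
by apply: contM; [exact: continuous_expRNM|exact: continuous_real_powmx].
Qed.

Lemma mxI_gterm A s : posmx A -> 0 < s -> mxI `]0, +oo[ (gterm A s).
Proof.
move=> /posmx_bound[b [c [C [b0 c0 C0 HC]]]] s0.
have i1 := integrable_gamma b0 s0; have i2 := integrable_gamma c0 s0.
have i3 := integrableZR C (mitv _) (integrableDR (mitv _) i1 i2).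
apply: (mxI_dom _ _ i3); first exact: interval_open.
  by move=> psi t h /[!in_itv]/= /andP[t0 _]; exact: continuous_gterm.
move=> t /[!in_itv]/= /andP[t0 _].
rewrite /gterm nrmZ cmod_real ger0_norm ?expR_ge0// -mulrDl mulrA mulrC.
by rewrite ler_wpM2r ?expR_ge0// HC.
Qed.

(** Equal to [s^(-A) Gamma(A)] by [Gam_scale]: changing [s] is how the upper case inserts its
    weights. *)
Definition Gam A s : M := mx_Rintegral `]0, +oo[ (gterm A s).

Lemma Gamma_mxE A : posmx A -> Gamma_mx A = Gam A 1.
Proof. by move=> pA; rewrite /Gamma_mx gamma_integrandE improper_posE//; exact: mxI_gterm. Qed.

Lemma upper_gammaE A x : posmx A -> 0 < x ->
  upper_gamma_mx A x = mx_Rintegral `]x, +oo[ (gterm A 1).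
Proof.
move=> pA x0; rewrite /upper_gamma_mx gamma_integrandE improper_aboveE//.
apply: mxIS (mxI_gterm pA ltr01) => [||t/=]; try exact: mitv.
by rewrite !in_itv/= !andbT; exact: lt_trans.
Qed.

Lemma lower_gammaE A x : posmx A -> 0 < x ->
  lower_gamma_mx A x = mx_Rintegral `]0, x[ (gterm A 1).
Proof.
move=> pA x0; rewrite /lower_gamma_mx gamma_integrandE improper_belowE//.
apply: mxIS (mxI_gterm pA ltr01) => [||t/=]; try exact: mitv.
by rewrite !in_itv/= andbT => /andP[].
Qed.

Lemma lower_upper_gamma A x : posmx A -> 0 < x ->
  lower_gamma_mx A x + upper_gamma_mx A x = Gamma_mx A.
Proof.
move=> pA x0; have gi := mxI_gterm pA ltr01.
rewrite lower_gammaE// upper_gammaE// Gamma_mxE//; apply: RlinP => psi h.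
have i1 := gi _ h.
rewrite RlinD// !(Rlin_Rintegral _ _ h) //.
- have := @Rintegral_itvB R (fun t => psi (gterm A 1 t)) (BRight 0) +oo%O x i1.
  rewrite bnd_simp (ltW x0) => /(_ isT isT) <-.
  have i2 : mu.-integrable `]0, x[ (EFin \o (fun t => psi (gterm A 1 t))).
    apply: integrableS i1; [exact: mitv|exact: mitv|].
    by move=> t/=; rewrite !in_itv/= andbT => /andP[].
  by rewrite (Rintegral_itv_bndo_bndc i2) addrC subrK.
- apply: mxIS gi; [exact: mitv|exact: mitv|].
  by move=> t /=; rewrite !in_itv/= !andbT; exact: lt_trans.
- apply: mxIS gi; [exact: mitv|exact: mitv|].
  by move=> t/=; rewrite !in_itv/= andbT => /andP[].
Qed.

Lemma Rlin_Gam A s psi : posmx A -> 0 < s -> Rlin psi ->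
  psi (Gam A s) = \int[mu]_(t in `]0, +oo[) psi (gterm A s t).
Proof. by move=> pA s0 h; apply: Rlin_Rintegral => //; exact: mxI_gterm. Qed.

Lemma comm_Rintegral X (D : set RT) (f : R -> M) : measurable D -> mxI D f ->
  (forall t, D t -> comm_mx X (f t)) -> comm_mx X (mx_Rintegral D f).
Proof.
move=> mD fi Xf; apply: RlinP => psi h.
rewrite (Rlin_Rintegral mD fi (Rlin_mull X h)) (Rlin_Rintegral mD fi (Rlin_mulr X h)).
by apply: eq_Rintegral => t /[!inE] /Xf ->.
Qed.

Lemma comm_gterm X A s t : comm_mx X A -> comm_mx X (gterm A s t).
Proof.
move=> XA; rewrite /comm_mx /gterm -scalemxAl -scalemxAr; congr (_ *: _).
apply: comm_real_powmx; apply: comm_mxB => //; exact: comm_mx1.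
Qed.

Lemma comm_Gamma_mx X A : posmx A -> comm_mx X A -> comm_mx X (Gamma_mx A).
Proof.
move=> pA XA; rewrite Gamma_mxE//; apply: comm_Rintegral; [exact: mitv|exact: mxI_gterm|].
by move=> t _; exact: comm_gterm.
Qed.

Lemma Gam_scale A s : posmx A -> 0 < s -> Gam A s = real_powmx s^-1 A *m Gam A 1.
Proof.
move=> pA s0; apply: RlinP => psi h; set X := real_powmx s^-1 A.
have hX := Rlin_mull X h.
rewrite (Rlin_Gam pA s0 h) (Rlin_Gam pA ltr01 hX).
pose g t := psi (X *m gterm A 1 t).
have gE t : 0 < t -> g (s * t) = s^-1 * psi (gterm A s t).
  move=> t0; rewrite /g /gterm mul1r -scalemxAr !RlinZ// mulrCA; congr (_ * _).
  rewrite real_powmxM// real_powmxB1// mulmxA -scalemxAr real_powmx_inv//.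
  by rewrite -scalemxAl mul1mx RlinZ.
have gi : mu.-integrable `]0, +oo[ (EFin \o g) by exact: (mxI_gterm pA ltr01) _ hX.
have gsi : mu.-integrable `]0, +oo[ (EFin \o (fun t => g (s * t))).
  have i1 := integrableZR s^-1 (mitv _) (mxI_gterm pA s0 h).
  apply: eq_integrable_itv i1 => t; rewrite in_itv/= andbT => t0; exact/esym/gE.
have cg t : 0 < t -> {for t, continuous g} by exact: continuous_gterm hX.
have e1 := Rintegral_scale s0 cg gi gsi.
have e2 : \int[mu]_(t in `]0, +oo[) g (s * t) =
    \int[mu]_(t in `]0, +oo[) (s^-1 * psi (gterm A s t)).
  by apply: eq_Rint => t; rewrite in_itv/= andbT; exact: gE.
have e3 := RintegralZl s^-1 (mitv _) ((mxI_gterm pA s0) _ h).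
have s1 : s^-1 != 0 by rewrite invr_eq0 gt_eqF.
apply: (mulfI s1).
apply: etrans (esym e3) _.
apply: etrans (esym e2) _.
exact: e1.
Qed.

Lemma expRN_cvgy psi A : Rlin psi ->
  expR (- t) * psi (real_powmx t A) @[t --> +oo] --> 0.
Proof.
move=> h; have [K K0 hK] := Rlin_bound h.
have [C C0 HC] := @pw_le_exp R (nrm A) (2^-1) (ltac:(by rewrite invr_gt0)).
have c0 : K * nrm (1%:M : M) * C * expR (- (2^-1 * t)) @[t --> +oo] --> 0.
  rewrite -[X in _ --> X](mulr0 (K * nrm (1%:M : M) * C)); apply: cvgMl_tmp.
  have := @cvgr_expR R; apply: (cvg_comp (fun t => 2^-1 * t)).
  by apply: gt0_cvgMry => //; exact: cvg_id.
apply/norm_cvg0P; apply: (squeeze_cvgr _ (cvg_cst 0) c0).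
near=> t; have t1 : 1 <= t by near: t; exact: nbhs_pinfty_ge.
rewrite normr_ge0/= normrM ger0_norm ?expR_ge0//.
have -> : - t = - (2^-1 * t) + - (2^-1 * t) by field.
rewrite expRD -[leLHS]mulrA [leRHS]mulrC; apply: ler_wpM2l; first exact: expR_ge0.
rewrite expRN mulrC ler_pdivrMr ?expR_gt0//.
apply: le_trans (hK _) _; rewrite -!mulrA; apply: ler_wpM2l => //.
apply: le_trans (nrm_real_powmx _ t1) _; apply: ler_wpM2l; [exact: nrm_ge0|exact: HC].
Unshelve. all: by end_near. Qed.

(** Integration by parts against [e^(-t) t^A], which vanishes at 0 by [posmx A] and at infinity by
    the exponential. *)
Lemma Gamma_rec A : posmx A -> Gam (A + 1%:M) 1 = A *m Gam A 1.
Proof.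
move=> pA; have pA1 : posmx (A + 1%:M).
  by have := posmx_shift (c := 1) ler01 pA; rewrite rmorph1.
apply: RlinP => psi h; have hA := Rlin_mull A h.
rewrite (Rlin_Gam pA1 ltr01 h) (Rlin_Gam pA ltr01 hA).
have i1 := (mxI_gterm pA1 ltr01) _ h; have i2 := (mxI_gterm pA ltr01) _ hA.
pose F t := expR (- (1 * t)) * psi (real_powmx t A).
pose f t := psi (A *m gterm A 1 t) - psi (gterm (A + 1%:M) 1 t).
have fi : mu.-integrable `]0, +oo[ (EFin \o f) by exact: (integrableBR (mitv _) i2 i1).
have dF t : 0 < t -> is_derive t 1 F (f t).
  move=> t0; have d1 := is_derive_real_powmx A t0 h; have d2 := is_derive_expRNM 1 t.
  have -> : F = (fun t => expR (- (1 * t))) * (fun t => psi (real_powmx t A)) by [].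
  apply: is_derive_eq; rewrite /f /gterm addrK -scalemxAr !RlinZ// /GRing.scale/=.
  by ring.
have cf t : 0 < t -> {for t, continuous f}.
  by move=> t0; apply: contB; [exact: continuous_gterm hA t0|exact: continuous_gterm h t0].
have := @FTC_pos R F f 0 0 dF cf fi.
rewrite subrr RintegralB// => H.
apply/esym/eqP; rewrite -subr_eq0; apply/eqP; apply: H.
- have c1 := real_powmx_cvg0 pA h.
  have c2 : expR (- (1 * t)) @[t --> (0:R)^'+] --> expR (- (1 * 0)).
    by apply: cvg_at_right_filter; exact: continuous_expRNM.
  by have := cvgM c2 c1; rewrite mulr0; apply.
- by under eq_cvg do rewrite /F mul1r; exact: expRN_cvgy.
Qed.

End MatrixGamma.

(** * The lower incomplete case *)

Section Primitive.
Context {R : realType}.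
Implicit Types (h F f : R -> R) (c d t x y : R).
Local Notation mu := (@lebesgue_measure R).
Local Notation RT := (measurableTypeR R).

Lemma FTC_below F f (l0 lx x : R) : 0 < x ->
  (forall t, 0 < t < x -> is_derive t 1 F (f t)) ->
  (forall t, 0 < t < x -> {for t, continuous f}) ->
  mu.-integrable `]0, x[ (EFin \o f) ->
  F t @[t --> 0^'+] --> l0 -> F t @[t --> x^'-] --> lx ->
  \int[mu]_(t in `]0, x[) f t = lx - l0.
Proof.
move=> x0 dF cf fi F0 Fx.
(* Driving both endpoints by one parameter turns the limit along the product filter into a
   one-variable limit. *)
have cx : (x - c) @[c --> 0^'+] --> x^'-.
  have H : (x - c) @[c --> 0^'+] --> x.
    rewrite -[X in _ --> X]subr0; apply: cvgB; first exact: cvg_cst.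
    by apply: cvg_at_right_filter; exact: cvg_id.
  move=> A [e/= e0 HA]; have /cvgrPdist_lt/(_ _ e0) := H; apply: filter_app; near=> c => Hc.
  by apply: HA => //=; rewrite ltrBlDr ltrDl; near: c; exact: nbhs_right_gt.
have c1 : (c, x - c) @[c --> 0^'+] --> filter_prod (0:R)^'+ x^'-.
  move=> A [[B C]/= [HB HC] BC]; apply: filterS2 HB (cx _ HC) => c Bc Cc.
  exact: (BC (c, x - c)).
have c2 := cvg_comp _ _ c1 (improper_below x0 fi).
have c3 : F (x - c) - F c @[c --> 0^'+] --> lx - l0.
  by apply: cvgB => //; apply: cvg_comp Fx.
apply: (cvg_unique (@Rhausdorff R) c2); apply: cvg_trans c3; apply: near_eq_cvg.
near=> c; rewrite /=.
have c0 : 0 < c by near: c; exact: nbhs_right_gt.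
have cx2 : c <= x / 2 by near: c; apply: nbhs_right_le; rewrite divr_gt0.
apply/esym/FTC; first by lra.
- by move=> t tcd; apply: dF; lra.
- by move=> t tcd; apply: cf; lra.
Unshelve. all: by end_near. Qed.

(** Applied to the integrand of the theorem under a functional, this is the function [A] of the
    overview. *)
Definition prim h d : R := \int[mu]_(t in `]0, d]) h t.

Section Local.
Variables (h : R -> R) (y : R).
Hypothesis hi : mu.-integrable `]0, y[ (EFin \o h).
Hypothesis hc : forall t, 0 < t < y -> {for t, continuous h}.

Lemma integrable_oc d : d < y -> mu.-integrable `]0, d] (EFin \o h).
Proof.
move=> dy; apply: integrableS hi; [exact: mitv|exact: mitv|].
by move=> t /=; rewrite !in_itv/= => /andP[-> /le_lt_trans->].
Qed.

Lemma prim_derive t : 0 < t < y -> is_derive t 1 (prim h) (h t).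
Proof.
move=> /andP[t0 ty]; pose u := (t + y) / 2.
have tu : t < u by rewrite /u; lra.
have uy : u < y by rewrite /u; lra.
have [] := @continuous_FTC1 R h (BRight 0) t u tu (integrable_oc uy) _ _.
- exact: t0.
- by apply: hc; rewrite t0.
move=> d1 d2; apply: DeriveDef; first exact: d1.
by move: d2; rewrite derive1E.
Qed.

Lemma prim_cont t : 0 < t < y -> {for t, continuous (prim h)}.
Proof. by move=> /prim_derive; exact: is_derive_continuous. Qed.

Lemma primB c d : 0 < c -> c <= d -> d < y ->
  \int[mu]_(t in `[c, d]) h t = prim h d - prim h c.
Proof.
move=> c0 cd dy; apply: FTC => // t /andP[ct td]; [apply: prim_derive|apply: hc];
  by rewrite (lt_le_trans c0 ct) (le_lt_trans td dy).
Qed.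

Lemma prim_le d : d < y -> `|prim h d| <= \int[mu]_(t in `]0, y[) `|h t|.
Proof.
move=> dy; have di := integrable_oc dy.
apply: le_trans (le_normr_Rintegral _ di) _; first exact: mitv.
have i1 : mu.-integrable `]0, y[ (EFin \o (fun t => `|h t|)) by exact: integrable_norm hi.
have [d0|d0] := leP 0 d.
  rewrite -subr_ge0 (Rintegral_itvB i1) ?bnd_simp//.
  by apply: Rintegral_ge0.
rewrite set_itv_ge ?bnd_simp -?leNgt ?(ltW d0)// Rintegral_set0.
exact: Rintegral_ge0.
Qed.

Lemma prim_cvg0 : 0 < y -> prim h d @[d --> 0^'+] --> 0.
Proof.
move=> y0; pose u := y / 2; have u0 : 0 < u by rewrite divr_gt0.
have uy : u < y by rewrite /u; lra.
have i1 : mu.-integrable `[0, u] (EFin \o h).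
  have /integrableP[m1 m2] := integrable_oc uy.
  apply/integrableP; split; first exact/emeasurable_fun_itv_obnd_cbndP.
  rewrite -integral_itv_obnd_cbnd//; exact: measurableT_comp m1.
have c1 := cvg_at_right_filter (parameterized_integral_cvg_left u0 i1).
apply: cvg_trans c1; apply: near_eq_cvg; near=> d; apply/esym/Rintegral_itv_obnd_cbnd.
by apply: integrable_oc; apply: le_lt_trans uy; near: d; exact: nbhs_right_le.
Unshelve. all: by end_near. Qed.

End Local.
End Primitive.

(** * Geometric decay and termwise integration up to a finite bound *)

Section PowerSeries.
Context {R : realType} {N : nat}.
Local Notation M := 'M[R[i]]_N.
Local Notation mu := (@lebesgue_measure R).
Local Notation RT := (measurableTypeR R).
Implicit Types (A B X Y : M) (psi : M -> R) (t y q x : R).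

Lemma cvg_series_bounded (u : nat -> M) : cvgn (series u) ->
  exists2 K, 0 <= K & forall n, nrm (u n) <= K.
Proof.
move=> cu; set L := limn (series u).
have /cvg_nrmP c0 : series u n @[n --> \oo] --> L by exact: cu.
have [K [_ HK]] := cvg_seq_bounded (cvgP _ c0).
have HK1 n : nrm (series u n - L) <= K + 1.
  by apply: le_trans (ler_norm _) _; apply: HK => //; rewrite ltrDl.
have K1 : 0 <= K + 1 by exact: le_trans (nrm_ge0 _) (HK1 0%N).
exists (2 * (K + 1)) => [|n]; first exact: mulr_ge0.
have -> : u n = (series u n.+1 - L) - (series u n - L).
  by rewrite opprB addrA subrK /series/= big_nat_recr//= addrAC subrr add0r.
by apply: le_trans (nrmB _ _) _; have := HK1 n; have := HK1 n.+1; lra.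
Qed.

Lemma pwX (a s : R) l : 0 < s -> pw a (s ^+ l) = pw a s ^+ l.
Proof. by move=> s0; rewrite /pw lnXn// mulrnAr -mulr_natl expRM_natl. Qed.

Lemma pw_le (a s t : R) : 0 <= a -> 0 < s -> s <= t -> pw a s <= pw a t.
Proof.
by move=> a0 s0 st; rewrite ler_expR ler_wpM2l// ler_ln// posrE// (lt_le_trans s0).
Qed.

Lemma pw_lt1 (a s : R) : 0 < a -> 0 < s < 1 -> pw a s < 1.
Proof. by move=> a0 s01; rewrite expR_lt1 pmulr_rlt0// ln_lt0. Qed.

Variables (P Q : M) (D : nat -> M).
Hypotheses (pP : posmx P) (pQ : posmx Q) (cPQ : comm_mx P Q).

Lemma posM l : posmx (P *+ l + Q). Proof. exact: posmxMnD. Qed.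

Lemma powME t l : real_powmx t (P *+ l + Q - 1%:M) =
  real_powmx t (P *+ l) *m real_powmx t (Q - 1%:M).
Proof.
rewrite -addrA (@real_powmxD _ _ t (P *+ l))//.
apply: comm_mxB; last exact: comm_mx1.
by apply: comm_mx_sym; apply: comm_mxMn; exact: comm_mx_sym.
Qed.

(** The form in which convergence of the R-series is used: one geometric bound for all [t] up to
    [y]. *)
Definition geo y := exists K r : R, [/\ 0 <= K, 0 <= r < 1 &
  forall t l, 0 < t <= y -> nrm (D l *m real_powmx t (P *+ l)) <= K * r ^+ l].

(* D_l t^(lP) = (D_l x^(lP)) (t/x)^(lP), a bounded factor times a geometrically
   decaying one. *)
Lemma cvg_geo x y : 0 < y < x ->
  cvgn (series (fun l => D l *m real_powmx x (P *+ l))) -> geo y.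
Proof.
move=> /andP[y0 yx] /cvg_series_bounded[K K0 HK].
have x0 := lt_trans y0 yx.
have [a [C [a0 C0 HC]]] := pP.
exists (K * C), (pw a (y / x)); split; first exact: mulr_ge0.
  by rewrite pw_ge0/= pw_lt1// divr_gt0// ltr_pdivrMr// mul1r.
move=> t l /andP[t0 ty].
have s0 : 0 < t / x by rewrite divr_gt0.
have -> : t = x * (t / x) by rewrite mulrCA mulfV ?mulr1 ?gt_eqF.
rewrite real_powmxM// mulmxA; apply: le_trans (nrmM _ _) _; rewrite -mulrA.
apply: ler_pM; [exact: nrm_ge0|exact: nrm_ge0|exact: HK|].
rewrite real_powmxMn//; apply: le_trans (HC _ _) _.
  rewrite exprn_gt0//= exprn_ile1 ?(ltW s0)// ler_pdivrMr// mul1r.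
  exact: le_trans ty (ltW yx).
rewrite pwX//; apply: ler_wpM2l => //; apply: lerXn2r; rewrite ?nnegrE ?pw_ge0//.
by apply: pw_le => //; [exact: ltW|rewrite ler_pM2r ?invr_gt0].
Qed.

Lemma geo_bound y : geo y -> exists K r b c : R, [/\ [/\ 0 <= K, 0 <= r < 1, 0 < b & 0 < c] &
  forall t l, 0 < t <= y ->
    nrm (D l *m real_powmx t (P *+ l + Q - 1%:M)) <= K * r ^+ l * (pw (b - 1) t + pw (c - 1) t)].
Proof.
move=> [K [r [K0 r01 HK]]]; have [b [c [C [b0 c0 C0 HC]]]] := posmx_bound pQ.
exists (K * C), r, b, c; split; first by split=> //; exact: mulr_ge0.
move=> t l tl; have t0 : 0 < t by case/andP: tl.
rewrite powME mulmxA; apply: le_trans (nrmM _ _) _.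
have -> : K * C * r ^+ l * (pw (b - 1) t + pw (c - 1) t) =
    K * r ^+ l * (C * (pw (b - 1) t + pw (c - 1) t)) by ring.
apply: ler_pM; [exact: nrm_ge0|exact: nrm_ge0|exact: HK|exact: HC].
Qed.

(* [expR (- t) * Gs psi t] is [psi] of the integrand of the theorem. *)
Definition Gs psi t : R :=
  limn (series (fun l => psi (D l *m real_powmx t (P *+ l + Q - 1%:M)))).

Lemma Gs_abs psi y t : Rlin psi -> geo y -> 0 < t <= y ->
  cvgn (series (fun l => `|psi (D l *m real_powmx t (P *+ l + Q - 1%:M))|)).
Proof.
move=> h /geo_bound[K [r [b [c [[K0 r01 b0 c0] HK]]]]] ty.
have [k k0 hk] := Rlin_bound h.
have cg := @cvg_geometric_dom R (k * K * (pw (b - 1) t + pw (c - 1) t)) r r01.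
apply: (dominated_cvg_series _ cg) => l.
rewrite normr_id; apply: le_trans (hk _) _; rewrite -!mulrA; apply: ler_wpM2l => //.
by apply: le_trans (HK _ _ ty) _; rewrite -!mulrA [r ^+ l * _]mulrC.
Qed.

Lemma Gs_cvg psi y t : Rlin psi -> geo y -> 0 < t <= y ->
  cvgn (series (fun l => psi (D l *m real_powmx t (P *+ l + Q - 1%:M)))).
Proof. by move=> h gy ty; apply: normed_cvg; exact: Gs_abs h gy ty. Qed.

Lemma Gs_cont psi y t : Rlin psi -> geo y -> 0 < t < y -> {for t, continuous (Gs psi)}.
Proof.
move=> h gy /andP[t0 ty].
have [K [r [b [c [[K0 r01 b0 c0] HK]]]]] := geo_bound gy.
have [k k0 hk] := Rlin_bound h.
(* The extra 1 leaves room for the points near [t], by continuity of the two powers. *)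
pose C := pw (b - 1) t + pw (c - 1) t + 1.
have cb : {for t, continuous (fun t => pw (b - 1) t + pw (c - 1) t)}.
  by apply: contD; exact: continuous_pw.
apply: (@tannery R R (nbhs t) _ _ _ (fun l => (k * K * C) * r ^+ l)).
- near=> s => l.
  have s0 : 0 < s by near: s; exact: lt_nbhsr.
  have sy : s <= y by apply: ltW; near: s; exact: lt_nbhsl.
  apply: le_trans (hk _) _; rewrite -!mulrA; apply: ler_wpM2l => //.
  apply: le_trans (HK _ l _) _; first by rewrite s0.
  rewrite -!mulrA; apply: ler_wpM2l => //; rewrite [leRHS]mulrC.
  apply: ler_wpM2l; first by apply: exprn_ge0; case/andP: r01.
  near: s; have /cvgrPdist_lt/(_ _ ltr01) := cb; apply: filterS => s; rewrite ltr_norml.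
  by move=> /andP[H _]; rewrite /C; lra.
- exact: cvg_geometric_dom.
- by move=> l; exact: (@continuous_real_powmx _ _ (fun A => psi (D l *m A)) (P *+ l + Q - 1%:M) t t0 (Rlin_mull (D l) h)).
Unshelve. all: by end_near. Qed.

(** The weight [q^(M_l)] dilates the variable: for [t < x] the coefficient [D l] only meets
    arguments below [q x], where [geo (q * x)] controls it. *)
Lemma vtermE q t l : 0 < q -> 0 < t ->
  D l *m real_powmx q (P *+ l + Q) *m gterm (P *+ l + Q) 1 t =
  (q * expR (- t))%:C *: (D l *m real_powmx (q * t) (P *+ l + Q - 1%:M)).
Proof.
move=> q0 t0; rewrite real_powmxM// [real_powmx q (_ - _)]real_powmxB1// /gterm mul1r.
rewrite -scalemxAl -!scalemxAr scalerA -mulmxA; congr (_ *: _).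
rewrite -rmorphM/=; congr (_%:C).
by rewrite mulrAC mulfV ?mul1r// gt_eqF.
Qed.

Lemma gterm_dom q x : 0 < q -> 0 < x -> geo (q * x) -> exists (w : R -> R) (r : R),
  [/\ 0 <= r < 1, mu.-integrable `]0, x[ (EFin \o w) & forall l t, 0 < t < x ->
    nrm (D l *m real_powmx q (P *+ l + Q) *m gterm (P *+ l + Q) 1 t) <= r ^+ l * w t].
Proof.
move=> q0 x0 /geo_bound[K [r [b [c [[K0 r01 b0 c0] HK]]]]].
exists (fun t => q * K * pw (b - 1) q * (pw (b - 1) t * expR (- (1 * t))) +
  q * K * pw (c - 1) q * (pw (c - 1) t * expR (- (1 * t)))), r; split=> //.
  have i1 := integrableZR (q * K * pw (b - 1) q) (mitv _) (integrable_gamma b0 ltr01).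
  have i2 := integrableZR (q * K * pw (c - 1) q) (mitv _) (integrable_gamma c0 ltr01).
  apply: integrableS (integrableDR (mitv _) i1 i2); [exact: mitv|exact: mitv|].
  by move=> t/=; rewrite !in_itv/= andbT => /andP[].
move=> l t /andP[t0 tx]; rewrite vtermE// nrmZ cmod_real ger0_norm ?mulr_ge0 ?expR_ge0 ?(ltW q0)//.
rewrite mul1r; have qt : 0 < q * t <= q * x by rewrite mulr_gt0//= ler_pM2l// ltW.
have := HK _ l qt; rewrite !pwM// => H.
have -> : r ^+ l * (q * K * pw (b - 1) q * (pw (b - 1) t * expR (- t)) +
    q * K * pw (c - 1) q * (pw (c - 1) t * expR (- t))) =
  q * expR (- t) * (K * r ^+ l * (pw (b - 1) q * pw (b - 1) t + pw (c - 1) q * pw (c - 1) t)) by ring.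
by apply: ler_wpM2l => //; rewrite mulr_ge0 ?expR_ge0// ltW.
Qed.

(** The geometric bound leaves an integrable function of [t] times [r ^+ l], so absolute convergence
    is not lost by integrating. It is used with [q < 1] for the Abel means, and with [q = 1]
    wherever [geo] holds up to the endpoint. *)
Lemma lower_gamma_series q x psi : 0 < q -> 0 < x -> geo (q * x) -> Rlin psi ->
  [/\ mu.-integrable `]0, x[ (EFin \o (fun t => q * expR (- t) * Gs psi (q * t))),
    \int[mu]_(t in `]0, x[) (q * expR (- t) * Gs psi (q * t)) = limn (series (fun l =>
      psi (D l *m real_powmx q (P *+ l + Q) *m lower_gamma_mx (P *+ l + Q) x))) &
    cvgn (series (fun l => D l *m real_powmx q (P *+ l + Q) *m lower_gamma_mx (P *+ l + Q) x))].
Proof.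
move=> q0 x0 gqx h; have [w [r [r01 wi Hw]]] := gterm_dom q0 x0 gqx.
pose X l := D l *m real_powmx q (P *+ l + Q).
pose v l t := psi (X l *m gterm (P *+ l + Q) 1 t).
have gi l : mxI `]0, x[ (gterm (P *+ l + Q) 1).
  apply: mxIS (mxI_gterm (posM l) ltr01) => [||t/=]; try exact: mitv.
  by rewrite !in_itv/= andbT => /andP[].
have vi l : mu.-integrable `]0, x[ (EFin \o v l) by exact: gi _ (Rlin_mull (X l) h).
have [k k0 hk] := Rlin_bound h.
have vE l : \int[mu]_(t in `]0, x[) v l t = psi (X l *m lower_gamma_mx (P *+ l + Q) x).
  by rewrite (lower_gammaE (posM l) x0) (Rlin_Rintegral (mitv _) (gi l) (Rlin_mull (X l) h)).
have vs t : 0 < t < x -> cvgn (series (fun l => `|v l t|)).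
  move=> tx; have cg := @cvg_geometric_dom R (k * w t) r r01.
  apply: (dominated_cvg_series _ cg) => l; rewrite normr_id.
  by apply: le_trans (hk _) _; rewrite -mulrA ler_wpM2l// [w t * _]mulrC Hw.
have vb l : \int[mu]_(t in `]0, x[) `|v l t| <= k * (\int[mu]_(t in `]0, x[) w t) * r ^+ l.
  have i1 := integrableZR (k * r ^+ l) (mitv _) wi.
  have -> : k * (\int[mu]_(t in `]0, x[) w t) * r ^+ l = k * r ^+ l * (\int[mu]_(t in `]0, x[) w t).
    by rewrite mulrAC.
  rewrite -(RintegralZl _ _ wi)//; apply: le_Rintegral => //; first exact: integrable_norm (vi l).
  move=> t /=; rewrite in_itv/= => tx; apply: le_trans (hk _) _.
  by rewrite -mulrA ler_wpM2l// Hw.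
have vlim t : 0 < t < x -> limn (series (v ^~ t)) = q * expR (- t) * Gs psi (q * t).
  move=> /andP[t0 tx]; have qt : 0 < q * t <= q * x by rewrite mulr_gt0//= ler_pM2l// ltW.
  have -> : v ^~ t = (q * expR (- t)) *: (fun l => psi (D l *m real_powmx (q * t) (P *+ l + Q - 1%:M))).
    by apply/funext => l; rewrite /v /X vtermE// RlinZ.
  rewrite lim_seriesZ//; exact: Gs_cvg h gqx qt.
have vs' t : `]0, x[%classic t -> cvgn (series (fun l => `|v l t|)).
  by rewrite /= in_itv/=; exact: vs.
have [i1 i2] := Rintegral_series (mitv _) vi vs' vb (cvg_geometric_dom r01).
split.
- by apply: eq_integrable_itv i1 => t; rewrite in_itv/= => tx; rewrite vlim.
- apply: etrans (etrans _ i2) _; last by congr (limn (series _)); apply/funext => l; exact: vE.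
  by apply: eq_Rint => t; rewrite in_itv/= => tx; rewrite vlim.
- apply: (@cvg_series_nrm _ _ _ (fun l => 2 * (N * N)%:R * (\int[mu]_(t in `]0, x[) w t) * r ^+ l)).
    move=> l; have fi : mxI `]0, x[ (fun t => X l *m gterm (P *+ l + Q) 1 t).
      by move=> phi hphi; exact: gi _ (Rlin_mull (X l) hphi).
    have -> : D l *m real_powmx q (P *+ l + Q) *m lower_gamma_mx (P *+ l + Q) x =
        mx_Rintegral `]0, x[ (fun t => X l *m gterm (P *+ l + Q) 1 t).
      apply: RlinP => phi hphi; rewrite (Rlin_Rintegral (mitv _) fi hphi).
      by rewrite (lower_gammaE (posM l) x0) (Rlin_Rintegral (mitv _) (gi l) (Rlin_mull (X l) hphi)).
    have wl := integrableZR (r ^+ l) (mitv _) wi.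
    apply: le_trans (nrm_Rintegral_le (mitv _) fi wl _) _; last first.
      by rewrite (RintegralZl _ _ wi)// -!mulrA [r ^+ l * _]mulrC.
    by move=> t /=; rewrite in_itv/= => tx; exact: Hw.
  exact: cvg_geometric_dom.
Qed.

End PowerSeries.

(** * Abel's theorem with matrix weights *)

Section Abel.
Context {R : realType} {N : nat}.
Local Notation M := 'M[R[i]]_N.
Implicit Types (A B X Y : M) (psi : M -> R) (t y q x : R).

Lemma nrm_mx_expB1 A : nrm (mx_exp A - 1%:M) <= nrm (1%:M : M) * (nrm A * expR (nrm A)).
Proof.
have c1 : series (exp_coefmx A) n - 1%:M @[n --> \oo] --> mx_exp A - 1%:M.
  by apply: cvgB; [exact: cvg_exp_coefmx|exact: cvg_cst].
apply: (nrm_lim_le c1); near=> n.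
have /prednK <- : (0 < n)%N by near: n; exact: nbhs_infty_gt.
rewrite /series/= big_nat_recl// {1}/exp_coefmx fact0 invr1 scale1r expr0 addrAC subrr add0r.
apply: le_trans (nrm_sum _ _ _) _.
apply: (@le_trans _ _ (\sum_(0 <= i < n.-1) nrm (1%:M : M) * (nrm A * (nrm A ^+ i / i`!%:R)))).
  apply: ler_sum => i _; apply: le_trans (nrm_exp_coefmx _ _) _; apply: ler_wpM2l; first exact: nrm_ge0.
  rewrite exprS -mulrA; apply: ler_wpM2l; first exact: nrm_ge0.
  apply: ler_wpM2l; first by rewrite exprn_ge0// nrm_ge0.
  by rewrite lef_pV2 ?posrE ?ltr0n ?fact_gt0// ler_nat factS leq_pmull.
rewrite -mulr_sumr -mulr_sumr; apply: ler_wpM2l; first exact: nrm_ge0.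
apply: ler_wpM2l; first exact: nrm_ge0.
have cv : cvgn (series (exp_coeff (nrm A))) by exact: is_cvg_series_exp_coeff.
apply: (@series_le_lim _ (exp_coeff (nrm A))) => // i.
by rewrite divr_ge0// exprn_ge0// nrm_ge0.
Unshelve. all: by end_near. Qed.

(** From [e^(-a t) <= 1 / (1 + a t)]. Its use is that the geometric series of ratio [e^(-a t)] has
    sum [O(1/t)]. *)
Lemma expRB1_ge (a t : R) : 0 < a -> 0 < t <= 1 -> a / (1 + a) * t <= 1 - expR (- (a * t)).
Proof.
move=> a0 /andP[t0 t1]; have at0 : 0 < a * t by rewrite mulr_gt0.
have H : expR (- (a * t)) <= (1 + a * t)^-1.
  by rewrite expRN lef_pV2 ?posrE ?expR_gt0 ?expR_ge1Dx// addr_gt0.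
apply: le_trans (lerB (lexx 1) H).
have -> : 1 - (1 + a * t)^-1 = a * t / (1 + a * t).
  by field; rewrite gt_eqF// addr_gt0.
rewrite mulrAC; apply: ler_wpM2l; first exact: ltW.
rewrite lef_pV2 ?posrE ?addr_gt0//; nra.
Qed.

Lemma half_bound (X e : R) : 0 <= X -> 0 < e -> X * (e / (2 * (X + 1))) <= e / 2.
Proof.
move=> X0 e0; have X1 : 0 < X + 1 by rewrite ltr_wpDl.
rewrite mulrA ler_pdivrMr ?mulr_gt0//.
have -> : e / 2 * (2 * (X + 1)) = X * e + e by field.
by rewrite lerDl ltW.
Qed.

Lemma sum_lt_le (m n : nat) : \sum_(0 <= l < n) (l < m)%:R <= m%:R :> R.
Proof.
suff -> : \sum_(0 <= l < n) (l < m)%:R = (minn n m)%:R :> R by rewrite ler_nat geq_minr.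
elim: n => [|n IH]; first by rewrite big_geq// min0n.
rewrite big_nat_recr//= IH -natrD; congr (_%:R).
case: (ltnP n m) => nm /=.
  by rewrite (minn_idPl nm) addn1.
by rewrite (minn_idPr (leqW nm)) addn0.
Qed.

Variables (P Q : M).
Hypotheses (pP : posmx P) (pQ : posmx Q) (cPQ : comm_mx P Q).
Local Notation W y l := (real_powmx (expR (- y)) (P *+ l + Q)).

(** Since [P] and [Q] commute, consecutive weights differ by the factor [1 - e^(-y P)], which is
    [O(y)], while [e^(-y l P)] decays geometrically in [l]. *)
Lemma abel_weight_bound : exists C a : R, [/\ 0 <= C, 0 < a & forall y l, 0 < y <= 1 ->
  nrm (W y l) <= C * expR (- (a * y)) ^+ l /\
  nrm (W y l - W y l.+1) <= C * y * expR (- (a * y)) ^+ l].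
Proof.
have [a [C [a0 C0 HC]]] := pP; have [b [B [b0 B0 HB]]] := pQ.
pose K := nrm (1%:M : M) * (nrm P * expR (nrm P)).
have K0 : 0 <= K by rewrite !mulr_ge0 ?nrm_ge0 ?expR_ge0.
exists (C * (1 + K) * B), a; split=> //; first by rewrite !mulr_ge0// addr_ge0.
move=> y l /andP[y0 y1].
have e01 : 0 < expR (- y) <= 1 by rewrite expR_gt0/= expR_le1 oppr_le0 ltW.
have hQ : nrm (real_powmx (expR (- y)) Q) <= B.
  by apply: le_trans (HB _ e01) _; rewrite -[leRHS]mulr1; apply: ler_wpM2l => //; apply: pw_le1 => //; exact: ltW.
have hP : nrm (real_powmx (expR (- y)) (P *+ l)) <= C * expR (- (a * y)) ^+ l.
  rewrite real_powmxMn ?expR_gt0//; apply: le_trans (HC _ _) _.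
    by rewrite exprn_gt0 ?expR_gt0//= exprn_ile1 ?expR_ge0//; case/andP: e01.
  by rewrite pwX ?expR_gt0// /pw expRK mulrN.
have hK : nrm (1%:M - real_powmx (expR (- y)) P) <= K * y.
  rewrite -nrmN opprB /real_powmx expRK; apply: le_trans (nrm_mx_expB1 _) _.
  rewrite nrmZ cmod_real normrN (gtr0_norm y0) /K -!mulrA; apply: ler_wpM2l; first exact: nrm_ge0.
  rewrite mulrCA; apply: ler_wpM2l; first exact: nrm_ge0.
  rewrite mulrC; apply: ler_wpM2r; first exact: ltW.
  by rewrite ler_expR ler_piMl// nrm_ge0.
have cl k : comm_mx (P *+ k) Q by apply: comm_mx_sym; apply: comm_mxMn; exact: comm_mx_sym.
set E := expR (- (a * y)) ^+ l in hP *.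
have E0 : 0 <= E by rewrite exprn_ge0// expR_ge0.
split.
  rewrite (real_powmxD _ (cl l)); apply: le_trans (nrmM _ _) _.
  apply: (@le_trans _ _ (C * E * B)).
    by apply: ler_pM; rewrite ?nrm_ge0.
  rewrite mulrAC -[leLHS]mulr1 -mulrA; rewrite [C * (1 + K) * B]mulrAC -[leRHS]mulrA.
  by apply: ler_wpM2l; [exact: mulr_ge0|rewrite mulr1 ler_peMl// lerDl].
rewrite (real_powmxD _ (cl l)) (real_powmxD _ (cl l.+1)) mulrSr.
rewrite (@real_powmxD _ _ _ (P *+ l) P); last by apply: comm_mx_sym; apply: comm_mxMn; exact: comm_mx_refl.
rewrite -mulmxBl -[X in X - _]mulmx1 -mulmxBr.
apply: le_trans (nrmM _ _) _.
apply: (@le_trans _ _ ((C * E) * (K * y) * B)).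
  apply: ler_pM; rewrite ?nrm_ge0//; apply: le_trans (nrmM _ _) _.
  by apply: ler_pM; rewrite ?nrm_ge0.
have -> : C * (1 + K) * B * y * E = C * E * (K * y) * B + C * B * y * E by ring.
by rewrite lerDl !mulr_ge0// ltW.
Qed.

(* Summation by parts: consecutive weights differ by [O(y)] times a geometric
   term whose sum is [O(1/y)]. *)
Lemma abel_limit (a : nat -> M) psi : Rlin psi -> cvgn (series a) ->
  limn (series (fun l => psi (a l *m W y l))) @[y --> 0^'+] --> psi (limn (series a)).
Proof.
move=> h ca; set L := limn (series a).
have [C [al [C0 al0 HW]]] := abel_weight_bound.
have [k k0 hk] := Rlin_bound h.
(* Summation by parts is done with these remainders and not with the partial sums, because they tend
   to 0. *)
pose r n := series a n - L.
have rc : nrm (r n) @[n --> \oo] --> 0 by apply/cvg_nrmP; exact: ca.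
have [Kr [_ HKr]] := cvg_seq_bounded (cvgP _ rc).
pose B := Kr + 1; have HB n : nrm (r n) <= B.
  by apply: le_trans (ler_norm _) _; apply: HKr => //; rewrite ltrDl.
have B0 : 0 <= B := le_trans (nrm_ge0 _) (HB 0%N).
have aE l : a l = r l.+1 - r l.
  by rewrite /r opprB addrA subrK /series/= big_nat_recr//= addrAC subrr add0r.
have r0 : r 0%N = - L by rewrite /r /series/= big_geq// sub0r.
clearbody r L.
pose v y l := psi (r l.+1 *m (W y l - W y l.+1)).
have parts y n : series (fun l => psi (a l *m W y l)) n =
    psi (r n *m W y n) + psi (L *m W y 0%N) + series (v y) n.
  elim: n => [|n IH].
    rewrite /series/= !big_geq// addr0 r0 mulNmx (RlinN _ h) addNr.
    by [].
  rewrite [series _ n.+1](_ : _ = series (fun l => psi (a l *m W y l)) n + psi (a n *m W y n)); last first.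
    by rewrite /series/= big_nat_recr.
  rewrite [series (v y) n.+1](_ : _ = series (v y) n + v y n); last by rewrite /series/= big_nat_recr.
  have e1 : psi (a n *m W y n) = psi (r n.+1 *m W y n) - psi (r n *m W y n).
    by rewrite aE mulmxBl; exact: RlinB.
  have e2 : v y n = psi (r n.+1 *m W y n) - psi (r n.+1 *m W y n.+1).
    by rewrite /v mulmxBr; exact: RlinB.
  have gen (p0 p1 p2 c S : R) : p0 + c + S + (p1 - p0) = p2 + c + (S + (p1 - p2)) by ring.
  have e3 := etrans (congr2 (fun u w => u + w) IH e1)
    (gen _ _ (psi (r n.+1 *m W y n.+1)) (psi (L *m W y 0%N)) (series (v y) n)).
  apply: etrans e3 _.
  by congr (_ + (_ + _)); exact: esym e2.
have vb y l : 0 < y <= 1 -> `|v y l| <= k * (nrm (r l.+1) * (C * y * expR (- (al * y)) ^+ l)).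
  move=> y01; apply: le_trans (hk _) _; apply: ler_wpM2l => //.
  apply: le_trans (nrmM _ _) _; apply: ler_wpM2l; first exact: nrm_ge0.
  by case: (HW y l y01).
have q01 y : 0 < y <= 1 -> 0 <= expR (- (al * y)) < 1.
  by move=> /andP[y0 _]; rewrite expR_ge0/= expR_lt1 oppr_lt0 mulr_gt0.
have vc y : 0 < y <= 1 -> cvgn (series (v y)).
  move=> y01; have cg := @cvg_geometric_dom R (k * B * C * y) _ (q01 y y01).
  apply: (dominated_cvg_series _ cg) => l; apply: le_trans (vb y l y01) _.
  rewrite -!mulrA; apply: ler_wpM2l => //; apply: ler_wpM2r => //.
  have /andP[y0 _] := y01.
  by rewrite !mulr_ge0 ?exprn_ge0 ?expR_ge0// ltW.
have limE y : 0 < y <= 1 -> limn (series (fun l => psi (a l *m W y l))) =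
    psi (L *m W y 0%N) + limn (series (v y)).
  move=> y01; apply/cvg_lim => //.
  have -> : series (fun l => psi (a l *m W y l)) =
      (fun n => psi (r n *m W y n) + psi (L *m W y 0%N) + series (v y) n).
    by apply/funext => n; exact: parts.
  apply: cvgD; last exact: vc.
  rewrite -[X in _ --> X]add0r; apply: cvgD; last exact: cvg_cst.
  have c0 : k * (nrm (r n) * C) @[n --> \oo] --> 0.
    rewrite -[X in _ --> X](mulr0 k); apply: cvgMl_tmp.
    by rewrite -[X in _ --> X](mul0r C); apply: cvgMr_tmp.
  apply/norm_cvg0P; apply: (squeeze_cvgr _ (cvg_cst 0) c0).
  near=> n; rewrite normr_ge0/=; apply: le_trans (hk _) _; apply: ler_wpM2l => //.
  apply: le_trans (nrmM _ _) _; apply: ler_wpM2l; first exact: nrm_ge0.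
  case: (HW y n y01) => H _; apply: le_trans H _; rewrite -[leRHS]mulr1; apply: ler_wpM2l => //.
  by apply: exprn_ile1; case/andP: (q01 _ y01) => ? /ltW.
have c1 : psi (L *m W y 0%N) @[y --> 0^'+] --> psi L.
  rewrite -{2}[L]mulmx1 -(real_powmx1 (P *+ 0 + Q)) -[X in real_powmx X _]expR0 -[X in expR X]oppr0.
  apply: cvg_at_right_filter.
  have := @continuous_real_powmx R N _ (P *+ 0 + Q) (expR (- 0)) (expR_gt0 _) (Rlin_mull L h).
  apply: (@continuous_comp R R R (fun y => expR (- y)) (fun t => psi (L *m real_powmx t (P *+ 0 + Q))) 0).
  by apply: continuous_comp; [exact: opp_continuous|exact: continuous_expR].
have c2 : limn (series (v y)) @[y --> 0^'+] --> 0.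
  apply/cvgrPdist_le => e e0.
  (* For [l >= m] the remainder is at most [d], and [d] offsets the [O(1/y)] geometric sum times the
     factor [y]; the [m] earlier terms are each [O(y)] and are handled by [y <= y1]. Each part costs
     [e / 2] by [half_bound]. *)
  pose d := e / (2 * (k * C * ((1 + al) / al) + 1)).
  have X0 : 0 <= k * C * ((1 + al) / al).
    by rewrite !mulr_ge0// ?invr_ge0 ?addr_ge0// ltW.
  have d0 : 0 < d by rewrite divr_gt0// mulr_gt0// ltr_wpDl.
  have /cvgrPdist_le/(_ _ d0)[m _ Hm] := rc.
  have kCBm : 0 <= k * C * B * m%:R by rewrite !mulr_ge0.
  pose y1 := e / (2 * (k * C * B * m%:R + 1)).
  have y10 : 0 < y1 by rewrite divr_gt0// mulr_gt0// ltr_wpDl.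
  near=> y; rewrite sub0r normrN.
  have y0 : 0 < y by near: y; exact: nbhs_right_gt.
  have yle1 : y <= 1 by near: y; exact: nbhs_right_le.
  have yy1 : y <= y1 by near: y; exact: nbhs_right_le.
  have y01 : 0 < y <= 1 by rewrite y0.
  have q1 := q01 _ y01; have q0 : 0 <= expR (- (al * y)) by case/andP: q1.
  have cv := vc y y01.
  have kCy0 : 0 <= k * C * y by rewrite !mulr_ge0// ltW.
  have kCyd0 : 0 <= k * C * y * d by apply: mulr_ge0 => //; exact: ltW.
  rewrite -(cvg_lim (@Rhausdorff R) (cvg_norm cv)).
  apply: limr_le; first exact: cvgP (cvg_norm cv).
  near=> n.
  apply: (@le_trans _ _ (\sum_(0 <= l < n) (k * C * y * d * expR (- (al * y)) ^+ l +
      k * C * y * B * (l < m)%:R))).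
    apply: le_trans (ler_norm_sum _ _ _) _; apply: ler_sum => l _.
    apply: le_trans (vb y l y01) _.
    have -> : k * (nrm (r l.+1) * (C * y * expR (- (al * y)) ^+ l)) =
      k * C * y * (nrm (r l.+1) * expR (- (al * y)) ^+ l) by ring.
    have -> : k * C * y * d * expR (- (al * y)) ^+ l + k * C * y * B * (l < m)%:R =
      k * C * y * (d * expR (- (al * y)) ^+ l + B * (l < m)%:R) by ring.
    apply: ler_wpM2l; first by rewrite !mulr_ge0// ltW.
    have [lm|ml] := ltnP l m.
      rewrite -[leLHS]add0r; apply: lerD.
        by apply: mulr_ge0; [exact: ltW|exact: exprn_ge0].
      apply: ler_pM; [exact: nrm_ge0|exact: exprn_ge0|exact: HB|].
      by apply: exprn_ile1 => //; case/andP: q1 => _ /ltW.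
    rewrite mulr0 addr0; apply: ler_wpM2r; first exact: exprn_ge0.
    have := Hm l.+1 (leqW ml); rewrite sub0r normrN.
    exact: le_trans (ler_norm _).
  rewrite big_split/= -[X in _ + X]mulr_sumr.
  have h1 : \sum_(0 <= l < n) (k * C * y * d * expR (- (al * y)) ^+ l) <= e / 2.
    apply: le_trans (geometric_le n kCyd0 q1) _.
    apply: (@le_trans _ _ (k * C * y * d / (al / (1 + al) * y))).
      apply: ler_wpM2l => //.
      have a1 : 0 < al / (1 + al) * y by rewrite mulr_gt0// divr_gt0// addr_gt0.
      have a2 := expRB1_ge al0 y01.
      by rewrite lef_pV2 ?posrE// (lt_le_trans a1).
    have -> : k * C * y * d / (al / (1 + al) * y) = k * C * ((1 + al) / al) * d.
      by field; rewrite !gt_eqF// addr_gt0.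
    exact: half_bound.
  have h2 : k * C * y * B * (\sum_(0 <= l < n) (l < m)%:R) <= e / 2.
    apply: (@le_trans _ _ (k * C * B * m%:R * y1)); last exact: half_bound.
    have -> : k * C * y * B * (\sum_(0 <= l < n) (l < m)%:R) =
      k * C * B * (\sum_(0 <= l < n) (l < m)%:R) * y by ring.
    apply: ler_pM; [|exact: ltW| |exact: yy1].
      by rewrite !mulr_ge0// sumr_ge0.
    by apply: ler_wpM2l; [rewrite !mulr_ge0|exact: sum_lt_le].
  by rewrite [leRHS](splitr e); exact: lerD.
rewrite -[X in _ --> X]addr0; apply: cvg_trans (cvgD c1 c2); apply: near_eq_cvg.
near=> y; apply/esym/limE; apply/andP; split; first by near: y; exact: nbhs_right_gt.
by near: y; exact: nbhs_right_le.
Unshelve. all: by end_near. Qed.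
End Abel.

(** * Abel means of an integral that converges at its upper endpoint *)

Section AbelIntegralBelow.
Context {R : realType}.
Implicit Types (c d t x y q I : R).
Local Notation mu := (@lebesgue_measure R).
Local Notation RT := (measurableTypeR R).
Variables (g : R -> R) (x I : R).
Hypothesis x0 : 0 < x.
Hypothesis gi : forall y, 0 < y < x -> mu.-integrable `]0, y[ (EFin \o g).
Hypothesis gc : forall t, 0 < t < x -> {for t, continuous g}.
Hypothesis gI : prim g d @[d --> x^'-] --> I.

Let mid t : 0 < t < x -> exists2 y, 0 < y < x & t < y.
Proof. by move=> tx; exists ((t + x) / 2); lra. Qed.

Lemma prim_derive_below t : 0 < t < x -> is_derive t 1 (prim g) (g t).
Proof.
move=> tx; have [y /andP[y0 yx] ty] := mid tx; apply: (@prim_derive _ _ y).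
- by apply: gi; rewrite y0.
- by move=> s /andP[s0 sy]; apply: gc; rewrite s0 (lt_trans sy).
- by rewrite ty andbT; case/andP: tx.
Qed.

Lemma prim_cvg0_below : prim g d @[d --> 0^'+] --> 0.
Proof.
have y0 : 0 < x / 2 < x by have := x0; lra.
by apply: (@prim_cvg0 _ _ (x / 2)); [exact: gi|case/andP: y0].
Qed.

Lemma prim_bounded_below : exists2 K, 0 <= K & forall d, 0 < d < x -> `|prim g d| <= K.
Proof.
have /cvgrPdist_le/(_ 1 ltr01) := gI; move=> [e /= e0 He].
(* Beyond [d0] the primitive is within 1 of its limit; before [d0] it is bounded by integrability of
   [g]. The [x / 2] keeps [d0] positive. *)
pose d0 := Num.max (x / 2) (x - e / 2).
have d0x : 0 < d0 < x.
  rewrite /d0 lt_max gt_max; apply/andP; split; first by apply/orP; left; have := x0; lra.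
  by apply/andP; split; have := x0; lra.
have [y y0x d0y] := mid d0x.
exists (`|I| + 1 + \int[mu]_(t in `]0, y[) `|g t|).
  by rewrite !addr_ge0// Rintegral_ge0.
move=> d /andP[dg0 dx]; have [dd0|d0d] := leP d d0.
  apply: le_trans (prim_le (gi y0x) (le_lt_trans dd0 d0y)) _.
  by rewrite lerDr addr_ge0.
rewrite -[leLHS]addr0; apply: lerD; last exact: Rintegral_ge0.
have := He d; rewrite /= => /(_ _ dx); rewrite -[prim g d](subrK I) => H.
rewrite addrC; apply: le_trans (ler_normD _ _) _; apply: lerD => //.
rewrite subrK in H; rewrite distrC; apply: H.
move: d0d; rewrite /d0 gt_max => /andP[_ H2].
by rewrite gtr0_norm ?subr_gt0//; lra.
Qed.

(** As [q x < x], the dilated primitive is differentiable up to and including [t = x], so the parts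
    formula has an ordinary boundary value there and none at 0. *)
Lemma abel_integral_parts q : 0 < q < 1 ->
  mu.-integrable `]0, x[ (EFin \o (fun t => q * g (q * t) * expR (- ((1 - q) * t)))) ->
  mu.-integrable `]0, x[ (EFin \o (fun t => prim g (q * t) * expR (- ((1 - q) * t)))) /\
  \int[mu]_(t in `]0, x[) (q * g (q * t) * expR (- ((1 - q) * t))) =
  prim g (q * x) * expR (- ((1 - q) * x)) +
  (1 - q) * \int[mu]_(t in `]0, x[) (prim g (q * t) * expR (- ((1 - q) * t))).
Proof.
move=> /andP[q0 q1] i1; have [K K0 HK] := prim_bounded_below.
have qt t : 0 < t <= x -> 0 < q * t < x.
  move=> /andP[t0 tx]; rewrite mulr_gt0//=.
  by apply: lt_le_trans tx; rewrite gtr_pMl.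
have dp t : 0 < t <= x -> is_derive t 1 (fun t => prim g (q * t)) (q * g (q * t)).
  move=> tx; have d1 := prim_derive_below (qt t tx).
  have -> : (fun t => prim g (q * t)) = prim g \o (q \*: (@id R)) by [].
  by apply: is_derive_eq; rewrite /GRing.scale/= mulr1 mulrC.
have cE t : {for t, continuous (fun t => expR (- ((1 - q) * t)))}.
  exact: continuous_expRNM.
have cp t : 0 < t <= x -> {for t, continuous (fun t => prim g (q * t) * expR (- ((1 - q) * t)))}.
  by move=> tx; apply: contM => //; exact: is_derive_continuous (dp t tx).
have i2 : mu.-integrable `]0, x[ (EFin \o (fun t => prim g (q * t) * expR (- ((1 - q) * t)))).
  have iK : mu.-integrable `]0, x[ (EFin \o (fun _ : R => K)).
    apply: integrableS (integrable_cc (h := fun _ => K) (c := 0) (d := x) _); try exact: mitv.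
      by move=> t /=; rewrite !in_itv/= => /andP[/ltW -> /ltW ->].
    by move=> t _; exact: cvg_cst.
  apply: le_integrableR iK _; first exact: mitv.
    apply: measurable_open_continuous; first exact: interval_open.
    by move=> t /=; rewrite in_itv/= => /andP[t0 tx]; apply: cp; rewrite t0 ltW.
  move=> t /=; rewrite in_itv/= => /andP[t0 tx].
  rewrite normrM -[leRHS]mulr1; apply: ler_pM => //; first by apply: HK; apply: qt; rewrite t0 ltW.
  by rewrite ger0_norm ?expR_ge0// expR_le1 oppr_le0 mulr_ge0 ?ltW// subr_gt0.
split=> //.
have i3 := integrableZR (1 - q) (mitv _) i2.
pose F t := prim g (q * t) * expR (- ((1 - q) * t)).
pose f t := q * g (q * t) * expR (- ((1 - q) * t)) - (1 - q) * F t.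
have dF t : 0 < t < x -> is_derive t 1 F (f t).
  move=> /andP[t0 tx]; have tx' : 0 < t <= x by rewrite t0 ltW.
  have d1 := dp t tx'; have d2 := is_derive_expRNM (1 - q) t.
  have -> : F = (fun t => prim g (q * t)) * (fun t => expR (- ((1 - q) * t))) by [].
  by apply: is_derive_eq; rewrite /f /F /GRing.scale/=; ring.
have cf t : 0 < t < x -> {for t, continuous f}.
  move=> /andP[t0 tx]; have tx' : 0 < t <= x by rewrite t0 ltW.
  apply: contB; last by apply: contZ; exact: cp.
  apply: contM => //; apply: contZ; apply: (@continuous_comp R R R (fun t => q * t) g t).
    by apply: contZ; exact: cvg_id.
  by apply: gc; exact: qt.
have F0 : F t @[t --> 0^'+] --> 0.
  have c1 : prim g (q * t) @[t --> 0^'+] --> 0.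
    apply: cvg_comp prim_cvg0_below.
    move=> A [e/= e0 HA]; exists (e / q) => /=; first by rewrite divr_gt0.
    move=> t /=; rewrite sub0r normrN => H t0; apply: HA; last by rewrite mulr_gt0.
    by rewrite /= sub0r normrN normrM gtr0_norm// mulrC -ltr_pdivlMr.
  have c2 : expR (- ((1 - q) * t)) @[t --> (0:R)^'+] --> expR (- ((1 - q) * 0)).
    by apply: cvg_at_right_filter; exact: cE.
  by have := cvgM c1 c2; rewrite mul0r; apply.
have Fx : F t @[t --> x^'-] --> F x.
  by apply: cvg_at_left_filter; apply: cp; rewrite x0/=.
have := FTC_below x0 dF cf (integrableBR (mitv _) i1 i3) F0 Fx.
rewrite subr0 (RintegralB _ i1 i3)// (RintegralZl _ _ i2)//.
by move/eqP; rewrite subr_eq => /eqP.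
Qed.

(** In [abel_integral_parts] the boundary value tends to [I] because [q x] tends to [x] from below,
    and the remaining bounded integral carries the factor [1 - q]. The ratio is written [q = e^(-y)]
    to match the weights of [abel_limit]. *)
Lemma abel_integral_below :
  (forall q, 0 < q < 1 ->
    mu.-integrable `]0, x[ (EFin \o (fun t => q * g (q * t) * expR (- ((1 - q) * t))))) ->
  \int[mu]_(t in `]0, x[) (expR (- y) * g (expR (- y) * t) * expR (- ((1 - expR (- y)) * t)))
    @[y --> 0^'+] --> I.
Proof.
move=> Hi; have [K K0 HK] := prim_bounded_below.
pose J := \int[mu]_(t in `]0, x[) K.
have iK : mu.-integrable `]0, x[ (EFin \o (fun _ : R => K)).
  apply: integrableS (integrable_cc (h := fun _ => K) (c := 0) (d := x) _); try exact: mitv.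
    by move=> t /=; rewrite !in_itv/= => /andP[/ltW -> /ltW ->].
  by move=> t _; exact: cvg_cst.
have ec : expR (- y) @[y --> (0:R)^'+] --> (1:R).
  rewrite -[X in _ --> X]expR0 -[X in expR X]oppr0; apply: cvg_at_right_filter.
  by apply: (@continuous_comp R R R); [exact: opp_continuous|exact: continuous_expR].
have qc : expR (- y) * x @[y --> 0^'+] --> x^'-.
  have H : expR (- y) * x @[y --> 0^'+] --> x.
    by rewrite -[X in _ --> X]mul1r; apply: cvgMr_tmp.
  move=> A [e/= e0 HA]; have /cvgrPdist_lt/(_ _ e0) := H; apply: filter_app; near=> c => Hc.
  apply: HA => //=; rewrite gtr_pMl// expR_lt1 oppr_lt0; near: c; exact: nbhs_right_gt.
have c1 : prim g (expR (- y) * x) * expR (- ((1 - expR (- y)) * x)) @[y --> 0^'+] --> I.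
  rewrite -[X in _ --> X]mulr1; apply: cvgM; first exact: cvg_comp qc gI.
  rewrite -[X in _ --> X]expR0.
  have : - ((1 - expR (- y)) * x) @[y --> 0^'+] --> (0:R).
    have H : - ((1 - expR (- y)) * x) @[y --> (0:R)^'+] --> - ((1 - 1) * x).
      by apply: cvgN; apply: cvgMr_tmp; apply: cvgB => //; exact: cvg_cst.
    by rewrite subrr mul0r oppr0 in H.
  by move=> H; apply: cvg_comp H _; exact: continuous_expR.
have c2 : (1 - expR (- y)) * \int[mu]_(t in `]0, x[)
    (prim g (expR (- y) * t) * expR (- ((1 - expR (- y)) * t))) @[y --> 0^'+] --> 0.
  have c0 : (1 - expR (- y)) * J @[y --> 0^'+] --> 0.
    have H : (1 - expR (- y)) * J @[y --> (0:R)^'+] --> (1 - 1) * J.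
      by apply: cvgMr_tmp; apply: cvgB => //; exact: cvg_cst.
    by rewrite subrr mul0r in H.
  apply/norm_cvg0P; apply: (squeeze_cvgr _ (cvg_cst 0) c0).
  near=> y; have y0 : 0 < y by near: y; exact: nbhs_right_gt.
  have q01 : 0 < expR (- y) < 1 by rewrite expR_gt0 expR_lt1 oppr_lt0.
  have [i2 _] := abel_integral_parts q01 (Hi _ q01).
  rewrite normr_ge0/= normrM ger0_norm ?subr_ge0; last by case/andP: q01 => _ /ltW.
  apply: ler_wpM2l; first by rewrite subr_ge0; case/andP: q01 => _ /ltW.
  apply: norm_Rintegral_le => //.
  move=> t /=; rewrite in_itv/= => /andP[t0 tx]; rewrite normrM -[leRHS]mulr1; apply: ler_pM => //.
    apply: HK; rewrite mulr_gt0 ?expR_gt0//=; apply: lt_trans tx.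
    by rewrite gtr_pMl//; case/andP: q01.
  rewrite ger0_norm ?expR_ge0// expR_le1 oppr_le0 mulr_ge0 ?(ltW t0)// subr_ge0.
  by case/andP: q01 => _ /ltW.
rewrite -[X in _ --> X]addr0; apply: cvg_trans (cvgD c1 c2); apply: near_eq_cvg.
near=> y; have y0 : 0 < y by near: y; exact: nbhs_right_gt.
have q01 : 0 < expR (- y) < 1 by rewrite expR_gt0 expR_lt1 oppr_lt0.
by have [_ ->] := abel_integral_parts q01 (Hi _ q01).
Unshelve. all: by end_near. Qed.

End AbelIntegralBelow.

(** * Equality of the two Abel limits on a bounded interval *)

Section LowerCase.
Context {R : realType} {N : nat}.
Local Notation M := 'M[R[i]]_N.
Local Notation mu := (@lebesgue_measure R).
Implicit Types (A B X Y : M) (psi : M -> R) (t y q x : R).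

Lemma comm_mx_inv X A : comm_mx X A -> comm_mx X (invmx A).
Proof.
(* For a singular matrix [invmx] returns the matrix itself, so commutation persists. *)
move=> XA; have [Au|Au] := boolP (A \in unitmx); last by rewrite invmx_out.
rewrite /comm_mx -[LHS]mul1mx -(mulVmx Au) -[LHS]mulmxA; congr (_ *m _).
by rewrite mulmxA -XA -mulmxA mulmxV// mulmx1.
Qed.

Lemma comm_lower_gamma X A x : posmx A -> 0 < x -> comm_mx X A ->
  comm_mx X (lower_gamma_mx A x).
Proof.
move=> pA x0 XA; rewrite lower_gammaE//; apply: comm_Rintegral; first exact: mitv.
  apply: mxIS (mxI_gterm pA ltr01) => [||t/=]; try exact: mitv.
  by rewrite !in_itv/= andbT => /andP[].
by move=> t _; exact: comm_gterm.
Qed.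

Variables (P Q : M) (D : nat -> M).
Hypotheses (pP : posmx P) (pQ : posmx Q) (cPQ : comm_mx P Q).

Lemma gint_integrable y psi : 0 < y -> geo P D y -> Rlin psi ->
  mu.-integrable `]0, y[ (EFin \o (fun t => expR (- t) * Gs P Q D psi t)).
Proof.
move=> y0 gy h.
have g1 : geo P D (1 * y) by rewrite mul1r.
have [i1 _ _] := lower_gamma_series pP pQ cPQ ltr01 y0 g1 h.
by apply: eq_integrable_itv i1 => t _; rewrite !mul1r.
Qed.

Lemma gint_cont y t psi : geo P D y -> Rlin psi -> 0 < t < y ->
  {for t, continuous (fun t => expR (- t) * Gs P Q D psi t)}.
Proof.
move=> gy h ty; apply: contM; last exact: (Gs_cont pQ cPQ h gy ty).
have -> : (fun t : R => expR (- t)) = (fun t => expR (- (1 * t))).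
  by apply/funext => s; rewrite mul1r.
exact: continuous_expRNM.
Qed.

(* Abel summation: inserting [q^(M_l)], [q < 1], in the l-th term makes termwise
   integration legitimate, and both sides converge as [q] tends to [1]. *)
Lemma lower_gamma_sum x psi I : 0 < x -> (forall y, 0 < y < x -> geo P D y) ->
  Rlin psi ->
  cvgn (series (fun l => D l *m lower_gamma_mx (P *+ l + Q) x)) ->
  prim (fun t => expR (- t) * Gs P Q D psi t) d @[d --> x^'-] --> I ->
  psi (limn (series (fun l => D l *m lower_gamma_mx (P *+ l + Q) x))) = I.
Proof.
move=> x0 gx h ca gI.
pose g t := expR (- t) * Gs P Q D psi t.
have gi y : 0 < y < x -> mu.-integrable `]0, y[ (EFin \o g).
  by move=> yx; apply: gint_integrable => //; [case/andP: yx|exact: gx].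
have gc t : 0 < t < x -> {for t, continuous g}.
  move=> tx; have yx : 0 < (t + x) / 2 < x by lra.
  by apply: gint_cont (gx _ yx) h _; lra.
(* The dilation acts on the powers only; splitting [e^(-t)] as [e^(-q t) e^(-(1-q) t)] completes
   [g (q t)] and leaves the damping factor. *)
have gE q t : q * expR (- t) * Gs P Q D psi (q * t) = q * g (q * t) * expR (- ((1 - q) * t)).
  rewrite /g; move: (Gs P Q D psi (q * t)) => G.
  have -> : expR (- t) = expR (- (q * t)) * expR (- ((1 - q) * t)).
    by rewrite -expRD; congr expR; ring.
  by ring.
have gq q : 0 < q < 1 -> geo P D (q * x).
  by move=> /andP[q0 q1]; apply: gx; rewrite mulr_gt0//= gtr_pMl.
have Hi q : 0 < q < 1 -> mu.-integrable `]0, x[ (EFin \o (fun t => q * g (q * t) * expR (- ((1 - q) * t)))).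
  move=> q01; have [q0 _] := andP q01.
  have [i1 _ _] := lower_gamma_series pP pQ cPQ q0 x0 (gq q q01) h.
  by apply: eq_integrable_itv i1 => t _; exact: gE.
have c1 := abel_integral_below x0 gi gc gI Hi.
have c2 := abel_limit pP pQ cPQ h ca.
apply: (cvg_unique (@Rhausdorff R) c2); apply: cvg_trans c1; apply: near_eq_cvg.
near=> y; have y0 : 0 < y by near: y; exact: nbhs_right_gt.
have q01 : 0 < expR (- y) < 1 by rewrite expR_gt0 expR_lt1 oppr_lt0.
have [q0 _] := andP q01.
have [_ i2 _] := lower_gamma_series pP pQ cPQ q0 x0 (gq _ q01) h.
have i3 : \int[mu]_(t in `]0, x[) (expR (- y) * g (expR (- y) * t) * expR (- ((1 - expR (- y)) * t))) =
    \int[mu]_(t in `]0, x[) (expR (- y) * expR (- t) * Gs P Q D psi (expR (- y) * t)).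
  by apply: eq_Rint => t _; rewrite gE.
apply: (etrans i3); apply: (etrans i2).
congr (limn (series _)); apply/funext => l.
have cq : comm_mx (real_powmx (expR (- y)) (P *+ l + Q)) (lower_gamma_mx (P *+ l + Q) x).
  apply: (comm_lower_gamma (posM pP pQ cPQ l) x0).
  by apply/comm_mx_sym/comm_real_powmx; exact: comm_mx_refl.
by rewrite -[LHS]/(psi _) -mulmxA cq mulmxA.
Unshelve. all: by end_near. Qed.

End LowerCase.

(** * The coefficients of the theorem and the lower identity *)

Section Coefficients.
Context {R : realType} {N r s : nat}.
Local Notation M := 'M[R[i]]_N.
Local Notation mu := (@lebesgue_measure R).
Variables (P Q : M) (A : 'I_r -> M) (B : 'I_s -> M) (z : R[i]).
Implicit Types (X Y : M) (psi : M -> R) (t y q x : R).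

(** The [D_l] of the overview: an instance of the sequence [D] that the analytic lemmas leave
    arbitrary. *)
Definition coef l : M := z ^+ l *: (hyp_coef A B l *m invmx (Gamma_mx (P *+ l + Q))).

Hypothesis hcomm : forall X Y, X \in [:: P, Q & codom A ++ codom B] ->
  Y \in [:: P, Q & codom A ++ codom B] -> comm_mx X Y.
Hypotheses (pP : posmx P) (pQ : posmx Q).

Lemma comm_prod X n (F : 'I_n -> M) : (forall i, comm_mx X (F i)) ->
  comm_mx X (\prod_(i < n) F i).
Proof.
by move=> XF; apply: (big_ind (comm_mx X)) => // [|U V]; [exact: comm_mx1|exact: comm_mxM].
Qed.

Lemma comm_pochhammer X Y l : comm_mx X Y -> comm_mx X (pochhammer_mx Y l).
Proof.
move=> XY; apply: comm_prod => k; apply: comm_mxD => //; exact: comm_mx_scalar.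
Qed.

Lemma comm_hyp_coef X l : (forall i, comm_mx X (A i)) -> (forall j, comm_mx X (B j)) ->
  comm_mx X (hyp_coef A B l).
Proof.
move=> XA XB; rewrite /comm_mx /hyp_coef -scalemxAl -scalemxAr; congr (_ *: _).
apply: comm_mxM; last apply: comm_mx_inv; apply: comm_prod => i; exact: comm_pochhammer.
Qed.

Let cPQ : comm_mx P Q. Proof. by apply: hcomm; rewrite !inE eqxx ?orbT. Qed.

Lemma comm_coef X l : comm_mx X P -> comm_mx X Q -> (forall i, comm_mx X (A i)) ->
  (forall j, comm_mx X (B j)) -> comm_mx (coef l) X.
Proof.
move=> XP XQ XA XB; apply: comm_mx_sym.
rewrite /comm_mx /coef -scalemxAl -scalemxAr; congr (_ *: _).
apply: comm_mxM; first exact: comm_hyp_coef.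
apply: comm_mx_inv; apply: comm_Gamma_mx; first exact: posmxMnD.
by apply: comm_mxD => //; exact: comm_mxMn.
Qed.

Lemma coefP l : comm_mx (coef l) P.
Proof.
apply: comm_coef; [exact: comm_mx_refl|exact: cPQ| |].
  by move=> i; apply: hcomm; rewrite !inE ?eqxx// mem_cat codom_f ?orbT.
by move=> i; apply: hcomm; rewrite !inE ?eqxx// mem_cat codom_f ?orbT.
Qed.

Lemma coefQ l : comm_mx (coef l) Q.
Proof.
apply: comm_coef; [exact: comm_mx_sym|exact: comm_mx_refl| |].
- by move=> i; apply: hcomm; rewrite !inE ?eqxx ?orbT// mem_cat codom_f ?orbT.
- by move=> i; apply: hcomm; rewrite !inE ?eqxx ?orbT// mem_cat codom_f ?orbT.
Qed.

Lemma rRs_termE t : rRs_term A B P Q z t = (fun l => coef l *m real_powmx t (P *+ l)).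
Proof. by apply/funext => l; rewrite /rRs_term /coef scalemxAl. Qed.

Lemma term_coef l X : comm_mx X (Gamma_mx (P *+ l + Q)) ->
  z ^+ l *: (hyp_coef A B l *m X *m invmx (Gamma_mx (P *+ l + Q))) = coef l *m X.
Proof.
by move=> /comm_mx_inv H; rewrite /coef -scalemxAl; congr (_ *: _); rewrite -!mulmxA H.
Qed.

Lemma res_termE x : 0 < x ->
  res_term A B x P Q z = (fun l => coef l *m lower_gamma_mx (P *+ l + Q) x).
Proof.
move=> x0; apply/funext => l; apply: term_coef.
have pM := posmxMnD l cPQ pP pQ.
apply: comm_Gamma_mx => //; apply: comm_mx_sym.
by apply: comm_lower_gamma => //; exact: comm_mx_refl.
Qed.

Lemma rEs_termE x : 0 < x ->
  rEs_term A B x P Q z = (fun l => coef l *m upper_gamma_mx (P *+ l + Q) x).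
Proof.
move=> x0; apply/funext => l; apply: term_coef.
have pM := posmxMnD l cPQ pP pQ.
have -> : upper_gamma_mx (P *+ l + Q) x = Gamma_mx (P *+ l + Q) - lower_gamma_mx (P *+ l + Q) x.
  by rewrite -(lower_upper_gamma pM x0) addrAC subrr add0r.
apply: comm_mx_sym; apply: comm_mxB; first exact: comm_mx_refl.
by apply: comm_lower_gamma => //; apply: comm_mx_sym; apply: comm_Gamma_mx.
Qed.

Lemma Rlin_integrand psi t : Rlin psi -> cvgn (series (rRs_term A B P Q z t)) ->
  psi (rRs_integrand A B P Q z t) = expR (- t) * Gs P Q coef psi t.
Proof.
move=> h ct; rewrite /rRs_integrand RlinZ//; congr (_ * _).
have [_ <-] := Rlin_lim_series (Rlin_mull (real_powmx t (Q - 1%:M)) h) ct.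
congr (limn (series _)); apply/funext => l; rewrite rRs_termE; apply: (congr1 psi).
apply: esym; apply: etrans (congr1 _ (powME cPQ t l)) _; rewrite mulmxA.
have cQ1 X : comm_mx X Q -> comm_mx X (real_powmx t (Q - 1%:M)).
  by move=> XQ; apply: comm_real_powmx; apply: comm_mxB => //; exact: comm_mx1.
apply: cQ1; apply: comm_mx_sym; apply: comm_mxM.
  exact/comm_mx_sym/coefQ.
by apply: comm_real_powmx; apply: comm_mxMn; exact: comm_mx_sym.
Qed.

Lemma lower_case x : 0 < x ->
  cvgn (series (res_term A B x P Q z)) ->
  (forall t : R, 0 < t -> t < x -> cvgn (series (rRs_term A B P Q z t))) ->
  improper_cvg 0^'+ x^'- (rRs_integrand A B P Q z) ->
  res A B x P Q z = improper_integral 0^'+ x^'- (rRs_integrand A B P Q z).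
Proof.
move=> x0 ca ct [nearI cI]; set f := rRs_integrand A B P Q z in nearI cI *.
apply: RlinP => psi h; rewrite /res (res_termE x0).
have gx y : 0 < y < x -> geo P coef y.
  (* Geometric decay up to [y] needs convergence at a strictly larger argument; the midpoint is
     still below [x]. *)
  move=> yx; have yx' : 0 < y < (y + x) / 2 by lra.
  by apply: (cvg_geo pP yx'); rewrite -rRs_termE; apply: ct; lra.
rewrite (res_termE x0) in ca.
apply: (lower_gamma_sum pP pQ cPQ x0 gx h ca).
pose g t := expR (- t) * Gs P Q coef psi t.
have gi y : 0 < y < x -> mu.-integrable `]0, y[ (EFin \o g).
  by move=> yx; apply: (gint_integrable pP pQ cPQ _ (gx y yx) h); case/andP: yx.
have gc t : 0 < t < x -> {for t, continuous g}.
  move=> tx; have yx : 0 < (t + x) / 2 < x by lra.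
  by apply: (gint_cont pQ cPQ (gx _ yx) h); lra.
have xd : (x - d) @[d --> x^'-] --> (0:R)^'+.
  have H : (x - d) @[d --> x^'-] --> (0 : R).
    have H : (x - d) @[d --> x^'-] --> x - x.
      by apply: cvgB; [exact: cvg_cst|apply: cvg_at_left_filter; exact: cvg_id].
    by rewrite subrr in H.
  move=> U [e/= e0 HU]; have /cvgrPdist_lt/(_ _ e0) := H; apply: filter_app; near=> c => Hc.
  by apply: HU => //=; rewrite subr_gt0; near: c; exact: nbhs_left_lt.
(* Along this path the hypothesis on the improper integral becomes a limit in [d] alone; the missing
   piece over []0, x - d]] tends to 0. *)
have c1 : (x - d, d) @[d --> x^'-] --> filter_prod (0:R)^'+ x^'-.
  move=> U [[V W]/= [HV HW] VW]; have HV' := xd _ HV.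
  change (\forall d \near x^'-, U (x - d, d)); near=> d; apply: (VW (x - d, d)).
  by split=> /=; near: d.
have c2 : psi (mx_Rintegral `[x - d, d] f) @[d --> x^'-] --> psi (improper_integral 0^'+ x^'- f).
  exact: cvg_comp c1 (Rlin_lim h cI).
have c0 := prim_cvg0_below x0 gi.
have c3 : prim g (x - d) @[d --> x^'-] --> 0 by exact: cvg_comp xd c0.
have c4 : psi (mx_Rintegral `[x - d, d] f) + prim g (x - d) @[d --> x^'-] -->
    psi (improper_integral 0^'+ x^'- f) + 0 by exact: cvgD c2 c3.
rewrite addr0 in c4.
apply: cvg_trans c4; apply: near_eq_cvg.
have nI := c1 _ nearI.
near=> d.
have d0 : x / 2 <= d by near: d; apply: nbhs_left_ge; lra.
have dx : d < x by near: d; exact: nbhs_left_lt.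
have fi : mx_integrable `[x - d, d] f by near: d; exact: nI.
rewrite /= (Rlin_Rintegral (mitv _) (mx_integrable_mxI (mitv _) fi) h).
have -> : \int[mu]_(t in `[x - d, d]) psi (f t) = \int[mu]_(t in `[x - d, d]) g t.
  apply: eq_Rint => t; rewrite in_itv/= => /andP[t1 t2].
  apply: (Rlin_integrand h); apply: ct; lra.
have dy : 0 < (d + x) / 2 < x by lra.
rewrite (@primB _ g ((d + x) / 2) (gi _ dy)) ?subrK//; try lra.
by move=> t ty; apply: gc; lra.
Unshelve. all: by end_near. Qed.

End Coefficients.

(** * Continuation of a Laplace transform *)

Section AscendingBinomial.
Context {R : realType}.
Implicit Types (y h s : R) (c k l m n : nat).

(** Induction on [c]: Pascal's rule gives [T_(n+1) = S + y T_n], with [S] the sum for [c], and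
    [T_n <= T_(n+1)] then yields [(1 - y) T_(n+1) <= S]. *)
Lemma binomial_series_le c y n : 0 <= y < 1 ->
  \sum_(0 <= m < n) 'C(c + m, m)%:R * y ^+ m <= (1 - y) ^- c.+1.
Proof.
move=> /andP[y0 y1]; have q0 : 0 < 1 - y by rewrite subr_gt0.
elim: c n => [|c IH] n.
  have := @geometric_le R 1 y n ler01; rewrite y0 y1 => /(_ isT); rewrite div1r expr1.
  by apply: le_trans; rewrite /series/=; apply: ler_sum => m _; rewrite add0n binn.
pose T n := \sum_(0 <= m < n) 'C(c.+1 + m, m)%:R * y ^+ m : R.
have T0 k : 0 <= T k by apply: sumr_ge0 => m _; rewrite mulr_ge0 ?exprn_ge0.
have Tmono k : T k <= T k.+1 by rewrite /T big_nat_recr//= lerDl mulr_ge0 ?exprn_ge0.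
have Trec k : T k.+1 = \sum_(0 <= m < k.+1) 'C(c + m, m)%:R * y ^+ m + y * T k.
  rewrite /T !big_nat_recl// !bin0 -addrA; congr (_ + _).
  rewrite mulr_sumr -big_split/=; apply: eq_bigr => m _.
  by rewrite (addSn c m.+1) binS natrD (addSnnS c m) exprS; ring.
have key : T n.+1 * (1 - y) <= (1 - y) ^- c.+1.
  rewrite mulrBr mulr1 lerBlDr [leLHS]Trec; apply: lerD; first exact: IH.
  by rewrite mulrC; apply: ler_wpM2r.
apply: (@le_trans _ _ (T n.+1)); first exact: Tmono.
by rewrite exprS invfM mulrC ler_pdivlMr.
Qed.

Lemma bin_le_exp2 n k : ('C(n, k) <= 2 ^ n)%N.
Proof.
elim: n k => [|n IH] [|k]; rewrite ?bin0 ?bin0n ?expn_gt0//.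
by rewrite binS expnS mul2n -addnn leq_add.
Qed.

(** Separates the derivative order [n] from the Taylor index [k]; the price is the factor 2 in front
    of the step [h] in [rising_series_le]. *)
Lemma fact_add_le n k : ((n + k)`! <= 2 ^ (n + k) * (k`! * n`!))%N.
Proof.
rewrite -(bin_fact (leq_addl n k)) addnK leq_mul2r; apply/orP; right.
exact: bin_le_exp2.
Qed.

(** The rising factorial from [c + 1], that is [(c + m)! / c!]. It bounds the factor gained in
    passing from [Gamma(A)] to [Gamma(A + m)] when [nrm A <= c + 1]. *)
Definition rising c m : R := \prod_(i < m) (c.+1 + i)%:R.

Lemma risingE c m : rising c m = m`!%:R * 'C(c + m, m)%:R.
Proof.
rewrite -natrM mulnC; elim: m => [|m IH]; first by rewrite /rising big_ord0 bin0.
rewrite /rising big_ord_recr/= -/(rising c m) IH -natrM; congr (_%:R).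
have := mul_bin_diag (c + m.+1) m; rewrite addnS addSn factS /= => H.
by rewrite mulnA [('C(_, m.+1) * _)%N]mulnC -H mulnC mulnA.
Qed.

Lemma rising_series_le c n N h s : 0 < h -> 2 * h < s ->
  \sum_(0 <= k < N) (h ^+ k / k`!%:R * (rising c (n + k) / s ^+ (n + k))) <=
  n`!%:R / h ^+ n * (1 - 2 * h / s) ^- c.+1.
Proof.
move=> h0 hs; have s0 : 0 < s by apply: lt_trans hs; rewrite mulr_gt0.
pose y := 2 * h / s; have y01 : 0 <= y < 1.
  by rewrite divr_ge0 ?mulr_ge0 ?(ltW h0) ?(ltW s0)//= ltr_pdivrMr// mul1r.
have y0 : 0 <= y by case/andP: y01.
apply: (@le_trans _ _ (\sum_(0 <= k < N) (n`!%:R / h ^+ n * ('C(c + (n + k), n + k)%:R * y ^+ (n + k))))).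
  apply: ler_sum => k _; rewrite risingE /y !expr_div_n exprMn.
  have H : (n + k)`!%:R <= 2 ^+ (n + k) * (k`!%:R * n`!%:R) :> R.
    by rewrite -natrX -!natrM ler_nat fact_add_le.
  have f0 : 0 < k`!%:R :> R by rewrite ltr0n fact_gt0.
  have sm0 : 0 < s ^+ (n + k) by rewrite exprn_gt0.
  have -> : h ^+ k / k`!%:R * ((n + k)`!%:R * 'C(c + (n + k), n + k)%:R / s ^+ (n + k)) =
    (n + k)`!%:R * (h ^+ k / k`!%:R * 'C(c + (n + k), n + k)%:R / s ^+ (n + k)) by field; rewrite !gt_eqF.
  have -> : n`!%:R / h ^+ n * ('C(c + (n + k), n + k)%:R * (2 ^+ (n + k) * h ^+ (n + k) / s ^+ (n + k))) =
    2 ^+ (n + k) * (k`!%:R * n`!%:R) * (h ^+ k / k`!%:R * 'C(c + (n + k), n + k)%:R / s ^+ (n + k)).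
    by rewrite [h ^+ (n + k)]exprD; field; rewrite !gt_eqF// exprn_gt0.
  apply: ler_wpM2r => //.
  by rewrite !mulr_ge0 ?invr_ge0 ?exprn_ge0 ?(ltW h0) ?(ltW s0)// ltW.
rewrite -mulr_sumr; apply: ler_wpM2l; first by rewrite divr_ge0 ?exprn_ge0 ?(ltW h0).
apply: le_trans (binomial_series_le c (n + N) y01).
rewrite (@big_cat_nat _ _ _ n 0 (n + N))//= ?leq_addr//.
have -> : \sum_(n <= i < n + N) 'C(c + i, i)%:R * y ^+ i =
    \sum_(0 <= i < N) 'C(c + (n + i), n + i)%:R * y ^+ (n + i).
  by rewrite -[X in index_iota X _]add0n big_addn addKn; apply: eq_bigr => i _; rewrite [(i + n)%N]addnC.
by rewrite lerDr; apply: sumr_ge0 => i _; rewrite mulr_ge0 ?exprn_ge0.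
Qed.

End AscendingBinomial.

(** * Derivatives and Taylor series of scaled Gamma matrices *)

Section ScaledGamma.
Context {R : realType} {N : nat}.
Local Notation M := 'M[R[i]]_N.
Local Notation mu := (@lebesgue_measure R).
Local Notation RT := (measurableTypeR R).
Implicit Types (A X Y : M) (psi : M -> R) (h s t u : R).

Lemma pw_nat (n : nat) t : 0 < t -> pw n%:R t = t ^+ n.
Proof. by move=> t0; rewrite /pw expRM_natl lnK. Qed.

Lemma real_powmx_shift_nat t (n : nat) A : 0 < t ->
  real_powmx t (A + n%:R%:M - 1%:M) = (t ^+ n)%:C *: real_powmx t (A - 1%:M).
Proof.
move=> t0; rewrite -pw_nat// -real_powmx_shift; congr (real_powmx t _).
by rewrite addrAC (rmorph_nat (real_complex R)).
Qed.

Lemma posmx_nat A (n : nat) : posmx A -> posmx (A + n%:R%:M).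
Proof.
by move=> pA; have := posmx_shift (c := n%:R) (ler0n _ n) pA; rewrite (rmorph_nat (real_complex R)).
Qed.

Lemma comm_Gam X A s : posmx A -> 0 < s -> comm_mx X A -> comm_mx X (Gam A s).
Proof.
move=> pA s0 XA; apply: comm_Rintegral; [exact: mitv|exact: mxI_gterm|].
by move=> t _; exact: comm_gterm.
Qed.

Lemma Gam_recs A s : posmx A -> 0 < s -> Gam (A + 1%:M) s = (s^-1)%:C *: (A *m Gam A s).
Proof.
move=> pA s0; have pA1 : posmx (A + 1%:M) by have := posmx_nat 1 pA.
rewrite (Gam_scale pA1 s0) (Gam_scale pA s0) Gamma_rec//.
have -> : real_powmx s^-1 (A + 1%:M) = (s^-1)%:C *: real_powmx s^-1 A.
  rewrite -[X in X%:C](@pw1 R) ?invr_gt0// -real_powmx_shift.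
  by congr (real_powmx _ (_ + _)); rewrite rmorph1.
rewrite -scalemxAl; congr (_ *: _); rewrite !mulmxA; congr (_ *m _).
by apply: esym; apply: comm_real_powmx; exact: comm_mx_refl.
Qed.

Lemma nrm_Gam_shift X A s (c m : nat) : posmx A -> 0 < s -> comm_mx X A -> nrm A <= c.+1%:R ->
  nrm (X *m Gam (A + m%:R%:M) s) <= nrm (X *m Gam A s) * (rising c m / s ^+ m).
Proof.
move=> pA s0 XA Ac; elim: m => [|m IH].
  by rewrite /rising big_ord0 expr0 divr1 mulr1 raddf0 addr0.
have -> : A + m.+1%:R%:M = (A + m%:R%:M) + 1%:M by rewrite -natr1 raddfD/= addrA.
have pm := posmx_nat m pA.
rewrite Gam_recs// -scalemxAr nrmZ cmod_real gtr0_norm ?invr_gt0//.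
have cG : (A + m%:R%:M) *m Gam (A + m%:R%:M) s = Gam (A + m%:R%:M) s *m (A + m%:R%:M).
  by apply: (comm_Gam pm s0); exact: comm_mx_refl.
move: (Gam (A + m%:R%:M) s) IH cG => G IH ->.
(* The factor [A + m] is applied to [Y] before norms are taken: estimating the scalar matrix by
   itself would cost a factor [N] at every step. *)
rewrite mulmxA mulmxDr mul_mx_scalar; move: (X *m G) IH => Y IH.
have H : nrm (Y *m A + m%:R *: Y) <= nrm Y * (c.+1 + m)%:R.
  apply: le_trans (nrmD _ _) _; rewrite nrmZ cmod_natr natrD mulrDr [m%:R * _]mulrC.
  by apply: lerD => //; apply: le_trans (nrmM _ _) _; apply: ler_wpM2l => //; exact: nrm_ge0.
have -> : rising c m.+1 / s ^+ m.+1 = rising c m / s ^+ m * ((c.+1 + m)%:R * s^-1).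
  by rewrite /rising big_ord_recr/= exprS invfM; ring.
rewrite mulrC mulrA [leRHS]mulrA; apply: ler_wpM2r; first by rewrite invr_ge0 ltW.
by apply: le_trans H _; apply: ler_wpM2r.
Qed.

(** Expand [e^(h t)] in [e^(-(s-h) t) = e^(-s t) e^(h t)] and integrate termwise. Up to sign the
    k-th derivative in [s] is [Gam (A + k) s], and the sign cancels against that of the step
    [- h]. *)
Lemma Gam_taylor A X psi h s : posmx A -> Rlin psi -> 0 < h < s ->
  series (fun k => h ^+ k / k`!%:R * psi (X *m Gam (A + k%:R%:M) s)) n @[n --> \oo] -->
  psi (X *m Gam A (s - h)).
Proof.
move=> pA hpsi /andP[h0 hs]; have s0 := lt_trans h0 hs.
have sh0 : 0 < s - h by rewrite subr_gt0.
have hX := Rlin_mull X hpsi.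
have [k k0 hk] := Rlin_bound hX.
have [b [c [C [b0 c0 C0 HC]]]] := posmx_bound pA.
pose w t := k * C * (pw (b - 1) t * expR (- ((s - h) * t)) + pw (c - 1) t * expR (- ((s - h) * t))).
have wi : mu.-integrable `]0, +oo[ (EFin \o w).
  by apply: integrableZR; [exact: mitv|apply: integrableDR; [exact: mitv|exact: integrable_gamma|exact: integrable_gamma]].
pose v j t := h ^+ j / j`!%:R * psi (X *m gterm (A + j%:R%:M) s t).
have vE j t : 0 < t -> v j t = (h * t) ^+ j / j`!%:R * (expR (- (s * t)) * psi (X *m real_powmx t (A - 1%:M))).
  move=> t0; rewrite /v /gterm real_powmx_shift_nat// !(RlinZ _ _ hX) exprMn; ring.
have vi j : mu.-integrable `]0, +oo[ (EFin \o v j).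
  by apply: integrableZR; [exact: mitv|exact: (mxI_gterm (posmx_nat j pA) s0) _ hX].
have vabs j t : 0 < t -> `|v j t| <= (h * t) ^+ j / j`!%:R * (expR (- (h * t)) * w t).
  move=> t0; rewrite vE// normrM ger0_norm; last first.
    by rewrite divr_ge0// exprn_ge0// mulr_ge0// ltW.
  apply: ler_wpM2l; first by rewrite divr_ge0// exprn_ge0// mulr_ge0// ltW.
  rewrite normrM ger0_norm ?expR_ge0//.
  have -> : expR (- (s * t)) = expR (- (h * t)) * expR (- ((s - h) * t)).
    by rewrite -expRD; congr expR; ring.
  rewrite -mulrA; apply: ler_wpM2l; first exact: expR_ge0.
  rewrite mulrC; have -> : w t = k * (C * (pw (b - 1) t + pw (c - 1) t)) * expR (- ((s - h) * t)).
    by rewrite /w; ring.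
  apply: ler_wpM2r; first exact: expR_ge0.
  by apply: le_trans (hk _) _; apply: ler_wpM2l => //; exact: HC.
have e_le (x : R) n : 0 <= x -> \sum_(0 <= j < n) (x ^+ j / j`!%:R) <= expR x.
  move=> x0; apply: (@series_le_lim _ (exp_coeff x)) => [j|]; last exact: is_cvg_series_exp_coeff.
  by rewrite divr_ge0// exprn_ge0.
have w0 t : 0 < t -> 0 <= w t.
  move=> t0; apply: mulr_ge0; first exact: mulr_ge0.
  by apply: addr_ge0; (apply: mulr_ge0; [exact: pw_ge0|exact: expR_ge0]).
have wc t : 0 < t -> {for t, continuous w}.
  by move=> t0; apply: contZ; apply: contD;
    (apply: contM; [exact: continuous_pw|exact: continuous_expRNM]).
(* The Poisson weights [(h t)^j e^(-h t) / j!] sum to 1, so these majorants have total mass at most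
   the integral of [w]. *)
pose wj j t := (h * t) ^+ j / j`!%:R * (expR (- (h * t)) * w t).
have wj0 j t : 0 < t -> 0 <= wj j t.
  move=> t0; apply: mulr_ge0; last by apply: mulr_ge0; [exact: expR_ge0|exact: w0].
  by apply: divr_ge0 => //; apply: exprn_ge0; apply: mulr_ge0; exact: ltW.
have wjs n t : 0 < t -> \sum_(0 <= j < n) wj j t <= w t.
  move=> t0; rewrite -mulr_suml mulrA -[leRHS]mul1r; apply: ler_wpM2r; first exact: w0.
  rewrite expRN ler_pdivrMr ?expR_gt0// mul1r; apply: e_le.
  by rewrite mulr_ge0// ltW.
have wji j : mu.-integrable `]0, +oo[ (EFin \o wj j).
  apply: le_integrableR wi _; first exact: mitv.
    apply: measurable_open_continuous; first exact: interval_open.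
    move=> t /=; rewrite in_itv/= andbT => t0; apply: contM.
      apply: (@continuous_comp R R R (fun t => h * t) (fun x => x ^+ j / j`!%:R)).
        by apply: contZ; exact: cvg_id.
      by apply: cvgMr_tmp; exact: exprn_continuous.
    by apply: contM; [exact: continuous_expRNM|exact: wc].
  move=> t /=; rewrite in_itv/= andbT => t0; rewrite ger0_norm ?wj0//.
  apply: le_trans (wjs j.+1 t t0); rewrite big_nat_recr//= lerDr.
  by apply: sumr_ge0 => i _; exact: wj0.
pose B j := \int[mu]_(t in `]0, +oo[) wj j t.
have B0 j : 0 <= B j.
  by apply: Rintegral_ge0 => t /=; rewrite in_itv/= andbT; exact: wj0.
have Bc : cvgn (series B).
  apply: (@bounded_sum_cvg_series _ B (\int[mu]_(t in `]0, +oo[) w t)) => // n.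
  rewrite /series/= -Rintegral_sum//.
  apply: le_Rintegral => //; first exact: integrable_sumR.
  by move=> t /=; rewrite in_itv/= andbT; exact: wjs.
have vB j : \int[mu]_(t in `]0, +oo[) `|v j t| <= B j.
  apply: le_Rintegral => //; first exact: integrable_norm (vi j).
  by move=> t /=; rewrite in_itv/= andbT; exact: vabs.
have vs t : `]0, +oo[%classic t -> cvgn (series (fun j => `|v j t|)).
  rewrite /= in_itv/= andbT => t0.
  have wc' : cvgn (series (wj ^~ t)).
    by apply: (@bounded_sum_cvg_series _ _ (w t)) => [j|n]; [exact: wj0|exact: wjs].
  by apply: (dominated_cvg_series _ wc') => j; rewrite normr_id; exact: vabs.
have [i1 i2] := Rintegral_series (mitv _) vi vs vB Bc.
have vint j : \int[mu]_(t in `]0, +oo[) v j t = h ^+ j / j`!%:R * psi (X *m Gam (A + j%:R%:M) s).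
  have pj := posmx_nat j pA.
  rewrite (RintegralZl _ _ ((mxI_gterm pj s0) _ hX))//; congr (_ * _).
  by rewrite -(Rlin_Gam pj s0 hX).
have cS : cvgn (series (fun j => \int[mu]_(t in `]0, +oo[) v j t)).
  apply: (dominated_cvg_series _ Bc) => j; apply: le_trans (vB j).
  by apply: le_normr_Rintegral => //; exact: mitv.
have -> : (fun j => h ^+ j / j`!%:R * psi (X *m Gam (A + j%:R%:M) s)) =
    (fun j => \int[mu]_(t in `]0, +oo[) v j t).
  by apply/funext => j; rewrite vint.
suff -> : psi (X *m Gam A (s - h)) = limn (series (fun j => \int[mu]_(t in `]0, +oo[) v j t)) by exact: cS.
rewrite -i2 (Rlin_Gam pA sh0 hX); apply: eq_Rint => t; rewrite in_itv/= andbT => t0.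
pose p := expR (- (s * t)) * psi (X *m real_powmx t (A - 1%:M)).
have -> : v ^~ t = p *: exp_coeff (h * t).
  by apply/funext => j; rewrite vE// mulrC.
rewrite lim_seriesZ; last exact: is_cvg_series_exp_coeff.
rewrite -[limn _]/(expR (h * t)) /gterm (RlinZ _ _ hX) /p.
have -> : expR (- ((s - h) * t)) = expR (- (s * t)) * expR (h * t).
  by rewrite -expRD; congr expR; ring.
by rewrite mulrAC.
Qed.

End ScaledGamma.

Section Continuation.
Context {R : realType} {N : nat}.
Local Notation M := 'M[R[i]]_N.
Local Notation mu := (@lebesgue_measure R).
Implicit Types (A X Y : M) (psi : M -> R) (h s t u y : R).

Lemma bernoulli_le (x : R) n : 0 <= x <= 1 -> 1 - n%:R * x <= (1 - x) ^+ n.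
Proof.
move=> /andP[x0 x1]; elim: n => [|n IH]; first by rewrite mul0r subr0 expr0.
have p0 : 0 <= 1 - x by rewrite subr_ge0.
apply: (@le_trans _ _ ((1 - x) * (1 - n%:R * x))).
  rewrite -natr1; have : 0 <= n%:R * x * x by rewrite !mulr_ge0.
  by lra.
by rewrite exprS; apply: ler_wpM2l.
Qed.

Variables (P Q : M) (D : nat -> M).
Hypotheses (pP : posmx P) (pQ : posmx Q) (cPQ : comm_mx P Q).
Hypotheses (DP : forall l, comm_mx (D l) P) (DQ : forall l, comm_mx (D l) Q).

Let pM l : posmx (P *+ l + Q). Proof. exact: posmxMnD. Qed.
Let DM l : comm_mx (D l) (P *+ l + Q).
Proof. by apply: comm_mxD => //; exact: comm_mxMn. Qed.

Lemma nrm_powM : exists a C : R, [/\ 0 < a, 0 <= C & forall q l, 0 < q <= 1 ->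
  nrm (real_powmx q (P *+ l + Q)) <= C * pw a q ^+ l].
Proof.
have [a [C [a0 C0 HC]]] := pP; have [b [B [b0 B0 HB]]] := pQ.
exists a, (C * B); split=> //; first exact: mulr_ge0.
move=> q l /andP[q0 q1].
have cl : comm_mx (P *+ l) Q by apply: comm_mx_sym; apply: comm_mxMn; exact: comm_mx_sym.
rewrite (real_powmxD _ cl); apply: le_trans (nrmM _ _) _.
have -> : C * B * pw a q ^+ l = (C * pw a q ^+ l) * B by ring.
apply: ler_pM; [exact: nrm_ge0|exact: nrm_ge0| |].
  rewrite real_powmxMn//; apply: le_trans (HC _ _) _; last by rewrite pwX.
  by rewrite exprn_gt0//= exprn_ile1// ltW.
apply: le_trans (HB q _) _; first by rewrite q0.
by rewrite -[leRHS]mulr1; apply: ler_wpM2l => //; apply: pw_le1; [exact: ltW|rewrite q0].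
Qed.

(** Natural constants and the successor are chosen to fit [rising]; linearity in [l] makes the
    Taylor loss only exponential in [l]. *)
Lemma nrm_Mx : exists al be : nat, forall l, nrm (P *+ l + Q) <= (al * l + be).+1%:R.
Proof.
exists (Num.bound (nrm P)), (Num.bound (nrm Q)) => l.
have hP : nrm P <= (Num.bound (nrm P))%:R by apply/ltW/archi_boundP/nrm_ge0.
have hQ : nrm Q <= (Num.bound (nrm Q))%:R by apply/ltW/archi_boundP/nrm_ge0.
apply: le_trans (nrmD _ _) _; rewrite -natr1 natrD natrM.
rewrite -scaler_nat nrmZ cmod_natr mulrC.
have : nrm P * l%:R <= (Num.bound (nrm P))%:R * l%:R by exact: ler_wpM2r.
by lra.
Qed.

Variable Ka : R.
Hypothesis HKa : forall l, nrm (D l *m Gam (P *+ l + Q) 1) <= Ka.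

Definition Tsum psi n s : R :=
  limn (series (fun l => psi (D l *m Gam (P *+ l + Q + n%:R%:M) s))).

Lemma Ka0 : 0 <= Ka. Proof. exact: le_trans (nrm_ge0 _) (HKa 0%N). Qed.

(* Continuation step: [Tsum psi n] is formally, up to sign, the n-th derivative
   of [s |-> sum_l psi (D_l Gamma(M_l) s^(- M_l))]; the ratio [y] depends only on
   [s1], so finitely many steps reach [s1] from any larger [s]. *)
Lemma Tsum_taylor (s1 : R) : 1 < s1 -> exists2 y, 0 < y < 1 & forall psi n s, Rlin psi -> s1 <= s ->
  \sum_(0 <= k < m) ((y * s) ^+ k / k`!%:R * Tsum psi (n + k) s) @[m --> \oo] -->
  Tsum psi n (s - y * s).
Proof.
move=> s11; have [a [C [a0 C0 HC]]] := nrm_powM; have [al [be Hnrm]] := nrm_Mx.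
have s10 : 0 < s1 by exact: lt_trans s11.
pose rho := pw a s1^-1.
have rho1 : rho < 1 by apply: pw_lt1 => //; rewrite invr_gt0 s10 invf_lt1.
have rho0 : 0 < rho by exact: pw_gt0.
(* Small enough that Bernoulli's inequality gives [(1 - 2 y)^al > rho]: the loss per unit of [l]
   stays below the decay [rho] of [s^(-M_l)]. *)
pose y := (1 - rho) / (4 * (al%:R + 1)).
have al1 : 0 < (al%:R + 1 : R) by rewrite ltr_wpDl.
have y0 : 0 < y by rewrite divr_gt0 ?subr_gt0// mulr_gt0.
have y4 : 4 * y * (al%:R + 1) = 1 - rho by rewrite /y; field; rewrite gt_eqF.
have ya : 0 <= y * al%:R by rewrite mulr_ge0// ltW.
have y14 : 4 * y < 1 by lra.
have y1 : y < 1 by lra.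
exists y; first by rewrite y0.
move=> psi n s h ss1; have s0 : 0 < s := lt_le_trans s10 ss1.
have [k k0 hk] := Rlin_bound h.
have ys0 : 0 < y * s by rewrite mulr_gt0.
have yss : 2 * (y * s) < s by nra.
pose q := 1 - 2 * (y * s) / s.
have qE : q = 1 - 2 * y by rewrite /q; field; rewrite gt_eqF.
have q0 : 0 < q by rewrite qE; lra.
have q1 : rho < q ^+ al.
  have y2 : 0 <= 2 * y <= 1 by lra.
  have := bernoulli_le al y2; rewrite -qE; lra.
pose v k l := (y * s) ^+ k / k`!%:R * psi (D l *m Gam (P *+ l + Q + (n + k)%:R%:M) s).
have sV : 0 < s^-1 <= 1 by rewrite invr_gt0 s0 invf_le1// (le_trans (ltW s11)).
have pws : pw a s^-1 <= rho.
  by apply: pw_le; [exact: ltW|case/andP: sV|rewrite lef_pV2].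
have g1 l : nrm (D l *m Gam (P *+ l + Q) s) <= Ka * (C * rho ^+ l).
  have pl := pM l; rewrite (Gam_scale pl s0).
  have cl : comm_mx (real_powmx s^-1 (P *+ l + Q)) (Gam (P *+ l + Q) 1).
    by apply: (comm_Gam pl ltr01); apply: comm_mx_sym; apply: comm_real_powmx; exact: comm_mx_refl.
  rewrite cl mulmxA; apply: le_trans (nrmM _ _) _.
  apply: ler_pM; [exact: nrm_ge0|exact: nrm_ge0|exact: HKa|].
  apply: le_trans (HC _ _ sV) _; apply: ler_wpM2l => //.
  by apply: lerXn2r; rewrite ?nnegrE ?pw_ge0// ltW.
pose c l := (al * l + be)%N.
pose Z := k * (Ka * C) * (n`!%:R / (y * s) ^+ n) * q ^- be.+1.
have nh0 : 0 <= n`!%:R / (y * s) ^+ n by rewrite divr_ge0// exprn_ge0// ltW.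
(* [rising_series_le] sums the whole Taylor series of the l-th term at the cost
   [q^(-(al l + be + 1))]. A bound that is geometric in [l] and uniform in [m] permits exchanging
   the two limits. *)
have vsum l m : \sum_(0 <= j < m) `|v j l| <= Z * (rho / q ^+ al) ^+ l.
  apply: (@le_trans _ _ (\sum_(0 <= j < m) k * (Ka * (C * rho ^+ l)) *
      ((y * s) ^+ j / j`!%:R * (rising (c l) (n + j) / s ^+ (n + j))))).
    apply: ler_sum => j _; have f0 : 0 <= (y * s) ^+ j / j`!%:R.
      by rewrite divr_ge0// exprn_ge0// ltW.
    rewrite normrM ger0_norm// mulrCA; apply: ler_wpM2l => //.
    apply: le_trans (hk _) _; rewrite -[leRHS]mulrA; apply: (ler_wpM2l k0).
    apply: le_trans (nrm_Gam_shift (n + j) (pM l) s0 (DM l) (Hnrm l)) _.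
    apply: ler_wpM2r; last exact: g1.
    by rewrite divr_ge0 ?exprn_ge0 ?(ltW s0)// prodr_ge0.
  rewrite -mulr_sumr.
  have H := rising_series_le (c l) n m ys0 yss.
  have kk0 : 0 <= k * (Ka * (C * rho ^+ l)).
    by apply: mulr_ge0 => //; apply: mulr_ge0; [exact: Ka0|apply: mulr_ge0 => //; apply: exprn_ge0; exact: ltW].
  apply: le_trans (ler_wpM2l kk0 H) _; rewrite -/q.
  have -> : q ^- (c l).+1 = (q ^+ al ^- l) * q ^- be.+1.
    by rewrite -invfM -exprM -exprD /c addnS.
  rewrite /Z expr_div_n le_eqVlt; apply/orP; left; apply/eqP; ring.
have Z0 : 0 <= Z.
  apply: mulr_ge0; last by rewrite invr_ge0 exprn_ge0// ltW.
  by apply: mulr_ge0 => //; apply: mulr_ge0 => //; apply: mulr_ge0 => //; exact: Ka0.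
have r01 : 0 <= rho / q ^+ al < 1.
  by rewrite divr_ge0 ?exprn_ge0 ?(ltW rho0) ?(ltW q0)//= ltr_pdivrMr ?exprn_gt0// mul1r.
pose B l := Z * (rho / q ^+ al) ^+ l.
have Bc : cvgn (series B) by exact: cvg_geometric_dom.
have vB j l : `|v j l| <= B l.
  apply: le_trans (vsum l j.+1); rewrite big_nat_recr//= lerDr; exact: sumr_ge0.
have vc j : cvgn (series (v j)) by apply: (dominated_cvg_series _ Bc) => l; exact: vB.
have TE j : (y * s) ^+ j / j`!%:R * Tsum psi (n + j) s = limn (series (v j)).
  have f0 : (y * s) ^+ j / j`!%:R != 0.
    by rewrite gt_eqF// divr_gt0 ?exprn_gt0// ltr0n fact_gt0.
  have vE : v j = ((y * s) ^+ j / j`!%:R) *: (fun l => psi (D l *m Gam (P *+ l + Q + (n + j)%:R%:M) s)).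
    by [].
  rewrite vE lim_seriesZ//.
  have -> : (fun l => psi (D l *m Gam (P *+ l + Q + (n + j)%:R%:M) s)) =
      ((y * s) ^+ j / j`!%:R)^-1 *: v j.
    by apply/funext => l; rewrite vE /GRing.scale/= /GRing.scale/= mulrA mulVf// mul1r.
  by apply: is_cvg_seriesZ; exact: vc.
have fin m : \sum_(0 <= j < m) ((y * s) ^+ j / j`!%:R * Tsum psi (n + j) s) =
    limn (series (fun l => \sum_(0 <= j < m) v j l)).
  apply/esym/cvg_lim => //.
  have -> : series (fun l => \sum_(0 <= j < m) v j l) = (fun L => \sum_(0 <= j < m) series (v j) L).
    by apply/funext => L; rewrite /series/= exchange_big.
  under eq_bigr do rewrite TE.
  by apply: cvg_bigsum => j; exact: vc.
have -> : (fun m => \sum_(0 <= j < m) ((y * s) ^+ j / j`!%:R * Tsum psi (n + j) s)) =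
    (fun m => limn (series (fun l => \sum_(0 <= j < m) v j l))).
  by apply/funext => m; exact: fin.
apply: (@tannery R nat \oo _ (fun m l => \sum_(0 <= j < m) v j l) _ B) => //.
  near=> m => l; apply: le_trans (ler_norm_sum _ _ _) _; exact: vsum.
move=> l; have ys : 0 < y * s < s by rewrite ys0 gtr_pMl.
have := @Gam_taylor R N _ (D l) psi (y * s) s (posmx_nat n (pM l)) h ys.
have -> : (fun j => (y * s) ^+ j / j`!%:R * psi (D l *m Gam (P *+ l + Q + n%:R%:M + j%:R%:M) s)) = v ^~ l.
  by apply/funext => j; rewrite /v natrD raddfD/= addrA.
exact.
Unshelve. all: by end_near. Qed.

End Continuation.

(** * Laplace transform of a bounded function *)

Section Laplace.
Context {R : realType}.
Local Notation mu := (@lebesgue_measure R).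
Local Notation RT := (measurableTypeR R).
Implicit Types (h s t : R) (k m n : nat).
Variables (A : R -> R) (K : R).
Hypothesis Ac : forall t, 0 < t -> {for t, continuous A}.
Hypothesis AK : forall t, 0 < t -> `|A t| <= K.

Lemma Kge0 : 0 <= K. Proof. exact: le_trans (normr_ge0 _) (AK ltr01). Qed.

Definition lapk m s t : R := A t * (t ^+ m * expR (- (s * t))).
Definition lap m s : R := \int[mu]_(t in `]0, +oo[) lapk m s t.

Lemma integrable_powexp m s : 0 < s ->
  mu.-integrable `]0, +oo[ (EFin \o (fun t : R => t ^+ m * expR (- (s * t)))).
Proof.
move=> s0; have m1 : 0 < m%:R + 1 :> R by rewrite ltr_wpDl.
apply: eq_integrable_itv (integrable_gamma m1 s0) => t; rewrite in_itv/= andbT => t0.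
by rewrite addrK pw_nat.
Qed.

Lemma continuous_powexp m s t : {for t, continuous (fun t : R => t ^+ m * expR (- (s * t)))}.
Proof. by apply: contM; [exact: exprn_continuous|exact: continuous_expRNM]. Qed.

Lemma continuous_lapk m s t : 0 < t -> {for t, continuous (lapk m s)}.
Proof. by move=> t0; apply: contM; [exact: Ac|exact: continuous_powexp]. Qed.

Lemma lapk_le m s t : 0 < t -> `|lapk m s t| <= K * (t ^+ m * expR (- (s * t))).
Proof.
move=> t0; have p0 : 0 <= t ^+ m * expR (- (s * t)).
  by apply: mulr_ge0; [apply: exprn_ge0; exact: ltW|exact: expR_ge0].
by rewrite normrM [`|_ ^+ _ * _|]ger0_norm//; apply: ler_wpM2r => //; exact: AK.
Qed.

Lemma integrable_lapk m s : 0 < s -> mu.-integrable `]0, +oo[ (EFin \o lapk m s).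
Proof.
move=> s0; apply: le_integrableR (integrableZR K (mitv _) (integrable_powexp m s0)) _; first exact: mitv.
  apply: measurable_open_continuous; first exact: interval_open.
  by move=> t /=; rewrite in_itv/= andbT; exact: continuous_lapk.
by move=> t /=; rewrite in_itv/= andbT; exact: lapk_le.
Qed.

Lemma lap_taylor m h s : 0 < h < s ->
  \sum_(0 <= k < n) (h ^+ k / k`!%:R * lap (m + k) s) @[n --> \oo] --> lap m (s - h).
Proof.
move=> /andP[h0 hs]; have s0 := lt_trans h0 hs; have sh0 : 0 < s - h by rewrite subr_gt0.
pose v k t := h ^+ k / k`!%:R * lapk (m + k) s t.
pose w t := K * (t ^+ m * expR (- ((s - h) * t))).
have wi : mu.-integrable `]0, +oo[ (EFin \o w).
  by apply: integrableZR; [exact: mitv|exact: integrable_powexp].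
have w0 t : 0 < t -> 0 <= w t.
  move=> t0; apply: mulr_ge0; first exact: Kge0.
  by apply: mulr_ge0; [apply: exprn_ge0; exact: ltW|exact: expR_ge0].
pose wj k t := h ^+ k / k`!%:R * (K * (t ^+ (m + k) * expR (- (s * t)))).
have wjE k t : wj k t = (h * t) ^+ k / k`!%:R * (expR (- (h * t)) * w t).
  rewrite /wj /w; have -> : expR (- (s * t)) = expR (- (h * t)) * expR (- ((s - h) * t)).
    by rewrite -expRD; congr expR; ring.
  by rewrite exprD exprMn; ring.
have c0 k : 0 <= h ^+ k / k`!%:R by rewrite divr_ge0// exprn_ge0// ltW.
have wj0 k t : 0 < t -> 0 <= wj k t.
  move=> t0; apply: mulr_ge0 => //; apply: mulr_ge0; first exact: Kge0.
  by apply: mulr_ge0; [apply: exprn_ge0; exact: ltW|exact: expR_ge0].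
have wjs n t : 0 < t -> \sum_(0 <= j < n) wj j t <= w t.
  move=> t0; under eq_bigr do rewrite wjE.
  rewrite -mulr_suml mulrA -[leRHS]mul1r; apply: ler_wpM2r; first exact: w0.
  rewrite expRN ler_pdivrMr ?expR_gt0// mul1r.
  apply: (@series_le_lim _ (exp_coeff (h * t))) => [j|]; last exact: is_cvg_series_exp_coeff.
  by rewrite divr_ge0// exprn_ge0// mulr_ge0// ltW.
have wji j : mu.-integrable `]0, +oo[ (EFin \o wj j).
  by apply: integrableZR; [exact: mitv|apply: integrableZR; [exact: mitv|exact: integrable_powexp]].
pose B j := \int[mu]_(t in `]0, +oo[) wj j t.
have B0 j : 0 <= B j.
  by apply: Rintegral_ge0 => t /=; rewrite in_itv/= andbT; exact: wj0.
have Bc : cvgn (series B).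
  apply: (@bounded_sum_cvg_series _ B (\int[mu]_(t in `]0, +oo[) w t)) => // n.
  rewrite /series/= -Rintegral_sum//.
  apply: le_Rintegral => //; first exact: integrable_sumR.
  by move=> t /=; rewrite in_itv/= andbT; exact: wjs.
have vi j : mu.-integrable `]0, +oo[ (EFin \o v j).
  by apply: integrableZR; [exact: mitv|exact: integrable_lapk].
have vabs j t : 0 < t -> `|v j t| <= wj j t.
  by move=> t0; rewrite normrM ger0_norm//; apply: ler_wpM2l => //; exact: lapk_le.
have vB j : \int[mu]_(t in `]0, +oo[) `|v j t| <= B j.
  apply: le_Rintegral => //; first exact: integrable_norm (vi j).
  by move=> t /=; rewrite in_itv/= andbT; exact: vabs.
have vs t : `]0, +oo[%classic t -> cvgn (series (fun j => `|v j t|)).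
  rewrite /= in_itv/= andbT => t0.
  have wc' : cvgn (series (wj ^~ t)).
    by apply: (@bounded_sum_cvg_series _ _ (w t)) => [j|n]; [exact: wj0|exact: wjs].
  by apply: (dominated_cvg_series _ wc') => j; rewrite normr_id; exact: vabs.
have [i1 i2] := Rintegral_series (mitv _) vi vs vB Bc.
have vint j : \int[mu]_(t in `]0, +oo[) v j t = h ^+ j / j`!%:R * lap (m + j) s.
  by rewrite (RintegralZl _ _ (integrable_lapk (m + j) s0)).
have cS : cvgn (series (fun j => \int[mu]_(t in `]0, +oo[) v j t)).
  apply: (dominated_cvg_series _ Bc) => j; apply: le_trans (vB j).
  by apply: le_normr_Rintegral => //; exact: mitv.
have -> : (fun n => \sum_(0 <= k < n) (h ^+ k / k`!%:R * lap (m + k) s)) =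
    series (fun j => \int[mu]_(t in `]0, +oo[) v j t).
  by apply/funext => n; rewrite /series/=; apply: eq_bigr => j _; rewrite vint.
suff -> : lap m (s - h) = limn (series (fun j => \int[mu]_(t in `]0, +oo[) v j t)) by exact: cS.
rewrite -i2; apply: eq_Rint => t; rewrite in_itv/= andbT => t0.
have -> : v ^~ t = lapk m s t *: exp_coeff (h * t).
  apply/funext => j; rewrite /v /lapk /exp_coeff/= [RHS]/GRing.scale/= /GRing.scale/= exprD exprMn.
  by ring.
rewrite lim_seriesZ; last exact: is_cvg_series_exp_coeff.
rewrite -[limn _]/(expR (h * t)) /lapk /GRing.scale/= -!mulrA -expRD.
by congr (_ * (_ * expR _)); ring.
Qed.

(* The integral of [A'(t) t^n e^(- s t)], integrated by parts so that it makes
   sense when only [A] is bounded. *)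
Definition lapd n s : R := s * lap n s - n%:R * lap n.-1 s.

Lemma lapd_taylor n h s : 0 < h < s ->
  \sum_(0 <= k < m) (h ^+ k / k`!%:R * lapd (n + k) s) @[m --> \oo] --> lapd n (s - h).
Proof.
move=> hs; have /andP[h0 _] := hs.
(* When [n] or [k] is 0 its predecessor is also 0, but the coefficient in front removes that
   term. *)
have e1 k : (n + k)%:R * lap (n + k).-1 s = n%:R * lap (n.-1 + k) s + k%:R * lap (n + k.-1) s.
  rewrite natrD mulrDl; congr (_ + _); first by case: (n) => [|n']; rewrite ?mul0r.
  by case: k => [|k]; rewrite ?mul0r// addnS.
have t1 := @lap_taylor n h s hs; have t2 := @lap_taylor n.-1 h s hs.
pose u k := h ^+ k / k`!%:R : R.
(* Since [k / k! = 1 / (k-1)!], this sum is [h] times a shifted one; subtracted from the sum with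
   factor [s], it produces the new factor [s - h]. *)
have e2 m : \sum_(0 <= k < m.+1) (u k * (k%:R * lap (n + k.-1) s)) =
    h * \sum_(0 <= k < m) (u k * lap (n + k) s).
  rewrite big_nat_recl//= mul0r mulr0 add0r mulr_sumr; apply: eq_bigr => k _.
  rewrite /u exprS factS natrM; field.
  by rewrite pnatr_eq0 -lt0n fact_gt0/= gt_eqF// ltr_pwDl.
have e3 m : \sum_(0 <= k < m.+1) (u k * lapd (n + k) s) =
    s * (\sum_(0 <= k < m.+1) (u k * lap (n + k) s)) -
    (n%:R * (\sum_(0 <= k < m.+1) (u k * lap (n.-1 + k) s)) +
     h * \sum_(0 <= k < m) (u k * lap (n + k) s)).
  rewrite -e2 !mulr_sumr -big_split/= -sumrB; apply: eq_bigr => k _.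
  by rewrite /lapd e1; ring.
have sh (v : nat -> R) l : v m @[m --> \oo] --> l -> v m.+1 @[m --> \oo] --> l.
  by rewrite -cvg_shiftS.
rewrite -cvg_shiftS; have -> : [sequence \sum_(0 <= k < m.+1) (h ^+ k / k`!%:R * lapd (n + k) s)]_m =
    (fun m => s * (\sum_(0 <= k < m.+1) (u k * lap (n + k) s)) -
    (n%:R * (\sum_(0 <= k < m.+1) (u k * lap (n.-1 + k) s)) +
     h * \sum_(0 <= k < m) (u k * lap (n + k) s))).
  by apply/funext => m; exact: e3.
have -> : lapd n (s - h) = s * lap n (s - h) - (n%:R * lap n.-1 (s - h) + h * lap n (s - h)).
  by rewrite /lapd; ring.
apply: cvgB; first by apply: cvgMl_tmp; exact: sh t1.
by apply: cvgD; apply: cvgMl_tmp; [exact: sh t2|exact: t1].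
Qed.

Lemma powexp_cvgy n s : 0 < s -> t ^+ n * expR (- (s * t)) @[t --> +oo] --> 0.
Proof.
move=> s0; pose d := s / 2; have d0 : 0 < d by rewrite divr_gt0.
have c0 : n`!%:R * d ^- n * expR (- (d * t)) @[t --> +oo] --> 0.
  rewrite -[X in _ --> X](mulr0 (n`!%:R * d ^- n)); apply: cvgMl_tmp.
  have := @cvgr_expR R; apply: (cvg_comp (fun t => d * t)).
  by apply: gt0_cvgMry => //; exact: cvg_id.
apply: (squeeze_cvgr _ (cvg_cst 0) c0).
near=> t; have t0 : 0 <= t by near: t; exact: nbhs_pinfty_ge.
rewrite mulr_ge0 ?exprn_ge0 ?expR_ge0//=.
have -> : expR (- (s * t)) = expR (- (d * t)) * expR (- (d * t)).
  by rewrite -expRD; congr expR; rewrite /d; field.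
rewrite mulrA; apply: ler_wpM2r; first exact: expR_ge0.
rewrite expRN ler_pdivrMr ?expR_gt0//.
have := expR_bound n d0 t0; rewrite ler_pdivrMr ?ltr0n ?fact_gt0//.
by rewrite mulrAC [n`!%:R * _]mulrC mulrAC.
Unshelve. all: by end_near. Qed.

Lemma lap_parts (g : R -> R) n s : 0 < s -> (forall t, 0 < t -> is_derive t 1 A (g t)) ->
  (forall t, 0 < t -> {for t, continuous g}) -> A t @[t --> 0^'+] --> 0 ->
  mu.-integrable `]0, +oo[ (EFin \o (fun t => g t * (t ^+ n * expR (- (s * t))))) ->
  \int[mu]_(t in `]0, +oo[) (g t * (t ^+ n * expR (- (s * t)))) = lapd n s.
Proof.
move=> s0 dA gc A0 gi.
have i1 := integrableZR s (mitv _) (integrable_lapk n s0).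
have i2 := integrableZR n%:R (mitv _) (integrable_lapk n.-1 s0).
have i3 := integrableBR (mitv _) i1 i2.
pose p t := t ^+ n * expR (- (s * t)).
pose q t := s * lapk n s t - n%:R * lapk n.-1 s t.
pose f t := g t * p t - q t.
have dF t : 0 < t -> is_derive t 1 (fun t => A t * p t) (f t).
  move=> t0; have d1 := dA t t0; have d2 := is_derive_expRNM s t.
  have d3 : is_derive t 1 ((@id R) ^+ n) (n%:R * t ^+ n.-1).
    by apply: is_derive_eq; rewrite /GRing.scale/= mulr1.
  have -> : (fun t => A t * p t) = A * ((@id R) ^+ n * (fun t => expR (- (s * t)))).
    by apply/funext => x; rewrite /p !fctE.
  apply: is_derive_eq; rewrite /f /q /lapk /p /GRing.scale/= !fctE; ring.
have cf t : 0 < t -> {for t, continuous f}.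
  move=> t0; apply: contB; first by apply: contM; [exact: gc|exact: continuous_powexp].
  by apply: contB; apply: contZ; exact: continuous_lapk.
have fi : mu.-integrable `]0, +oo[ (EFin \o f) by exact: integrableBR (mitv _) gi i3.
have c0 : A t * p t @[t --> 0^'+] --> 0.
  have c1 : p t @[t --> (0:R)^'+] --> p 0 by apply: cvg_at_right_filter; exact: continuous_powexp.
  by have := cvgM A0 c1; rewrite mul0r; apply.
have cy : A t * p t @[t --> +oo] --> 0.
  have c1 : K * p t @[t --> +oo] --> 0.
    by rewrite -[X in _ --> X](mulr0 K); apply: cvgMl_tmp; exact: powexp_cvgy.
  apply/norm_cvg0P; apply: (squeeze_cvgr _ (cvg_cst 0) c1).
  near=> t; rewrite normr_ge0/=; apply: lapk_le; near: t; exact: nbhs_pinfty_gt.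
have := FTC_pos dF cf fi c0 cy.
rewrite subrr (RintegralB _ gi i3)// (RintegralB _ i1 i2)//.
rewrite (RintegralZl _ _ (integrable_lapk n s0))// (RintegralZl _ _ (integrable_lapk n.-1 s0))//.
by move/eqP; rewrite subr_eq0 => /eqP.
Unshelve. all: by end_near. Qed.

Lemma Rintegral_expN : \int[mu]_(t in `]0, +oo[) expR (- (1 * t)) = 1 :> R.
Proof.
have dF (t : R) : 0 < t -> is_derive t 1 (fun t => - expR (- (1 * t))) (expR (- (1 * t))).
  move=> _; have d2 := is_derive_expRNM 1 t.
  have -> : (fun t : R => - expR (- (1 * t))) = - (fun t => expR (- (1 * t))) by [].
  by apply: is_derive_eq; ring.
have fi : mu.-integrable `]0, +oo[ (EFin \o (fun t : R => expR (- (1 * t)))).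
  by apply: eq_integrable_itv (integrable_powexp 0 ltr01) => t _; rewrite expr0 mul1r.
have c0 : - expR (- (1 * t)) @[t --> (0:R)^'+] --> (- 1 : R).
  have c1 : - expR (- (1 * t)) @[t --> (0:R)^'+] --> (- expR (- (1 * 0)) : R).
    by apply: cvgN; apply: cvg_at_right_filter; exact: continuous_expRNM.
  by rewrite mulr0 oppr0 expR0 in c1.
have cy : - expR (- (1 * t)) @[t --> +oo] --> (0 : R).
  have c1 := powexp_cvgy 0 ltr01.
  have c2 : - (t ^+ 0 * expR (- (1 * t))) @[t --> +oo] --> - (0 : R) by exact: cvgN.
  by rewrite oppr0 in c2; apply: cvg_trans c2; apply: near_eq_cvg; apply: nearW => t; rewrite expr0 mul1r.
by rewrite (FTC_pos dF (fun t _ => @continuous_expRNM R 1 t) fi c0 cy) sub0r opprK.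
Qed.

(** After dilation the mean is the integral of [A(t / s) e^(-t)] with integrand tending to
    [I e^(-t)]. The values [s = 1/(n+1)] make it a sequence, ready for dominated convergence. *)
Lemma lap_abel (I : R) : A t @[t --> +oo] --> I ->
  n.+1%:R^-1 * lap 0 n.+1%:R^-1 @[n --> \oo] --> I.
Proof.
move=> AI.
pose f n t := A (n.+1%:R * t) * expR (- (1 * t)).
have nS n : 0 < n.+1%:R :> R by rewrite ltr0n.
have fE n : n.+1%:R^-1 * lap 0 n.+1%:R^-1 = \int[mu]_(t in `]0, +oo[) f n t.
  have nV : 0 < (n.+1%:R^-1 : R) by rewrite invr_gt0.
  have fs t : f n (n.+1%:R^-1 * t) = lapk 0 n.+1%:R^-1 t.
    have e : n.+1%:R * (n.+1%:R^-1 * t) = t by rewrite mulrA mulfV ?gt_eqF// mul1r.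
    by rewrite /f e /lapk expr0 !mul1r.
  have fc t : 0 < t -> {for t, continuous (f n)}.
    move=> t0; apply: contM; last exact: continuous_expRNM.
    apply: (@continuous_comp R R R (fun t => n.+1%:R * t) A t); first by apply: contZ; exact: cvg_id.
    by apply: Ac; rewrite mulr_gt0.
  have ei : mu.-integrable `]0, +oo[ (EFin \o (fun t : R => K * (t ^+ 0 * expR (- (1 * t))))).
    by apply: integrableZR; [exact: mitv|exact: integrable_powexp].
  have fi : mu.-integrable `]0, +oo[ (EFin \o f n).
    apply: le_integrableR ei _; first exact: mitv.
      apply: measurable_open_continuous; first exact: interval_open.
      by move=> t /=; rewrite in_itv/= andbT; exact: fc.
    move=> t /=; rewrite in_itv/= andbT => t0; rewrite /f normrM expr0 !mul1r.
    rewrite [`|expR _|]ger0_norm ?expR_ge0//; apply: ler_wpM2r; first exact: expR_ge0.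
    by apply: AK; rewrite mulr_gt0.
  have fsi : mu.-integrable `]0, +oo[ (EFin \o (fun t => f n (n.+1%:R^-1 * t))).
    by apply: eq_integrable_itv (integrable_lapk 0 nV) => t _; rewrite fs.
  have e1 := Rintegral_scale nV fc fi fsi.
  have e2 : lap 0 n.+1%:R^-1 = \int[mu]_(t in `]0, +oo[) f n (n.+1%:R^-1 * t).
    by apply: eq_Rint => t _; rewrite fs.
  by rewrite e2 e1 mulrA invrK mulVf ?mul1r// gt_eqF.
have -> : (fun n => n.+1%:R^-1 * lap 0 n.+1%:R^-1) = (fun n => \int[mu]_(t in `]0, +oo[) f n t).
  by apply/funext => n; exact: fE.
have ei : mu.-integrable `]0, +oo[ (EFin \o (fun t : R => K * (t ^+ 0 * expR (- (1 * t))))).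
  by apply: integrableZR; [exact: mitv|exact: integrable_powexp].
have e0 : mu.-integrable `]0, +oo[ (EFin \o (fun t : R => expR (- (1 * t)))).
  by apply: eq_integrable_itv (integrable_powexp 0 ltr01) => t _; rewrite expr0 mul1r.
have [|x|n x|_] := @Rdominated_convergence _ RT R mu `]0, +oo[ f (fun t => I * expR (- (1 * t)))
   (fun t => K * (t ^+ 0 * expR (- (1 * t)))) (mitv _) _ _ ei _.
- move=> n; apply: measurable_open_continuous; first exact: interval_open.
  move=> t /=; rewrite in_itv/= andbT => t0.
  apply: contM; last exact: continuous_expRNM.
  apply: (@continuous_comp R R R (fun t => n.+1%:R * t) A t); first by apply: contZ; exact: cvg_id.
  by apply: Ac; rewrite mulr_gt0.
- rewrite /= in_itv/= andbT => x0; apply: cvgMr_tmp.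
  apply: cvg_comp AI.
  have := @natS_cvgy R; move=> H.
  by apply: (cvg_comp (fun n => n.+1%:R : R) (fun y => y * x) H); apply: gt0_cvgMly => //; exact: cvg_id.
- rewrite /= in_itv/= andbT => x0; rewrite /f normrM expr0 !mul1r.
  rewrite [`|expR _|]ger0_norm ?expR_ge0//; apply: ler_wpM2r; first exact: expR_ge0.
  by apply: AK; rewrite mulr_gt0.
by rewrite (RintegralZl _ _ e0)// Rintegral_expN mulr1.
Qed.

End Laplace.

(** * Lower bounds for the Gamma function *)

Section ComplexGamma.
Context {R : realType}.
Local Notation mu := (@lebesgue_measure R).
Local Notation RT := (measurableTypeR R).
Implicit Types (t u v m x y : R) (z w : R[i]).

Lemma sin_le_id x : 0 <= x -> sin x <= x.
Proof.
move=> x0; rewrite -subr_ge0.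
have d t : 0 <= t <= x -> is_derive t 1 (fun t => t - sin t) (1 - cos t).
  move=> _; have -> : (fun t => t - sin t) = (@id R) - (@sin R) by [].
  by apply: is_derive_eq.
have := @ge0_derive_le R _ _ 0 x x0 d; rewrite sin0 subrr; apply=> t _.
by rewrite subr_ge0 cos_le1.
Qed.

Lemma cos_ge x : 1 - x ^+ 2 / 2 <= cos x.
Proof.
wlog x0 : x / 0 <= x => [H|].
  have [/H//|/ltW x0] := leP 0 x.
  by rewrite -cosN -sqrrN; apply: H; rewrite oppr_ge0.
have d t : 0 <= t <= x -> is_derive t 1 (fun t => cos t + t ^+ 2 / 2) (t - sin t).
  move=> _; have -> : (fun t => cos t + t ^+ 2 / 2) = (@cos R) + (2^-1 \*: ((@id R) ^+ 2)).
    by apply/funext => s; rewrite !fctE /GRing.scale/= mulrC.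
  by apply: is_derive_eq; rewrite /GRing.scale/=; clear; field.
have := @ge0_derive_le R _ _ 0 x x0 d; rewrite cos0 expr0n/= mul0r addr0 => H.
by rewrite lerBlDr; apply: H => t /andP[t0 _]; rewrite subr_ge0; exact: sin_le_id.
Qed.

(** This is [|w| <= 4 |sinh (w/2)|]. At [w = ln (t/m)] it replaces a squared logarithm by
    [4 (t - m)^2 / (t m)], whose Gamma integral is explicit. *)
Lemma sqr_le_expR (w : R) : w ^+ 2 * expR w <= 4 * (expR w - 1) ^+ 2.
Proof.
set E := expR (w / 2).
have E0 : 0 < E by exact: expR_gt0.
have -> : expR w = E ^+ 2 by rewrite /E -expRM_natl; congr expR; field.
have h1 : 1 + w / 2 <= E by exact: expR_ge1Dx.
have h2 : (1 - w / 2) * E <= 1.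
  have : 1 - w / 2 <= expR (- (w / 2)) by have := expR_ge1Dx (- (w / 2)).
  by rewrite expRN -/E -[X in _ <= X -> _]mul1r ler_pdivlMr.
suff : `|w * E| <= `|2 * (E ^+ 2 - 1)|.
  by rewrite -ler_sqr ?nnegrE// !real_normK ?num_real// !exprMn -natrX.
have [w0|w0] := leP 0 w.
  have E1 : 1 <= E by apply: le_trans h1; rewrite lerDl divr_ge0.
  rewrite ger0_norm ?mulr_ge0 ?(ltW E0)// ger0_norm; last by nra.
  by nra.
have E1 : E <= 1 by rewrite /E expR_le1; lra.
rewrite ltr0_norm; last by nra.
rewrite ler0_norm; last by nra.
by nra.
Qed.

Definition cgamk z t : R[i] := (expR (- (1 * t)))%:C * cexp ((ln t)%:C * (z - 1)).
(** The complex Gamma function by Euler's integral; its integrability and recurrence are read off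
    from scalar matrices ([gterm_scalar]). *)
Definition cgam z : R[i] :=
  (\int[mu]_(t in `]0, +oo[) complex.Re (cgamk z t)) +i*
  (\int[mu]_(t in `]0, +oo[) complex.Im (cgamk z t)).

Lemma gterm_scalar N z t : gterm (z%:M : 'M[R[i]]_N) 1 t = (cgamk z t)%:M.
Proof.
have e : z%:M - 1%:M = (z - 1)%:M :> 'M[R[i]]_N by rewrite raddfB.
by rewrite /gterm /real_powmx e scale_scalar_mx mx_exp_scalar /cgamk scale_scalar_mx.
Qed.

Lemma posmx_scalar N z : 0 < complex.Re z -> posmx (z%:M : 'M[R[i]]_N).
Proof.
move=> z0; exists (complex.Re z), (nrm (1%:M : 'M[R[i]]_N)); split=> //; first exact: nrm_ge0.
move=> t _; rewrite /real_powmx scale_scalar_mx mx_exp_scalar -(scalemx1 _ (cexp _)) nrmZ cmod_cexp mulrC.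
apply: ler_wpM2l; first exact: nrm_ge0.
rewrite /pw ler_expR le_eqVlt; apply/orP; left; apply/eqP.
by case: (z) => a b /=; rewrite mul0r subr0 mulrC.
Qed.

Lemma integrable_cgamk z : 0 < complex.Re z ->
  mu.-integrable `]0, +oo[ (EFin \o (fun t => complex.Re (cgamk z t))) /\
  mu.-integrable `]0, +oo[ (EFin \o (fun t => complex.Im (cgamk z t))).
Proof.
move=> z0; have gi := mxI_gterm (posmx_scalar 1 z0) ltr01.
have e t : gterm (z%:M : 'M[R[i]]_1) 1 t 0 0 = cgamk z t by rewrite gterm_scalar mxE eqxx.
split; [have i1 := gi _ (Rlin_Re 0 0)|have i1 := gi _ (Rlin_Im 0 0)];
  by apply: eq_integrable_itv i1 => t _; rewrite e.
Qed.

Lemma Gam_scalar N z : 0 < complex.Re z -> Gam (z%:M : 'M[R[i]]_N) 1 = (cgam z)%:M.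
Proof.
move=> z0; apply: RlinP => psi h; have pz := posmx_scalar N z0.
have [i1 i2] := integrable_cgamk z0.
rewrite (Rlin_Gam pz ltr01 h) -[in RHS]scalemx1 (Rlin_scalar _ _ h)/=.
have e1 := RintegralZr (psi 1%:M) (mitv _) i1.
have e2 := RintegralZr (psi ('i *: 1%:M)) (mitv _) i2.
have j1 : mu.-integrable `]0, +oo[ (EFin \o (fun t => complex.Re (cgamk z t) * psi 1%:M)).
  by apply: eq_integrable_itv (integrableZR (psi 1%:M) (mitv _) i1) => t _; rewrite mulrC.
have j2 : mu.-integrable `]0, +oo[ (EFin \o (fun t => complex.Im (cgamk z t) * psi ('i *: 1%:M))).
  by apply: eq_integrable_itv (integrableZR (psi ('i *: 1%:M)) (mitv _) i2) => t _; rewrite mulrC.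
rewrite -e1 -e2 -(RintegralD _ j1 j2)//.
by apply: eq_Rint => t _; rewrite gterm_scalar -(scalemx1 _ (cgamk z t)) (Rlin_scalar _ _ h).
Qed.

Lemma cgam_rec z : 0 < complex.Re z -> cgam (z + 1) = z * cgam z.
Proof.
move=> z0; have z1 : 0 < complex.Re (z + 1) by case: (z) z0 => a b /= a0; rewrite ltr_wpDr.
have := Gamma_rec (posmx_scalar 1 z0).
rewrite -raddfD/= (Gam_scalar 1 z0) (Gam_scalar 1 z1) -scalar_mxM => /matrixP/(_ 0 0).
by rewrite !mxE.
Qed.

Lemma Re_cgam w z : 0 < complex.Re z ->
  complex.Re (w * cgam z) = \int[mu]_(t in `]0, +oo[) complex.Re (w * cgamk z t).
Proof.
move=> z0; have [i1 i2] := integrable_cgamk z0.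
have ReE (a b : R[i]) : complex.Re (a * b) = complex.Re a * complex.Re b - complex.Im a * complex.Im b.
  by case: a b => ? ? [].
rewrite ReE /=.
rewrite -(RintegralZl _ _ i1)// -(RintegralZl _ _ i2)//.
have j1 := integrableZR (complex.Re w) (mitv _) i1.
have j2 := integrableZR (complex.Im w) (mitv _) i2.
by rewrite -(RintegralB _ j1 j2)//; apply: eq_Rint => t _; rewrite ReE.
Qed.

(* Multiplying by [m^(- i v)] makes the phase vanish at [t = m], where
   [t^(m - 1) e^(- t)] concentrates. *)
Lemma cgam_large m v : 1 < m -> 4 * v ^+ 2 <= m - 1 ->
  Rgamma m 1 / 2 <= cmod (cgam (m +i* v)).
Proof.
move=> m1 vm; have m0 : 0 < m by exact: lt_trans m1.
pose th := - (v * ln m); pose w := (cos th +i* sin th : R[i]).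
have cw : cmod w = 1 by rewrite /w /cmod/= cos2Dsin2 sqrtr1.
have -> : cmod (cgam (m +i* v)) = cmod (w * cgam (m +i* v)) by rewrite cmodM cw mul1r.
apply: le_trans (le_trans (ler_norm _) (Re_le_cmod _)).
have z0 : 0 < complex.Re (m +i* v) by [].
rewrite (Re_cgam w z0).
have kE t : complex.Re (w * cgamk (m +i* v) t) =
    pw (m - 1) t * expR (- (1 * t)) * cos (v * (ln t - ln m)).
  rewrite /cgamk /cexp /pw /w /th/= !(mul0r, mulr0, subr0, addr0, add0r).
  have -> : v * (ln t - ln m) = - (v * ln m) + ln t * v by ring.
  by rewrite cosD [(m - 1) * ln t]mulrC; ring.
pose g u t := pw (u - 1) t * expR (- (1 * t)).
have gi u : 0 < u -> mu.-integrable `]0, +oo[ (EFin \o g u) by move=> u0; exact: integrable_gamma.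
have mp : 0 < m + 1 by rewrite ltr_wpDr.
have mm : 0 < m - 1 by rewrite subr_gt0.
(* By [cos_ge] and [sqr_le_expR] the cosine loses at most [2 v^2 (t - m)^2 / (t m) = c (t - 2 m +
   m^2 / t)], a combination of Gamma integrands of parameters [m + 1], [m] and [m - 1]. *)
pose c := 2 * v ^+ 2 / m.
have i1 := gi m m0; have i2 := integrableZR c (mitv _) (gi _ mp).
have i3 := integrableZR (2 * m * c) (mitv _) (gi _ m0).
have i4 := integrableZR (m ^+ 2 * c) (mitv _) (gi _ mm).
have i5 := integrableBR (mitv _) (integrableBR (mitv _) (integrableDR (mitv _) i1 i3) i2) i4.
have jk : mu.-integrable `]0, +oo[ (EFin \o (fun t => complex.Re (w * cgamk (m +i* v) t))).
  have [j1 j2] := integrable_cgamk z0.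
  have j3 := integrableBR (mitv _) (integrableZR (complex.Re w) (mitv _) j1)
    (integrableZR (complex.Im w) (mitv _) j2).
  by apply: eq_integrable_itv j3 => t _; case: (w) (cgamk _ t) => ? ? [].
apply: (@le_trans _ _ (\int[mu]_(t in `]0, +oo[)
  (g m t + 2 * m * c * g m t - c * g (m + 1) t - m ^+ 2 * c * g (m - 1) t))); last first.
  apply: (le_Rintegral (mitv _) i5 jk) => t tt.
  have t0 : 0 < t by move: tt; rewrite /= in_itv/= andbT.
  rewrite kE.
  have gp : 0 <= g m t by apply: mulr_ge0; [exact: pw_ge0|exact: expR_ge0].
  have g1 : g (m + 1) t = t * g m t.
    have e : pw m t = pw (m - 1) t * t by rewrite -[X in _ = _ * X](pw1 t0) -pwD subrK.
    by rewrite /g addrK e; ring.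
  have g2 : g (m - 1) t = t^-1 * g m t.
    have e : pw (m - 1 - 1) t = pw (m - 1) t * t^-1 by rewrite pwD pwN1.
    by rewrite /g e; ring.
  rewrite g1 g2 -/(g m t).
  have -> : g m t + 2 * m * c * g m t - c * (t * g m t) - m ^+ 2 * c * (t^-1 * g m t) =
    g m t * (1 - 2 * v ^+ 2 * ((t - m) ^+ 2 / (t * m))).
    by rewrite /c; field; rewrite !gt_eqF.
  apply: ler_wpM2l => //; apply: le_trans (cos_ge _); rewrite lerD2l lerN2.
  have H := sqr_le_expR (ln t - ln m).
  have eE : expR (ln t - ln m) = t / m by rewrite expRD expRN !lnK.
  rewrite eE -ler_pdivlMr ?divr_gt0// in H.
  have e1 : 4 * (t / m - 1) ^+ 2 / (t / m) = 4 * ((t - m) ^+ 2 / (t * m)).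
    by field; rewrite !gt_eqF.
  rewrite e1 in H; rewrite exprMn.
  by have := ler_wpM2l (sqr_ge0 v) H; clear; lra.
rewrite (RintegralB _ (integrableBR (mitv _) (integrableDR (mitv _) i1 i3) i2) i4)//.
rewrite (RintegralB _ (integrableDR (mitv _) i1 i3) i2)// (RintegralD _ i1 i3)//.
rewrite (RintegralZl _ _ (gi _ m0))// (RintegralZl _ _ (gi _ mp))// (RintegralZl _ _ (gi _ mm))//.
have gE u : \int[mu]_(t in `]0, +oo[) g u t = Rgamma u 1 by [].
rewrite !gE Rgamma_rec//.
have r2 : Rgamma m 1 = (m - 1) * Rgamma (m - 1) 1 by have := Rgamma_rec mm; rewrite subrK.
have r3 : Rgamma (m - 1) 1 = Rgamma m 1 / (m - 1) by rewrite r2 mulrAC mulfV ?mul1r ?gt_eqF.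
have G0 := Rgamma_gt0 m0; rewrite r3; move: (Rgamma m 1) G0 => G G0.
have -> : G + 2 * m * c * G - c * (m * G) - m ^+ 2 * c * (G / (m - 1)) =
    G * (1 - 2 * v ^+ 2 / (m - 1)).
  by rewrite /c; field; rewrite !gt_eqF.
apply: ler_wpM2l; first exact: ltW.
have h : 2 * v ^+ 2 / (m - 1) <= 2^-1 by rewrite ler_pdivrMr//; move: vm; clear; lra.
by move: h; clear; lra.
Qed.

Lemma cmod_le_expR u v : 0 < u -> cmod (u +i* v) <= u * expR (v ^+ 2 / u ^+ 2).
Proof.
move=> u0; have h : 1 + v ^+ 2 / u ^+ 2 <= expR (v ^+ 2 / u ^+ 2) by exact: expR_ge1Dx.
apply: (@le_trans _ _ (u * (1 + v ^+ 2 / u ^+ 2))); last by apply: ler_wpM2l => //; exact: ltW.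
have p0 : 0 <= u * (1 + v ^+ 2 / u ^+ 2).
  by rewrite mulr_ge0 ?(ltW u0)// addr_ge0// divr_ge0// sqr_ge0.
rewrite /cmod/= -(ger0_norm p0) -sqrtr_sqr ler_wsqrtr//.
have -> : (u * (1 + v ^+ 2 / u ^+ 2)) ^+ 2 = u ^+ 2 + v ^+ 2 + (v ^+ 2 + (v ^+ 2 / u) ^+ 2).
  by field; rewrite gt_eqF.
by rewrite lerDl addr_ge0// sqr_ge0.
Qed.

(** Each use of the recurrence multiplies the ratio of [|Gamma(U + i v)|] to [Gamma(U)] by at most
    [e^(v^2 / U^2)], and the exponents telescope. The total loss stays below [e^(v^2 / u)] whatever
    [n]. *)
Lemma cgam_shift u v n : 0 < u ->
  cmod (cgam ((u + 1 + n%:R) +i* v)) * Rgamma (u + 1) 1 <=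
  cmod (cgam ((u + 1) +i* v)) * Rgamma (u + 1 + n%:R) 1 * expR (v ^+ 2 * (u^-1 - (u + n%:R)^-1)).
Proof.
move=> u0; elim: n => [|n IH]; first by rewrite !addr0 subrr mulr0 expR0 mulr1.
have U0 : 0 < u + 1 + n%:R by rewrite !ltr_wpDr.
have un : 0 < u + n%:R by rewrite ltr_wpDr.
have e1 : ((u + 1 + n.+1%:R) +i* v : R[i]) = ((u + 1 + n%:R) +i* v) + 1.
  by rewrite -natr1 addrA; apply/eqP; rewrite eq_complex/= addr0 !eqxx.
rewrite e1 cgam_rec// cmodM -natr1 [u + 1 + (n%:R + 1)]addrA (Rgamma_rec U0).
rewrite [u + (n%:R + 1)]addrA.
have h1 := cmod_le_expR v U0.
rewrite -mulrA; apply: le_trans (ler_pM (cmod_ge0 _) _ h1 IH) _.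
  by rewrite mulr_ge0 ?cmod_ge0// ltW// Rgamma_gt0// ltr_wpDr.
set a := cmod (cgam _); set b := Rgamma _ 1; set U := u + 1 + n%:R.
rewrite [leLHS](_ : _ = a * (U * b) * (expR (v ^+ 2 / U ^+ 2) * expR (v ^+ 2 * (u^-1 - (u + n%:R)^-1)))); last by ring.
apply: ler_wpM2l.
  by rewrite !mulr_ge0 ?cmod_ge0 ?(ltW U0)// ltW// Rgamma_gt0.
rewrite -expRD ler_expR -mulrDr; apply: ler_wpM2l; first exact: sqr_ge0.
have UE : U = u + n%:R + 1 by rewrite /U addrAC.
have x0 := un; rewrite UE; move: (u + n%:R) x0 => x x0.
have : (x + 1)^-2 <= x^-1 - (x + 1)^-1.
  have x1 : 0 < x + 1 by rewrite ltr_wpDr.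
  have -> : x^-1 - (x + 1)^-1 = (x * (x + 1))^-1 by field; rewrite !gt_eqF.
  rewrite lef_pV2 ?posrE ?mulr_gt0 ?exprn_gt0// expr2; apply: ler_wpM2r; first exact: ltW.
  by rewrite lerDl.
by clear; lra.
Qed.

(** A shift by [n > 4 v^2] reaches the range of [cgam_large]. Inside the cone [v^2 <= C u^2] the
    loss [e^(v^2 / u)] is at most [e^(C u)]. *)
Lemma cgam_lower u v C : 0 < u -> v ^+ 2 <= C * u ^+ 2 ->
  Rgamma (u + 1) 1 <= 2 * expR (C * u) * cmod (cgam ((u + 1) +i* v)).
Proof.
move=> u0 vC; pose n := Num.bound (4 * v ^+ 2).
have v0 := sqr_ge0 v.
have nb : 4 * v ^+ 2 < n%:R by apply: archi_boundP; rewrite mulr_ge0.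
have h1 := cgam_shift v n u0.
have U1 : 1 < u + 1 + n%:R by rewrite addrAC ltrDr ltr_wpDr.
have h2 : Rgamma (u + 1 + n%:R) 1 / 2 <= cmod (cgam ((u + 1 + n%:R) +i* v)).
  by apply: cgam_large => //; move: nb u0; clear; lra.
have G0 : 0 < Rgamma (u + 1 + n%:R) 1 by apply: Rgamma_gt0; exact: lt_trans U1.
have g0 : 0 < Rgamma (u + 1) 1 by apply: Rgamma_gt0; rewrite ltr_wpDr.
have h3 : expR (v ^+ 2 * (u^-1 - (u + n%:R)^-1)) <= expR (C * u).
  rewrite ler_expR; apply: (@le_trans _ _ (v ^+ 2 * u^-1)).
    by apply: ler_wpM2l => //; rewrite gerBl invr_ge0 addr_ge0// ltW.
  by rewrite ler_pdivrMr// -mulrA -expr2.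
have h4 := le_trans (ler_wpM2r (ltW g0) h2) h1.
have c0 := cmod_ge0 (cgam ((u + 1) +i* v)).
have h5 : Rgamma (u + 1 + n%:R) 1 / 2 * Rgamma (u + 1) 1 <=
    cmod (cgam ((u + 1) +i* v)) * Rgamma (u + 1 + n%:R) 1 * expR (C * u).
  by apply: le_trans h4 (ler_wpM2l _ h3); apply: mulr_ge0 c0 (ltW G0).
have gen (G g c E : R) : 0 < G -> G / 2 * g <= c * G * E -> g <= 2 * E * c.
  by clear => Gp H; rewrite -(ler_pM2l Gp); move: H; clear; lra.
exact: gen G0 h5.
Qed.

End ComplexGamma.

(** * Sequences of at most exponential growth *)

Section ExponentialGrowth.
Context {R : realType}.
Implicit Types (f g : nat -> R) (C : R).

(** The exponent [l.+1] absorbs multiplicative constants, and [1 <= C] makes the class stable under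
    products and sums of bounds. *)
Definition egrow f := exists2 C, 1 <= C & forall l, f l <= C ^+ l.+1.

Lemma egrow_le f g : (forall l, f l <= g l) -> egrow g -> egrow f.
Proof. by move=> fg [C C1 H]; exists C => // l; exact: le_trans (H l). Qed.

Lemma egrow_cst (c : R) : egrow (fun=> c).
Proof.
exists (1 + `|c|) => [|l]; first by rewrite lerDl.
have h : 1 <= 1 + `|c| by rewrite lerDl.
apply: (@le_trans _ _ (1 + `|c|)); first by rewrite (le_trans (ler_norm c))// lerDr.
by rewrite exprS ler_peMr ?exprn_ege1// (le_trans ler01).
Qed.

Lemma egrowM f g : (forall l, 0 <= f l) -> (forall l, 0 <= g l) -> egrow f -> egrow g ->
  egrow (fun l => f l * g l).
Proof.
move=> f0 g0 [C C1 HC] [B B1 HB]; exists (C * B) => [|l].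
  by rewrite -[1]mulr1; apply: ler_pM.
by rewrite exprMn; apply: ler_pM.
Qed.

Lemma egrowD f g : egrow f -> egrow g -> egrow (fun l => f l + g l).
Proof.
move=> [C C1 HC] [B B1 HB].
have C0 : 0 <= C := le_trans ler01 C1; have B0 : 0 <= B := le_trans ler01 B1.
exists (C + B) => [|l]; first exact: ler_wpDr.
apply: le_trans (lerD (HC l) (HB l)) _; elim: l => [|l IH]; first by rewrite !expr1.
rewrite [leRHS]exprS; apply: le_trans (ler_wpM2l (addr_ge0 C0 B0) IH).
rewrite [C ^+ l.+2]exprS [B ^+ l.+2]exprS.
have X0 : 0 <= C ^+ l.+1 by exact: exprn_ge0.
have Y0 : 0 <= B ^+ l.+1 by exact: exprn_ge0.
move: (C ^+ _) (B ^+ _) X0 Y0 => X Y X0 Y0.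
have -> : (C + B) * (X + Y) = C * X + B * Y + (C * Y + B * X) by clear; ring.
by rewrite lerDl addr_ge0// mulr_ge0.
Qed.

Lemma egrow_nat : egrow (fun l => l%:R).
Proof.
exists 2 => [|l]; first by rewrite ler1n.
by rewrite -natrX ler_nat (leq_trans (leqnSn l))// ltnW// ltn_expl.
Qed.

Lemma egrowX f n : (forall l, 0 <= f l) -> egrow f -> egrow (fun l => f l ^+ n).
Proof.
move=> f0 ef; elim: n => [|n IH].
  by apply: egrow_le (egrow_cst 1) => l; rewrite expr0.
have h : egrow (fun l => f l * f l ^+ n) by apply: egrowM => // l; exact: exprn_ge0.
by apply: egrow_le h => l; rewrite exprS.
Qed.

Lemma egrow_expR (c : R) : egrow (fun l => expR (c * l%:R)).
Proof.
exists (expR `|c|) => [|l]; first by rewrite -expR0 ler_expR.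
rewrite -expRM_natl ler_expR -natr1 mulrDl mul1r.
apply: (@le_trans _ _ (l%:R * `|c|)); last by rewrite lerDl.
by rewrite mulrC; apply: ler_wpM2l => //; exact: ler_norm.
Qed.

(* Solves [w_j <= a + b (w_(j+1) + ... + w_(n-1))] downwards from [j = n]. *)
Lemma downward_bound (w : nat -> R) (a b : R) n : 0 <= a -> 0 <= b ->
  (forall j, (j < n)%N -> w j <= a + b * \sum_(j.+1 <= k < n) w k) ->
  forall j, (j < n)%N -> w j <= a * (1 + b) ^+ n.
Proof.
move=> a0 b0 H; have b1 : 1 <= 1 + b by rewrite lerDl.
have key i : (i <= n)%N -> a + b * \sum_(n - i <= k < n) w k <= a * (1 + b) ^+ i.
  elim: i => [|i IH] ni; first by rewrite subn0 big_geq// mulr0 addr0 expr0 mulr1.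
  have lt_ni : (n - i.+1 < n)%N by rewrite subnSK// leq_subr.
  rewrite big_ltn//.
  have := H _ lt_ni; rewrite subnSK// => H1.
  have := IH (ltnW ni) => H2.
  rewrite mulrDr addrCA exprS mulrCA mulrDl mul1r addrC; apply: lerD => //.
  by apply: ler_wpM2l => //; exact: le_trans H1 H2.
move=> j jn; apply: le_trans (H j jn) _.
have := key (n - j.+1)%N (leq_subr _ _); rewrite subKn// => H1; apply: le_trans H1 _.
by apply: ler_wpM2l => //; apply: ler_weXn2l => //; exact: leq_subr.
Qed.

End ExponentialGrowth.

(** * Coefficient bounds on a joint spectral block of P and Q *)

Section Blocks.
Context {R : realType} {N : nat}.
Local Notation M := 'M[R[i]]_N.
Local Notation mu := (@lebesgue_measure R).
Local Notation RT := (measurableTypeR R).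
Implicit Types (A X Y : M) (psi : M -> R) (h s t u y : R).

Lemma ln_pow_le t k : 0 < t -> `|ln t| ^+ k / k`!%:R <= t + t^-1.
Proof.
move=> t0; have := expR_bound k ltr01 (normr_ge0 (ln t)); rewrite expr1n invr1 !mul1r => H.
apply: le_trans H _; have [l0|l0] := leP 0 (ln t).
  by rewrite ger0_norm// lnK// lerDl invr_ge0 ltW.
by rewrite ltr0_norm// expRN lnK// lerDr ltW.
Qed.

Lemma mulmxMnl X Y n : (X *+ n) *m Y = (X *m Y) *+ n.
Proof. by rewrite !mulmxE mulrnAl. Qed.

Variables (P Q : M) (D : nat -> M).
Hypotheses (pP : posmx P) (pQ : posmx Q) (cPQ : comm_mx P Q).
Variable Ka : R.
Hypothesis HKa : forall l, nrm (D l *m Gam (P *+ l + Q) 1) <= Ka.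
Variables (p q : R[i]) (eP eQ : M).
Hypotheses (p0 : 0 < complex.Re p) (q0 : 0 < complex.Re q).
Hypotheses (ceP : forall Y, comm_mx Y P -> comm_mx Y eP).
Hypotheses (nP : (P - p%:M) ^+ N *m eP = 0) (nQ : (Q - q%:M) ^+ N *m eQ = 0).

Let e := eP *m eQ.
Let Mx l : M := P *+ l + Q.
Let z l : R[i] := p *+ l + q.
Let nu l : M := Mx l - (z l)%:M.
Let u l : R := complex.Re p * l%:R + complex.Re q.

Let u0 l : 0 < u l. Proof. by rewrite /u ltr_wpDl// mulr_ge0// ltW. Qed.

Let zE l : z l + 1 = (u l + 1) +i* (complex.Im p * l%:R + complex.Im q).
Proof.
rewrite /z /u; apply/eqP; rewrite eq_complex/=; move: p q => [a a'] [b b'] /=.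
have H (c d : R) : (c +i* d) *+ l = (c *+ l) +i* (d *+ l).
  elim: l => [|k IH]; first by rewrite !mulr0n.
  by rewrite !mulrS IH; apply/eqP; rewrite eq_complex/= !eqxx.
by rewrite H/= addr0 !mulr_natr !eqxx.
Qed.

Let pM l : posmx (Mx l). Proof. exact: posmxMnD. Qed.
Let nuMx l X : comm_mx X (Mx l) -> comm_mx X (nu l).
Proof. by move=> H; apply: comm_mxB => //; exact: comm_mx_scalar. Qed.

(** [nu l] is a sum of two commuting parts whose N-th powers vanish on [eP] and on [eQ]. In each
    binomial term of degree [N + N] one of the exponents is at least [N]. *)
Lemma block_nilpotent l : nu l ^+ (N + N) *m e = 0.
Proof.
set U := (P - p%:M) *+ l; set V := Q - q%:M.
have nE : nu l = U + V.
  by rewrite /nu /Mx /z /U /V mulrnBl raddfD/= raddfMn/= opprD addrACA.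
have cUV : GRing.comm U V.
  apply: comm_mxB; last exact: comm_mx_scalar.
  apply: comm_mx_sym; apply: comm_mxMn; apply: comm_mxB; last exact: comm_mx_scalar.
  exact: comm_mx_sym.
have cVP n : comm_mx (V ^+ n) eP.
  apply: ceP; apply: comm_mx_sym; apply: comm_mxX; apply: comm_mxB => //; exact: comm_mx_scalar.
have UN : U ^+ N *m eP = 0 by rewrite /U exprMn_n mulmxMnl nP mul0rn.
have VN : V ^+ N *m eQ = 0 by [].
rewrite nE (exprDn_comm _ cUV) mulmx_suml big1// => i _.
rewrite mulmxMnl; suff -> : (U ^+ (N + N - i) * V ^+ i) *m e = 0 by rewrite mul0rn.
rewrite /e -mulmxE; have [iN|Ni] := leqP i N.
  have /subnK <- : (N <= N + N - i)%N by rewrite leq_subRL ?leq_add2r// (leq_trans iN)// leq_addr.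
  rewrite exprD -mulmxE -!mulmxA [V ^+ i *m _]mulmxA cVP -!mulmxA.
  by rewrite [U ^+ N *m _]mulmxA UN mul0mx mulmx0.
rewrite -(subnK (ltnW Ni)) [V ^+ _]exprD -mulmxE -!mulmxA [V ^+ N *m _]mulmxA cVP.
by rewrite -!mulmxA VN !mulmx0.
Qed.

(** The unknowns of a triangular system: [block_remainder] bounds each of them through those of
    larger [j], and they vanish from [N + N] on. *)
Let Z l j := D l *m nu l ^+ j *m e.

Lemma block_power l j t : D l *m nu l ^+ j *m (real_powmx t (Mx l) *m e) =
  cexp ((ln t)%:C * z l) *: \sum_(k < N + N) (ln t ^+ k / k`!%:R)%:C *: Z l (j + k).
Proof.
rewrite /real_powmx (mx_exp_block _ (block_nilpotent l)) -scalemxAr; congr (_ *: _).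
rewrite mulmx_sumr; apply: eq_bigr => k _; rewrite -scalemxAr; congr (_ *: _).
by rewrite /Z exprD -mulmxE !mulmxA.
Qed.

Lemma Z_vanish l j : (N + N <= j)%N -> Z l j = 0.
Proof.
by move=> /subnK <-; rewrite /Z exprD -mulmxE -!mulmxA block_nilpotent !mulmx0.
Qed.

Lemma cmod_block_factor l t : cmod (cexp ((ln t)%:C * z l)) = pw (u l) t.
Proof.
rewrite cmod_cexp /pw; congr expR; have := zE l; case: (z l) => a b /= /eqP.
by rewrite eq_complex/= => /andP[/eqP/addIr -> _]; rewrite mul0r subr0 mulrC.
Qed.

(* On a joint spectral block, [t^(M_l)] is the scalar [t^(z l)] times a unipotent
   factor, so [Gamma(M_l + 1)] is [cgam (z l + 1)] up to higher powers of the
   nilpotent part [nu l]. *)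
Lemma block_remainder l j :
  cmod (cgam (z l + 1)) * nrm (Z l j) <=
  Ka * nrm (Mx l) * nrm (nu l) ^+ j * nrm e +
  2 * (N * N)%:R * (Rgamma (u l + 1) 1 * (u l + 1 + (u l)^-1)) *
  \sum_(j.+1 <= k < N + N) nrm (Z l k).
Proof.
have pM1 : posmx (Mx l + 1%:M) by have := posmx_nat 1 (pM l).
have z1 : 0 < complex.Re (z l + 1) by rewrite zE/=; have := u0 l; lra.
have [c1 c2] := integrable_cgamk z1.
pose V := D l *m nu l ^+ j.
(* [Gamma(M_l + 1)] is used because the logarithms are bounded by [t + t^-1]: the additional power
   of [t] keeps the majorant integrable at 0. *)
pose G t := V *m gterm (Mx l + 1%:M) 1 t *m e.
(* Removes the term [k = 0] of [block_power], so that only [Z l k] with [k > j] remain. *)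
pose rem t := G t - cgamk (z l + 1) t *: Z l j.
pose S := \sum_(j.+1 <= k < N + N) nrm (Z l k).
have gi := mxI_gterm pM1 ltr01.
have Gi : mxI `]0, +oo[ G.
  by move=> psi h; exact: gi _ (Rlin_mull V (Rlin_mulr e h)).
have cE psi t : Rlin psi -> psi (cgamk (z l + 1) t *: Z l j) =
    complex.Re (cgamk (z l + 1) t) * psi (Z l j) + complex.Im (cgamk (z l + 1) t) * psi ('i *: Z l j).
  by move=> h; rewrite (Rlin_scalar _ _ h).
have ci psi : Rlin psi -> mu.-integrable `]0, +oo[ (EFin \o (fun t => psi (cgamk (z l + 1) t *: Z l j))).
  move=> h; have i1 := integrableZR (psi (Z l j)) (mitv _) c1.
  have i2 := integrableZR (psi ('i *: Z l j)) (mitv _) c2.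
  apply: eq_integrable_itv (integrableDR (mitv _) i1 i2) => t _.
  by rewrite (cE psi t h) mulrC [X in _ + X]mulrC.
have remi : mxI `]0, +oo[ rem.
  move=> psi h; apply: eq_integrable_itv (integrableBR (mitv _) (Gi _ h) (ci _ h)) => t _.
  by rewrite /rem (RlinB _ _ h).
have remE : mx_Rintegral `]0, +oo[ rem = V *m Gam (Mx l + 1%:M) 1 *m e - cgam (z l + 1) *: Z l j.
  apply: RlinP => psi h; rewrite (Rlin_Rintegral (mitv _) remi h) (RlinB _ _ h).
  have -> : \int[mu]_(t in `]0, +oo[) psi (rem t) =
      \int[mu]_(t in `]0, +oo[) (psi (G t) - psi (cgamk (z l + 1) t *: Z l j)).
    by apply: eq_Rint => t _; rewrite /rem (RlinB _ _ h).
  rewrite (RintegralB _ (Gi _ h) (ci _ h))//; congr (_ - _).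
    by rewrite (Rlin_Gam pM1 ltr01 (Rlin_mull V (Rlin_mulr e h))).
  rewrite (Rlin_scalar _ _ h)/=.
  rewrite -(RintegralZr _ _ c1)// -(RintegralZr _ _ c2)//.
  have i1 : mu.-integrable `]0, +oo[ (EFin \o (fun t => complex.Re (cgamk (z l + 1) t) * psi (Z l j))).
    by apply: eq_integrable_itv (integrableZR (psi (Z l j)) (mitv _) c1) => t _; rewrite mulrC.
  have i2 : mu.-integrable `]0, +oo[ (EFin \o (fun t => complex.Im (cgamk (z l + 1) t) * psi ('i *: Z l j))).
    by apply: eq_integrable_itv (integrableZR (psi ('i *: Z l j)) (mitv _) c2) => t _; rewrite mulrC.
  rewrite -(RintegralD _ i1 i2)//; apply: eq_Rint => t _; exact: cE.
have u2 : 0 < u l + 1 + 1 by have := u0 l; lra.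
pose w t := S * (pw (u l + 1 + 1 - 1) t * expR (- (1 * t)) + pw (u l - 1) t * expR (- (1 * t))).
have wi1 := integrable_gamma u2 ltr01; have wi2 := integrable_gamma (u0 l) ltr01.
have wi : mu.-integrable `]0, +oo[ (EFin \o w).
  by apply: integrableZR; [exact: mitv|exact: integrableDR (mitv _) wi1 wi2].
have remle t : 0 < t -> nrm (rem t) <= w t.
  move=> t0.
  have -> : rem t = (expR (- (1 * t)))%:C *: (cexp ((ln t)%:C * z l) *:
      \sum_(1 <= k < N + N) (ln t ^+ k / k`!%:R)%:C *: Z l (j + k)).
    rewrite /rem /G /gterm addrK -scalemxAr -scalemxAl -mulmxA block_power /cgamk addrK.
    rewrite -scalerA -scalerBr -scalerBr; congr (_ *: (_ *: _)).
    case E : (N + N)%N => [|n].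
      rewrite big_ord0 big_geq// Z_vanish ?E// subr0; by [].
    rewrite -(big_mkord xpredT (fun k => (ln t ^+ k / k`!%:R)%:C *: Z l (j + k))) big_ltn//.
    by rewrite expr0 fact0 divr1 scale1r addn0 addrAC subrr add0r.
  rewrite !nrmZ cmod_real ger0_norm ?expR_ge0// cmod_block_factor.
  have h1 : nrm (\sum_(1 <= k < N + N) (ln t ^+ k / k`!%:R)%:C *: Z l (j + k)) <= (t + t^-1) * S.
    apply: le_trans (nrm_sum _ _ _) _.
    apply: (@le_trans _ _ (\sum_(1 <= k < N + N) (t + t^-1) * nrm (Z l (j + k)))).
      apply: ler_sum => k _; rewrite nrmZ; apply: ler_wpM2r; first exact: nrm_ge0.
      by rewrite cmod_real normrM normfV normr_nat normrX; exact: ln_pow_le.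
    rewrite -mulr_sumr; apply: ler_wpM2l; first by rewrite addr_ge0 ?invr_ge0// ltW.
    have -> : \sum_(1 <= k < N + N) nrm (Z l (j + k)) = \sum_(j.+1 <= k < j + (N + N)) nrm (Z l k).
      by rewrite -[j.+1]add1n big_addn addKn; apply: eq_bigr => k _; rewrite addnC.
    have [jN|Nj] := leqP j.+1 (N + N).
      have tail : \sum_(N + N <= k < j + (N + N)) nrm (Z l k) = 0.
        by rewrite big_nat_cond big1// => k /andP[/andP[Nk _] _]; rewrite Z_vanish// nrm0.
      by rewrite (@big_cat_nat _ _ _ (N + N)%N)//= ?leq_addl// tail addr0.
    rewrite /S [leRHS]big_geq ?(ltnW Nj)// big_nat_cond big1// => k /andP[/andP[jk _] _].
    by rewrite Z_vanish ?nrm0// (leq_trans _ (ltnW jk))// -ltnS.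
  apply: le_trans (ler_wpM2l (expR_ge0 _) (ler_wpM2l (pw_ge0 _ _) h1)) _.
  have e1 : pw (u l + 1 + 1 - 1) t = pw (u l) t * t by rewrite addrK pwD pw1.
  have e2 : pw (u l - 1) t = pw (u l) t * t^-1 by rewrite pwD pwN1.
  by rewrite /w e1 e2 le_eqVlt; apply/orP; left; apply/eqP; ring.
have remle' t : `]0, +oo[%classic t -> nrm (rem t) <= w t.
  by rewrite /= in_itv/= andbT; exact: remle.
have H := nrm_Rintegral_le (mitv _) remi wi remle'.
have wE : \int[mu]_(t in `]0, +oo[) w t = S * (Rgamma (u l + 1) 1 * (u l + 1 + (u l)^-1)).
  rewrite (RintegralZl _ _ (integrableDR (mitv _) wi1 wi2))// (RintegralD _ wi1 wi2)//.
  rewrite -[X in _ * (X + _)]/(Rgamma (u l + 1 + 1) 1) -[X in _ * (_ + X)]/(Rgamma (u l) 1).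
  have u1 : 0 < u l + 1 by have := u0 l; lra.
  rewrite (Rgamma_rec u1) (Rgamma_rec (u0 l)).
  by move: (Rgamma (u l) 1) (u l) (u0 l) => g v v0; field; rewrite gt_eqF.
rewrite wE remE in H.
have DGE : V *m Gam (Mx l + 1%:M) 1 *m e = (D l *m Gam (Mx l) 1) *m Mx l *m nu l ^+ j *m e.
  rewrite (Gamma_rec (pM l)); apply: (congr1 (fun X => X *m e)); rewrite /V.
  have cM : comm_mx (nu l ^+ j) (Mx l).
    by apply: comm_mx_sym; apply: comm_mxX; apply: nuMx; exact: comm_mx_refl.
  have cG : comm_mx (nu l ^+ j) (Gam (Mx l) 1) by apply: (comm_Gam (pM l) ltr01).
  have cMG : comm_mx (Mx l) (Gam (Mx l) 1).
    by apply: (comm_Gam (pM l) ltr01); exact: comm_mx_refl.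
  move: (Gam (Mx l) 1) (Mx l) (nu l ^+ j) cM cG cMG => G1 M1 n1 cM cG cMG.
  by rewrite cMG -!mulmxA; congr (_ *m _); rewrite mulmxA cG -mulmxA cM.
have N1 : nrm (V *m Gam (Mx l + 1%:M) 1 *m e) <= Ka * nrm (Mx l) * nrm (nu l) ^+ j * nrm e.
  rewrite DGE; apply: le_trans (nrmM _ _) _; apply: ler_wpM2r; first exact: nrm_ge0.
  apply: le_trans (nrmMX _ _ _) _; apply: ler_wpM2r; first by rewrite exprn_ge0// nrm_ge0.
  by apply: le_trans (nrmM _ _) _; apply: ler_wpM2r; [exact: nrm_ge0|exact: HKa].
rewrite -nrmZ.
have -> : cgam (z l + 1) *: Z l j = V *m Gam (Mx l + 1%:M) 1 *m e -
    (V *m Gam (Mx l + 1%:M) 1 *m e - cgam (z l + 1) *: Z l j) by rewrite subKr.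
apply: le_trans (nrmB _ _) _; apply: lerD => //.
by apply: le_trans H _; rewrite -/S -!mulrA [S * _]mulrC -!mulrA.
Qed.

Lemma egrow_nrm_affine A B : egrow (fun l => nrm (A *+ l + B)).
Proof.
have h : egrow (fun l => nrm A * l%:R + nrm B).
  apply: egrowD; last exact: egrow_cst.
  by apply: egrowM => //; [move=> l; exact: nrm_ge0|exact: egrow_cst|exact: egrow_nat].
apply: egrow_le h => l; apply: le_trans (nrmD _ _) _; rewrite lerD2r -scaler_nat nrmZ cmod_natr.
by rewrite mulrC.
Qed.

(** [cgam_lower] turns the inequalities of [block_remainder] into a triangular system for
    [nrm (Z l j) * Rgamma (u l + 1) 1]. Its size does not depend on [l] and its coefficients grow at
    most exponentially, hence so does the solution. *)
Lemma block_growth : exists E : nat -> R, [/\ forall l, 0 <= E l, egrow E &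
  forall l t, 1 <= t -> nrm (D l *m real_powmx t (Mx l - 1%:M) *m e) <=
    E l / Rgamma (u l + 1) 1 * pw (u l) t].
Proof.
pose a := complex.Re p; pose b := complex.Re q.
have a0 : 0 < a by exact: p0.
have b0 : 0 < b by exact: q0.
pose a' := complex.Im p; pose b' := complex.Im q.
(* The points [p l + q] lie in a fixed cone around the positive axis:
   [|a' l + b'| <= C1 (a l + b)]. *)
pose C1 := `|a'| / a + `|b'| / b; pose C := C1 ^+ 2.
have uE l : u l = a * l%:R + b by [].
have C10 : 0 <= C1 by rewrite addr_ge0// divr_ge0// ltW.
have vC l : (a' * l%:R + b') ^+ 2 <= C * u l ^+ 2.
  rewrite /C -exprMn -[leLHS]real_normK ?num_real//; apply: lerXn2r; rewrite ?nnegrE//.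
    by rewrite mulr_ge0// ltW.
  apply: le_trans (ler_normD _ _) _; rewrite normrM normr_nat uE mulrDr; apply: lerD.
    rewrite mulrA; apply: ler_wpM2r => //; rewrite /C1 mulrDl divfK ?gt_eqF//.
    by rewrite lerDl mulr_ge0 ?(ltW a0)// divr_ge0// ltW.
  by rewrite /C1 mulrDl [X in _ + X]divfK ?gt_eqF// lerDr mulr_ge0 ?(ltW b0)// divr_ge0// ltW.
have low l : Rgamma (u l + 1) 1 <= 2 * expR (C * u l) * cmod (cgam (z l + 1)).
  by rewrite zE; exact: cgam_lower.
have K0 : 0 <= Ka by exact: le_trans (nrm_ge0 _) (HKa 0%N).
pose N2 := (N + N)%N.
pose al l := 2 * expR (C * u l) * (Ka * nrm (Mx l) * (1 + nrm (nu l)) ^+ N2 * nrm e).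
pose bl l := 2 * expR (C * u l) * (2 * (N * N)%:R * (u l + 1 + (u l)^-1)).
have ee0 l : 0 <= 2 * expR (C * u l) by apply: mulr_ge0 => //; exact: expR_ge0.
have n10 l : 0 <= (1 + nrm (nu l)) ^+ N2 by apply: exprn_ge0; apply: addr_ge0 => //; exact: nrm_ge0.
have al0 l : 0 <= al l.
  apply: mulr_ge0 => //; apply: mulr_ge0; last exact: nrm_ge0.
  by apply: mulr_ge0 => //; apply: mulr_ge0 => //; exact: nrm_ge0.
have uu0 l : 0 <= u l + 1 + (u l)^-1.
  by apply: addr_ge0; [apply: addr_ge0 => //; exact: ltW|rewrite invr_ge0; exact: ltW].
have bl0 l : 0 <= bl l.
  by apply: mulr_ge0 => //; apply: mulr_ge0.
have G0 l : 0 < Rgamma (u l + 1) 1 by apply: Rgamma_gt0; have := u0 l; lra.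
have wbound l j : (j < N2)%N -> nrm (Z l j) * Rgamma (u l + 1) 1 <= al l * (1 + bl l) ^+ N2.
  apply: (@downward_bound _ (fun j => nrm (Z l j) * Rgamma (u l + 1) 1)) => // {}j jN.
  have H := block_remainder l j.
  apply: le_trans (ler_wpM2l (nrm_ge0 _) (low l)) _.
  have -> : nrm (Z l j) * (2 * expR (C * u l) * cmod (cgam (z l + 1))) =
    2 * expR (C * u l) * (cmod (cgam (z l + 1)) * nrm (Z l j)) by ring.
  apply: le_trans (ler_wpM2l (ee0 l) H) _; rewrite mulrDr; apply: lerD.
    apply: ler_wpM2l => //; apply: ler_wpM2r; first exact: nrm_ge0.
    apply: ler_wpM2l; first by apply: mulr_ge0 => //; exact: nrm_ge0.
    apply: (@le_trans _ _ ((1 + nrm (nu l)) ^+ j)).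
      by apply: lerXn2r; rewrite ?nnegrE ?addr_ge0 ?nrm_ge0// lerDr.
    by apply: ler_weXn2l; [rewrite lerDl; exact: nrm_ge0|exact: ltnW].
  rewrite -mulr_suml /bl le_eqVlt; apply/orP; left; apply/eqP.
  have gen (c n g X S : R) : 2 * c * (2 * n * (g * X) * S) = 2 * c * (2 * n * X) * (S * g).
    by clear; ring.
  exact: gen.
(* The factor 2 comes from [t + t^-1 <= 2 t] for [t >= 1]; the [t] cancels against the [t^-1] in
   [t^(M_l - 1)]. *)
pose E l := 2 * (N2%:R * (al l * (1 + bl l) ^+ N2)).
have b10 l : 0 <= (1 + bl l) ^+ N2 by apply: exprn_ge0; apply: addr_ge0.
exists E; split.
- by move=> l; apply: mulr_ge0 => //; apply: mulr_ge0 => //; apply: mulr_ge0.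
- have eu : egrow u.
    apply: egrowD; last exact: egrow_cst.
    by apply: egrowM => //; [move=> l; exact: ltW|exact: egrow_cst|exact: egrow_nat].
  have euV : egrow (fun l => (u l)^-1).
    apply: egrow_le (egrow_cst b^-1) => l; rewrite lef_pV2 ?posrE//.
    by rewrite uE lerDr mulr_ge0// ltW.
  have ee : egrow (fun l => 2 * expR (C * u l)).
    apply: egrowM => //; first exact: egrow_cst.
    have h : egrow (fun l => expR (C * a * l%:R) * expR (C * b)).
      by apply: egrowM => [l|l| |]; [exact: expR_ge0|exact: expR_ge0|exact: egrow_expR|exact: egrow_cst].
    by apply: egrow_le h => l; rewrite -expRD uE mulrDr mulrA.
  have eM : egrow (fun l => nrm (Mx l)) by exact: egrow_nrm_affine.
  have enu : egrow (fun l => 1 + nrm (nu l)).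
    apply: egrowD; first exact: egrow_cst.
    have h := egrow_nrm_affine (P - p%:M) (Q - q%:M).
    apply: egrow_le h => l; rewrite /nu /Mx /z mulrnBl raddfD/= raddfMn/= opprD addrACA.
    exact: lexx.
  have ea : egrow al.
    apply: egrowM => // [l|].
      apply: mulr_ge0; last exact: nrm_ge0.
      by apply: mulr_ge0 => //; apply: mulr_ge0 => //; exact: nrm_ge0.
    apply: egrowM => // [l|l| |].
    + by apply: mulr_ge0 => //; apply: mulr_ge0 => //; exact: nrm_ge0.
    + exact: nrm_ge0.
    + apply: egrowM => // [l| |].
      * by apply: mulr_ge0 => //; exact: nrm_ge0.
      * by apply: egrowM => // [l|]; [exact: nrm_ge0|exact: egrow_cst].
      * by apply: egrowX => // l; apply: addr_ge0 => //; exact: nrm_ge0.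
    + exact: egrow_cst.
  have eb : egrow bl.
    apply: egrowM => // [l|]; first exact: mulr_ge0.
    apply: egrowM => //; first exact: egrow_cst.
    by apply: egrowD => //; apply: egrowD => //; exact: egrow_cst.
  apply: egrowM => // [l| |]; first by apply: mulr_ge0 => //; apply: mulr_ge0.
    exact: egrow_cst.
  apply: egrowM => // [l| |]; first exact: mulr_ge0.
    exact: egrow_cst.
  apply: egrowM => //; apply: egrowX => [l|]; first exact: addr_ge0.
  by apply: egrowD => //; exact: egrow_cst.
- move=> l t t1; have t0 : 0 < t := lt_le_trans ltr01 t1.
  have := block_power l 0 t; rewrite expr0 mulmx1 => HB.
  rewrite real_powmxB1// -scalemxAr -scalemxAl nrmZ cmod_real ger0_norm ?invr_ge0 ?(ltW t0)//.
  rewrite -mulmxA HB nrmZ cmod_block_factor.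
  have h1 : nrm (\sum_(k < N + N) (ln t ^+ k / k`!%:R)%:C *: Z l (0 + k)) <=
      (2 * t) * (N2%:R * (al l * (1 + bl l) ^+ N2 / Rgamma (u l + 1) 1)).
    apply: le_trans (nrm_sum _ _ _) _.
    apply: (@le_trans _ _ (\sum_(k < N + N) (2 * t) * (al l * (1 + bl l) ^+ N2 / Rgamma (u l + 1) 1))).
      apply: ler_sum => k _; rewrite nrmZ; apply: ler_pM; [exact: cmod_ge0|exact: nrm_ge0| |].
        rewrite cmod_real normrM normfV normr_nat normrX.
        apply: le_trans (ln_pow_le k t0) _.
        have : t^-1 <= t by apply: (le_trans _ t1); rewrite invf_le1.
        by lra.
      by rewrite add0n ler_pdivlMr//; apply: wbound; exact: ltn_ord.
    by rewrite sumr_const card_ord -[leLHS]mulr_natl /N2 mulrCA.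
  apply: le_trans (ler_wpM2l _ (ler_wpM2l (pw_ge0 _ _) h1)) _; first by rewrite invr_ge0 ltW.
  have gen (pp n X g : R) : 0 < g -> t^-1 * (pp * ((2 * t) * (n * (X / g)))) = 2 * (n * X) / g * pp.
    by move=> g0; field; rewrite !gt_eqF.
  by rewrite gen.
Qed.

End Blocks.

(** * Summable majorants for the Laplace integrals *)

Section Domination.
Context {R : realType} {N : nat}.
Local Notation M := 'M[R[i]]_N.
Local Notation mu := (@lebesgue_measure R).
Local Notation RT := (measurableTypeR R).
Implicit Types (A X Y : M) (psi : M -> R) (h s t y : R).
Variables (P Q : M) (D : nat -> M).
Hypotheses (hP : mx_Re_gt0 P) (hQ : mx_Re_gt0 Q) (cPQ : comm_mx P Q).
Variable Ka : R.
Hypothesis HKa : forall l, nrm (D l *m Gam (P *+ l + Q) 1) <= Ka.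

Let pP : posmx P := posmx_Re hP.
Let pQ : posmx Q := posmx_Re hQ.

Definition laplace_dom s (W : nat -> R -> R) := exists2 B : nat -> R, cvgn (series B) &
  forall l, mu.-integrable `]0, +oo[ (EFin \o (fun t => W l t * expR (- (s * t)))) /\
    \int[mu]_(t in `]0, +oo[) (W l t * expR (- (s * t))) <= B l.

Lemma laplace_domD s W W' : laplace_dom s W -> laplace_dom s W' ->
  laplace_dom s (fun l t => W l t + W' l t).
Proof.
move=> [B cB HB] [B' cB' HB']; exists (fun l => B l + B' l).
  have -> : series (fun l => B l + B' l) = series B + series B'.
    by apply/funext => n; rewrite !fctE /series/= big_split.
  exact: is_cvgD.
move=> l; have [i1 b1] := HB l; have [i2 b2] := HB' l.
have e t : W l t * expR (- (s * t)) + W' l t * expR (- (s * t)) = (W l t + W' l t) * expR (- (s * t)).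
  by rewrite mulrDl.
split; first by apply: eq_integrable_itv (integrableDR (mitv _) i1 i2) => t _.
have -> : \int[mu]_(t in `]0, +oo[) ((W l t + W' l t) * expR (- (s * t))) =
    \int[mu]_(t in `]0, +oo[) (W l t * expR (- (s * t)) + W' l t * expR (- (s * t))).
  by apply: eq_Rint => t _; rewrite e.
by rewrite (RintegralD _ i1 i2)//; exact: lerD.
Qed.

Definition dominated_by e := exists2 s1, 0 < s1 & forall s, s1 <= s -> exists W,
  [/\ laplace_dom s W, forall l t, 0 < t -> 0 <= W l t &
    forall l t, 1 <= t -> nrm (D l *m real_powmx t (P *+ l + Q - 1%:M) *m e) <= W l t].

Lemma dominated_by0 : dominated_by 0.
Proof.
exists 1 => // s _; exists (fun _ _ => 0); split=> // [|l t _]; last by rewrite mulmx0 nrm0.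
exists (fun=> 0) => [|l].
  by have := @cvg_geometric_dom R 0 0; rewrite lexx ltr01 => /(_ isT);
    under eq_fun do rewrite mul0r.
split.
  apply: (@eq_integrable_itv _ _ (fun _ => 0)) => [t _|]; first by rewrite mul0r.
  exact: integrable0.
rewrite (_ : \int[mu]_(t in `]0, +oo[) (0 * expR (- (s * t))) = 0)//.
have -> : \int[mu]_(t in `]0, +oo[) (0 * expR (- (s * t))) = \int[mu]_(t in `]0, +oo[) (0 : R).
  by apply: eq_Rint => t _; rewrite mul0r.
by rewrite /Rintegral integral0.
Qed.

Lemma dominated_byD e f : dominated_by e -> dominated_by f -> dominated_by (e + f).
Proof.
move=> [s1 s10 H1] [s2 s20 H2]; exists (Num.max s1 s2); first by rewrite lt_max s10.
move=> s; rewrite ge_max => /andP[/H1[W [d1 p1 b1]] /H2[W' [d2 p2 b2]]].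
exists (fun l t => W l t + W' l t); split; first exact: laplace_domD.
  by move=> l t t0; apply: addr_ge0; [exact: p1|exact: p2].
move=> l t t1; rewrite mulmxDr; apply: le_trans (nrmD _ _) _; apply: lerD; [exact: b1|exact: b2].
Qed.

(** The integral of [t^(u_l) e^(-s t)] is [Gamma(u_l + 1) s^(-u_l - 1)], and its Gamma factor
    cancels the denominator of [block_growth]. What remains is geometric of ratio [C s^(-a)]. *)
Lemma dominated_by_block (p q : R[i]) (eP eQ : M) :
  0 < complex.Re p -> 0 < complex.Re q ->
  (forall Y, comm_mx Y P -> comm_mx Y eP) ->
  (P - p%:M) ^+ N *m eP = 0 -> (Q - q%:M) ^+ N *m eQ = 0 -> dominated_by (eP *m eQ).
Proof.
move=> p0 q0 ceP nP nQ.
have [E [E0 [C C1 EC] HE]] := block_growth pP pQ cPQ HKa p0 q0 ceP nP nQ.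
set a := complex.Re p in p0 HE *; set b := complex.Re q in q0 HE *.
have C0 : 0 < C := lt_le_trans ltr01 C1.
(* From this value on, [C s^(-a) <= e^(-1)]. *)
exists (expR ((ln C + 1) / a)) => [|s ss1]; first exact: expR_gt0.
have s0 : 0 < s := lt_le_trans (expR_gt0 _) ss1.
have r1 : C * pw (- a) s < 1.
  have h : ln C + 1 <= a * ln s.
    by rewrite mulrC -ler_pdivrMr// -(expRK ((ln C + 1) / a)) ler_ln ?posrE ?expR_gt0.
  rewrite -{1}(lnK C0) -expRD expR_lt1; lra.
pose u l := a * l%:R + b.
have u0 l : 0 < u l by rewrite /u ltr_wpDl// mulr_ge0// ltW.
have u1 l : 0 < u l + 1 by have := u0 l; lra.
have G0 l : 0 < Rgamma (u l + 1) 1 by exact: Rgamma_gt0.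
exists (fun l t => E l / Rgamma (u l + 1) 1 * pw (u l) t); split; last exact: HE.
- pose K := C * pw (- (b + 1)) s.
  exists (fun l => K * (C * pw (- a) s) ^+ l).
    by apply: cvg_geometric_dom; rewrite r1 andbT mulr_ge0 ?pw_ge0// ltW.
  move=> l; have i1 := integrable_gamma (u1 l) s0.
  have i2 := integrableZR (E l / Rgamma (u l + 1) 1) (mitv _) i1.
  have e t : E l / Rgamma (u l + 1) 1 * (pw (u l + 1 - 1) t * expR (- (s * t))) =
      E l / Rgamma (u l + 1) 1 * pw (u l) t * expR (- (s * t)) by rewrite addrK mulrA.
  split; first by apply: eq_integrable_itv i2 => t _; exact: e.
  have -> : \int[mu]_(t in `]0, +oo[) (E l / Rgamma (u l + 1) 1 * pw (u l) t * expR (- (s * t))) =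
     \int[mu]_(t in `]0, +oo[) (E l / Rgamma (u l + 1) 1 * (pw (u l + 1 - 1) t * expR (- (s * t)))).
    by apply: eq_Rint => t _; rewrite e.
  rewrite (RintegralZl _ _ i1)// -[X in _ * X]/(Rgamma (u l + 1) s) (Rgamma_scale (u1 l) s0).
  have -> : E l / Rgamma (u l + 1) 1 * (pw (- (u l + 1)) s * Rgamma (u l + 1) 1) =
      E l * pw (- (u l + 1)) s.
    by move: (Rgamma _ 1) (G0 l) => g g0; field; rewrite gt_eqF.
  have -> : K * (C * pw (- a) s) ^+ l = C ^+ l.+1 * pw (- (u l + 1)) s.
    have -> : pw (- (u l + 1)) s = pw (- (b + 1)) s * pw (- a) s ^+ l.
      rewrite /pw -expRM_natl -expRD; congr expR; rewrite /u; ring.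
    by rewrite /K exprMn exprS; ring.
  by apply: ler_wpM2r; [exact: pw_ge0|exact: EC].
- move=> l t t0; apply: mulr_ge0; last exact: pw_ge0.
  by apply: divr_ge0 => //; exact: ltW.
Qed.

Lemma dominated_by1 : dominated_by 1%:M.
Proof.
have [sP [sP1 HsP]] := primary_partition P; have [sQ [sQ1 HsQ]] := primary_partition Q.
have -> : 1%:M = \sum_(pe <- sP) \sum_(qe <- sQ) (pe.2 *m qe.2) :> M.
  under eq_bigr do rewrite -mulmx_sumr sQ1 mulmx1.
  by rewrite sP1.
rewrite big_seq; apply: big_ind => [||pe peP]; [exact: dominated_by0|exact: dominated_byD|].
rewrite big_seq; apply: big_ind => [||qe qeQ]; [exact: dominated_by0|exact: dominated_byD|].
have [p1 p2 p3] := HsP _ peP; have [q1 q2 q3] := HsQ _ qeQ.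
by apply: (@dominated_by_block pe.1 qe.1) => //; [exact: hP|exact: hQ].
Qed.

Lemma laplace_domination : geo P D 1 -> exists2 s, 0 < s & exists2 W, laplace_dom s W &
  forall l t, 0 < t -> nrm (D l *m real_powmx t (P *+ l + Q - 1%:M)) <= W l t.
Proof.
move=> g1; have [s1 s10 /(_ s1 (lexx _))[W [dW W0 bW]]] := dominated_by1.
have [K [r [b [c [[K0 r01 b0 c0] HK]]]]] := geo_bound pQ cPQ g1.
exists s1 => //.
pose V (l : nat) t := K * r ^+ l * (pw (b - 1) t + pw (c - 1) t).
have V0 l t : 0 <= V l t.
  apply: mulr_ge0; last by apply: addr_ge0; exact: pw_ge0.
  by apply: mulr_ge0 => //; apply: exprn_ge0; case/andP: r01.
exists (fun l t => V l t + W l t).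
  apply: laplace_domD => //.
  have i1 := integrable_gamma b0 s10; have i2 := integrable_gamma c0 s10.
  have i3 := integrableDR (mitv _) i1 i2.
  pose J := \int[mu]_(t in `]0, +oo[) (pw (b - 1) t * expR (- (s1 * t)) + pw (c - 1) t * expR (- (s1 * t))).
  exists (fun l => K * J * r ^+ l); first exact: cvg_geometric_dom.
  move=> l; have i4 := integrableZR (K * r ^+ l) (mitv _) i3.
  have e t : K * r ^+ l * (pw (b - 1) t * expR (- (s1 * t)) + pw (c - 1) t * expR (- (s1 * t))) =
      V l t * expR (- (s1 * t)) by rewrite /V -mulrDl mulrA.
  split; first by apply: eq_integrable_itv i4 => t _; exact: e.
  have -> : \int[mu]_(t in `]0, +oo[) (V l t * expR (- (s1 * t))) = \int[mu]_(t in `]0, +oo[)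
      (K * r ^+ l * (pw (b - 1) t * expR (- (s1 * t)) + pw (c - 1) t * expR (- (s1 * t)))).
    by apply: eq_Rint => t _; rewrite e.
  by rewrite (RintegralZl _ _ i3)// mulrAC.
move=> l t t0; have [t1|t1] := leP t 1.
  apply: le_trans (HK t l _) _; first by rewrite t0.
  by rewrite lerDl W0.
apply: le_trans (_ : _ <= W l t) _; last by rewrite lerDr.
by rewrite -[X in nrm X]mulmx1; apply: bW; exact: ltW.
Qed.

End Domination.

(** * The upper incomplete case *)

Section UpperCase.
Context {R : realType} {N : nat}.
Local Notation M := 'M[R[i]]_N.
Local Notation mu := (@lebesgue_measure R).
Local Notation RT := (measurableTypeR R).
Implicit Types (A X Y : M) (h s t y : R).
Variables (P Q : M) (D : nat -> M) (psi : M -> R) (I : R).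
Hypotheses (hP : mx_Re_gt0 P) (hQ : mx_Re_gt0 Q) (cPQ : comm_mx P Q).
Hypotheses (DP : forall l, comm_mx (D l) P) (DQ : forall l, comm_mx (D l) Q).
Hypothesis gD : forall y, 0 < y -> geo P D y.
Hypothesis ca : cvgn (series (fun l => D l *m Gam (P *+ l + Q) 1)).
Hypothesis hpsi : Rlin psi.

Let pP : posmx P := posmx_Re hP.
Let pQ : posmx Q := posmx_Re hQ.
Let g t := expR (- t) * Gs P Q D psi t.
Let A := prim g.

Hypothesis AI : A d @[d --> +oo] --> I.

Let gi y : 0 < y -> mu.-integrable `]0, y[ (EFin \o g).
Proof. by move=> y0; apply: (gint_integrable pP pQ cPQ y0 _ hpsi); exact: gD. Qed.

Let gc t : 0 < t -> {for t, continuous g}.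
Proof.
move=> t0; have y0 : 0 < t + 1 by rewrite ltr_wpDr.
by apply: (gint_cont pQ cPQ (gD y0) hpsi); rewrite t0 ltrDl ltr01.
Qed.

Let dA t : 0 < t -> is_derive t 1 A (g t).
Proof.
move=> t0; have y0 : 0 < t + 1 by rewrite ltr_wpDr.
apply: (@prim_derive _ _ (t + 1)); [exact: gi| |by rewrite t0 ltrDl ltr01].
by move=> u /andP[u0 _]; exact: gc.
Qed.

Let Ac t : 0 < t -> {for t, continuous A}.
Proof. by move=> t0; exact: is_derive_continuous (dA t0). Qed.

Let A0 : A d @[d --> 0^'+] --> 0.
Proof. exact: (prim_cvg0 (gi ltr01) ltr01). Qed.

Let A_bounded : exists K, forall t, 0 < t -> `|A t| <= K.
Proof.
have /cvgrPdist_le/(_ 1 ltr01)[d [_ Hd]] := AI.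
(* The point [d] given by convergence at infinity may be negative. *)
pose d0 := Num.max d 1; have d00 : 0 < d0 by rewrite lt_max ltr01 orbT.
have y0 : 0 < d0 + 1 by rewrite ltr_wpDr.
exists (`|I| + 1 + \int[mu]_(t in `]0, d0 + 1[) `|g t|) => t t0.
have [td|dt] := leP t d0.
  have ty : t < d0 + 1 by rewrite (le_lt_trans td)// ltrDl.
  by apply: le_trans (prim_le (gi y0) ty) _; rewrite lerDr addr_ge0.
rewrite -[leLHS]addr0; apply: lerD; last exact: Rintegral_ge0.
have dt' : d < t by apply: le_lt_trans dt; rewrite le_max lexx.
have := Hd t dt'; rewrite distrC => H.
by rewrite -[A t](subrK I) addrC; apply: le_trans (ler_normD _ _) _; exact: lerD.
Qed.

(* For large [s] the series may be integrated termwise, since the blockwise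
   lower bounds on Gamma give [D_l] a factor [C^l / Gamma(Re z_l + 1)]. *)
Lemma Tsum_large : exists2 s0, 0 < s0 & forall n s, s0 <= s ->
  Tsum P Q D psi n (1 + s) = lapd A n s.
Proof.
have [Ka Ka0 HKa] := cvg_series_bounded ca; have [K AK] := A_bounded.
have [s0 s00 [W [B cB HB] HW]] := laplace_domination hP hQ cPQ HKa (gD ltr01).
have [k k0 hk] := Rlin_bound hpsi.
exists s0 => // n s s0s; have sp : 0 < s := lt_le_trans s00 s0s.
have s1 : 0 < 1 + s by rewrite ltr_wpDl.
have pM l : posmx (P *+ l + Q) by exact: posmxMnD.
have pMn l := posmx_nat n (pM l).
pose v l t := psi (D l *m gterm (P *+ l + Q + n%:R%:M) (1 + s) t).
have vi l : mu.-integrable `]0, +oo[ (EFin \o v l).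
  exact: (mxI_gterm (pMn l) s1) _ (Rlin_mull (D l) hpsi).
have vE l t : 0 < t -> v l t = t ^+ n * expR (- ((1 + s) * t)) *
    psi (D l *m real_powmx t (P *+ l + Q - 1%:M)).
  move=> t0; rewrite /v /gterm real_powmx_shift_nat//.
  by rewrite !(RlinZ _ _ (Rlin_mull (D l) hpsi)); ring.
(* The factor [e^(-t)] of the integrand absorbs [t^n <= n! e^t], so one majorant serves every
   derivative order. *)
have te t : 0 < t -> t ^+ n * expR (- ((1 + s) * t)) <= n`!%:R * expR (- (s0 * t)).
  move=> t0; have := expR_bound n ltr01 (ltW t0).
  rewrite expr1n invr1 !mul1r ler_pdivrMr ?ltr0n ?fact_gt0// => H.
  apply: (@le_trans _ _ (expR t * n`!%:R * expR (- ((1 + s) * t)))).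
    by apply: ler_wpM2r => //; exact: expR_ge0.
  rewrite mulrC mulrA -expRD mulrC; apply: ler_wpM2l => //; rewrite ler_expR.
  have : s0 * t <= s * t by apply: ler_wpM2r => //; exact: ltW.
  by lra.
have vle l t : 0 < t -> `|v l t| <= k * n`!%:R * (W l t * expR (- (s0 * t))).
  move=> t0; rewrite vE// normrM ger0_norm; last first.
    by apply: mulr_ge0; [apply: exprn_ge0; exact: ltW|exact: expR_ge0].
  have h1 := le_trans (hk (D l *m real_powmx t (P *+ l + Q - 1%:M))) (ler_wpM2l k0 (HW l t t0)).
  apply: le_trans (ler_pM _ (normr_ge0 _) (te t t0) h1) _.
    by apply: mulr_ge0; [apply: exprn_ge0; exact: ltW|exact: expR_ge0].
  by rewrite le_eqVlt; apply/orP; left; apply/eqP; ring.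
have vB l : \int[mu]_(t in `]0, +oo[) `|v l t| <= k * n`!%:R * B l.
  have [i1 b1] := HB l; have i2 := integrableZR (k * n`!%:R) (mitv _) i1.
  have c0 : 0 <= k * n`!%:R by apply: mulr_ge0.
  apply: le_trans (ler_wpM2l c0 b1); rewrite -(RintegralZl _ _ i1)//.
  apply: le_Rintegral => //; first exact: integrable_norm (vi l).
  by move=> t /=; rewrite in_itv/= andbT; exact: vle.
have cB' : cvgn (series (fun l => k * n`!%:R * B l)).
  have -> : (fun l => k * n`!%:R * B l) = (k * n`!%:R) *: B by [].
  exact: is_cvg_seriesZ.
have vs t : `]0, +oo[%classic t -> cvgn (series (fun l => `|v l t|)).
  rewrite /= in_itv/= andbT => t0; have tt : 0 < t <= t by rewrite t0 lexx.
  have ct : cvgn (series ((t ^+ n * expR (- ((1 + s) * t))) *: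
      (fun l => `|psi (D l *m real_powmx t (P *+ l + Q - 1%:M))|))).
    by apply: is_cvg_seriesZ; exact: (Gs_abs pQ cPQ hpsi (gD t0) tt).
  apply: (dominated_cvg_series _ ct) => l; rewrite normr_id vE// normrM ger0_norm; first exact: lexx.
  by apply: mulr_ge0; [apply: exprn_ge0; exact: ltW|exact: expR_ge0].
have [i1 i2] := Rintegral_series (mitv _) vi vs vB cB'.
have lE t : 0 < t -> limn (series (v ^~ t)) = g t * (t ^+ n * expR (- (s * t))).
  move=> t0; have tt : 0 < t <= t by rewrite t0 lexx.
  have -> : v ^~ t = (t ^+ n * expR (- ((1 + s) * t))) *:
      (fun l => psi (D l *m real_powmx t (P *+ l + Q - 1%:M))).
    by apply/funext => l; rewrite vE.
  rewrite lim_seriesZ; last exact: (Gs_cvg pQ cPQ hpsi (gD t0) tt).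
  rewrite -[limn _]/(Gs P Q D psi t) /g /GRing.scale/=.
  have -> : expR (- ((1 + s) * t)) = expR (- t) * expR (- (s * t)).
    by rewrite -expRD; congr expR; ring.
  by ring.
have gni : mu.-integrable `]0, +oo[ (EFin \o (fun t => g t * (t ^+ n * expR (- (s * t))))).
  by apply: eq_integrable_itv i1 => t; rewrite in_itv/= andbT; exact: lE.
have := lap_parts Ac AK sp dA gc A0 gni; rewrite -/A => <-.
have -> : \int[mu]_(t in `]0, +oo[) (g t * (t ^+ n * expR (- (s * t)))) =
    \int[mu]_(t in `]0, +oo[) limn (series (v ^~ t)).
  by apply: eq_Rint => t; rewrite in_itv/= andbT => t0; rewrite lE.
apply: etrans _ (esym i2); rewrite /Tsum; congr (limn (series _)); apply/funext => l.
by rewrite (Rlin_Gam (pMn l) s1 (Rlin_mull (D l) hpsi)).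
Qed.

(** If the identities hold for all [n] at [s' / (1 - y)], both Taylor series based there agree, and
    they converge to the two sides at [s']. The induction must carry all [n] at once; the ratio
    being fixed, finitely many steps link [1 + s] to the range of [Tsum_large]. *)
Lemma Tsum_lapd s : 0 < s -> Tsum P Q D psi 0 (1 + s) = lapd A 0 s.
Proof.
move=> sp; have [Ka Ka0 HKa] := cvg_series_bounded ca; have [K AK] := A_bounded.
have s1 : 1 < 1 + s by rewrite ltrDl.
have [y /andP[y0 y1] Hy] := Tsum_taylor pP pQ cPQ DP DQ HKa s1.
have [s0 s00 H0] := Tsum_large.
have q0 : 0 < 1 - y by rewrite subr_gt0.
have key k : forall s', 1 + s <= s' -> (1 + s0) * (1 - y) ^+ k <= s' ->
    forall n, Tsum P Q D psi n s' = lapd A n (s' - 1).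
  elim: k => [|k IH] s' ss' ks' n.
    rewrite expr0 mulr1 in ks'; have e1 : 1 + (s' - 1) = s' by rewrite addrC subrK.
    by rewrite -[X in Tsum _ _ _ _ _ X]e1; apply: H0; rewrite lerBrDl.
  pose s2 := s' / (1 - y).
  have e1 : s2 - y * s2 = s' by rewrite /s2; field; rewrite gt_eqF.
  have s'0 : 0 < s' by apply: lt_le_trans ss'; exact: lt_trans s1.
  have s20 : 0 < s2 by rewrite divr_gt0.
  have ys2 : 0 < y * s2 by rewrite mulr_gt0.
  have s2s : s' <= s2 by rewrite -e1 gerBl ltW.
  have k2 : (1 + s0) * (1 - y) ^+ k <= s2.
    by rewrite /s2 ler_pdivlMr// -mulrA -exprSr.
  have c1 := Hy psi n s2 hpsi (le_trans ss' s2s).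
  (* The Laplace side lives at [s2 - 1] with the same step, which stays admissible because the
     target [s'] exceeds 1. *)
  have hs : 0 < y * s2 < s2 - 1.
    rewrite ys2/= ltrBrDr -ltrBrDl e1; apply: lt_le_trans ss'; exact: s1.
  have c2 := @lapd_taylor R A K Ac AK n _ _ hs.
  have e2 : s2 - 1 - y * s2 = s' - 1 by rewrite addrAC e1.
  rewrite e1 in c1; rewrite e2 in c2.
  have e3 : (fun m => \sum_(0 <= k < m) ((y * s2) ^+ k / k`!%:R * Tsum P Q D psi (n + k) s2)) =
      (fun m => \sum_(0 <= k < m) ((y * s2) ^+ k / k`!%:R * lapd A (n + k) (s2 - 1))).
    apply/funext => m; apply: eq_bigr => j _; congr (_ * _).
    by apply: IH => //; exact: le_trans ss' s2s.
  rewrite e3 in c1; exact: (cvg_unique (@Rhausdorff R) c1 c2).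
have [k Hk] : exists k, (1 + s0) * (1 - y) ^+ k <= 1 + s.
  have c1 : (1 + s0) * (1 - y) ^+ k @[k --> \oo] --> (1 + s0) * 0.
    apply: cvgMl_tmp; apply: cvg_expr; rewrite ger0_norm ?(ltW q0)// gtrBl//.
  rewrite mulr0 in c1; have sp1 : 0 < 1 + s by exact: lt_trans s1.
  have /cvgrPdist_le/(_ _ sp1)[k _ Hk] := c1; exists k.
  have := Hk k (leqnn k); rewrite sub0r normrN; exact: le_trans (ler_norm _).
have := key k (1 + s) (lexx _) Hk 0%N; by rewrite [1 + s - 1]addrAC subrr add0r.
Qed.

Lemma upper_gamma_sum : psi (limn (series (fun l => D l *m Gam (P *+ l + Q) 1))) = I.
Proof.
have [K AK] := A_bounded.
have c1 := lap_abel Ac AK AI.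
(* Chosen so that [e^(- tau n) = 1 / (1 + s)] with [s = 1/(n+1)]: the weights of [abel_limit] become
   the scaling of [Gam] at [1 + s]. *)
pose tau n : R := ln (1 + n.+1%:R^-1).
have x0 n : 0 < (n.+1%:R^-1 : R) by rewrite invr_gt0.
have x1 n : 0 < 1 + n.+1%:R^-1 :> R by rewrite addr_gt0.
have tau0 n : 0 < tau n by rewrite ln_gt0// ltrDl.
have tc : tau n @[n --> \oo] --> (0:R)^'+.
  have H : tau n @[n --> \oo] --> (0:R).
    have c2 : (1 + n.+1%:R^-1 : R) @[n --> \oo] --> (1 + 0 : R).
      apply: cvgD; first exact: cvg_cst.
      have := @natSV_cvg0 R => H; apply: cvg_trans H _; exact: cvg_within.
    rewrite addr0 in c2; rewrite -[X in _ --> X]ln1; apply: cvg_comp c2 _.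
    exact: continuous_ln ltr01.
  move=> U [e/= e0 HU]; have /cvgrPdist_lt/(_ _ e0) := H; apply: filterS => n Hn.
  by apply: HU => //=; exact: tau0.
have c2 := cvg_comp _ _ tc (abel_limit pP pQ cPQ hpsi ca).
apply: (cvg_unique (@Rhausdorff R) c2).
apply: cvg_trans c1; apply: near_eq_cvg; apply: nearW => n /=.
have -> : n.+1%:R^-1 * lap A 0 n.+1%:R^-1 = lapd A 0 n.+1%:R^-1 by rewrite /lapd mul0r subr0.
rewrite -(Tsum_lapd (x0 n)) /Tsum; congr (limn (series _)); apply/funext => l.
have pM : posmx (P *+ l + Q) by exact: posmxMnD.
have -> : expR (- tau n) = (1 + n.+1%:R^-1)^-1 by rewrite /tau expRN lnK// posrE.
rewrite raddf0 addr0 (Gam_scale pM (x1 n)) -[in RHS]mulmxA; apply: (congr1 (fun X => psi (D l *m X))).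
apply: (comm_Gam pM ltr01); apply: comm_mx_sym; apply: comm_real_powmx; exact: comm_mx_refl.
Qed.

End UpperCase.

Section UpperCoefficients.
Context {R : realType} {N r s : nat}.
Local Notation M := 'M[R[i]]_N.
Local Notation mu := (@lebesgue_measure R).
Variables (P Q : M) (A : 'I_r -> M) (B : 'I_s -> M) (z : R[i]).
Implicit Types (X Y : M) (psi : M -> R) (t y x : R).
Hypothesis hcomm : forall X Y, X \in [:: P, Q & codom A ++ codom B] ->
  Y \in [:: P, Q & codom A ++ codom B] -> comm_mx X Y.
Hypotheses (hP : mx_Re_gt0 P) (hQ : mx_Re_gt0 Q).

Lemma upper_case x : 0 < x ->
  cvgn (series (rEs_term A B x P Q z)) ->
  (forall t : R, x < t -> cvgn (series (rRs_term A B P Q z t))) ->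
  improper_cvg x^'+ +oo (rRs_integrand A B P Q z) ->
  rEs A B x P Q z = improper_integral x^'+ +oo (rRs_integrand A B P Q z).
Proof.
have cPQ : comm_mx P Q by apply: hcomm; rewrite !inE eqxx ?orbT.
have pP := posmx_Re hP; have pQ := posmx_Re hQ.
move=> x0 ce ct [nearI cI]; set f := rRs_integrand A B P Q z in nearI cI *.
pose D := coef P Q A B z; pose Mx l := P *+ l + Q.
have pM l : posmx (Mx l) by exact: posmxMnD.
have DP l : comm_mx (D l) P by exact: coefP.
have DQ l : comm_mx (D l) Q by exact: coefQ.
(* Convergence beyond [x] bounds the terms at every smaller argument too, so [geo] holds for all
   positive [y]; in particular the lower series up to [x] converges absolutely. *)
have gD y : 0 < y -> geo P D y.
  move=> y0; have yx : 0 < y < x + y by rewrite y0 ltrDr.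
  by apply: (cvg_geo pP yx); rewrite -rRs_termE; apply: ct; rewrite ltrDl.
have cR t : 0 < t -> cvgn (series (rRs_term A B P Q z t)).
  move=> t0; rewrite rRs_termE; have [K [q [K0 q01 HK]]] := gD t t0.
  apply: (cvg_series_nrm (b := fun l => K * q ^+ l)); last exact: cvg_geometric_dom.
  by move=> l; apply: HK; rewrite t0 lexx.
rewrite /rEs (rEs_termE z hcomm pP pQ x0) in ce *.
have g1 : geo P D (1 * x) by rewrite mul1r; exact: gD.
have lowE : (fun l => D l *m real_powmx 1 (Mx l) *m lower_gamma_mx (Mx l) x) =
    (fun l => D l *m lower_gamma_mx (Mx l) x).
  by apply/funext => l; rewrite real_powmx1 mulmx1.
apply: RlinP => psi h.
have [i1 i2 cl] := lower_gamma_series pP pQ cPQ ltr01 x0 g1 h; rewrite lowE in cl.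
set LE := limn (series (fun l => D l *m upper_gamma_mx (Mx l) x)) in ce *.
set LL := limn (series (fun l => D l *m lower_gamma_mx (Mx l) x)) in cl *.
pose a l := D l *m Gam (Mx l) 1.
have aE l : a l = D l *m lower_gamma_mx (Mx l) x + D l *m upper_gamma_mx (Mx l) x.
  rewrite -mulmxDr (lower_upper_gamma (pM l) x0) (Gamma_mxE (pM l)); reflexivity.
(* Convergence of the complete series is inferred from the two incomplete ones; it is what bounds
   [D_l Gamma(M_l)]. *)
have ca : series a n @[n --> \oo] --> LL + LE.
  have -> : series a = (fun n => series (fun l => D l *m lower_gamma_mx (Mx l) x) n +
      series (fun l => D l *m upper_gamma_mx (Mx l) x) n).
    apply/funext => n; rewrite /series/= -big_split; apply: eq_bigr => l _; exact: aE.
  by apply: cvgD; [exact: cl|exact: ce].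
pose g t := expR (- t) * Gs P Q D psi t.
have gi y : 0 < y -> mu.-integrable `]0, y[ (EFin \o g).
  by move=> y0; apply: (gint_integrable pP pQ cPQ y0 (gD y y0) h).
have gc t : 0 < t -> {for t, continuous g}.
  move=> t0; have y0 : 0 < t + 1 by rewrite ltr_wpDr.
  by apply: (gint_cont pQ cPQ (gD _ y0) h); rewrite t0 ltrDl ltr01.
have pc : {for x, continuous (prim g)}.
  have y0 : 0 < x + 1 by rewrite ltr_wpDr.
  apply: (@prim_cont _ _ (x + 1)); [exact: gi| |by rewrite x0 ltrDl ltr01].
  by move=> t /andP[t0 _]; exact: gc.
have LLE : psi LL = prim g x.
  have [_ e1] := Rlin_lim_series h cl; rewrite /LL -e1.
  have e2 : limn (series (psi \o (fun l => D l *m lower_gamma_mx (Mx l) x))) =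
      \int[mu]_(t in `]0, x[) (1 * expR (- t) * Gs P Q D psi (1 * t)).
    apply: etrans _ (esym i2); congr (limn (series _)); apply/funext => l.
    apply: (congr1 (fun X => psi (X *m lower_gamma_mx (Mx l) x))).
    by rewrite (real_powmx1 (P *+ l + Q)) mulmx1.
  rewrite e2; apply: etrans _ (Rintegral_itv_bndo_bndc (gi x x0)).
  by apply: eq_Rint => t _; rewrite !mul1r.
have xc : (x + d^-1) @[d --> +oo] --> x^'+.
  have H : (x + d^-1) @[d --> +oo] --> x.
    have c1 : (x + d^-1) @[d --> +oo] --> x + 0.
      by apply: cvgD; [exact: cvg_cst|apply/gtr0_cvgV0; [near=> d; near: d; exact: nbhs_pinfty_gt|exact: cvg_id]].
    by rewrite addr0 in c1.
  move=> U [e/= e0 HU]; have /cvgrPdist_lt/(_ _ e0) := H; apply: filter_app; near=> c => Hc.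
  by apply: HU => //=; rewrite ltrDl invr_gt0; near: c; exact: nbhs_pinfty_gt.
have c1 : (x + d^-1, d) @[d --> +oo] --> filter_prod x^'+ +oo.
  move=> U [[V W]/= [HV HW] VW]; have HV' := xc _ HV.
  change (\forall d \near +oo, U (x + d^-1, d)); near=> d; apply: (VW (x + d^-1, d)).
  by split=> /=; near: d.
have c2 : psi (mx_Rintegral `[x + d^-1, d] f) @[d --> +oo] --> psi (improper_integral x^'+ +oo f).
  exact: cvg_comp c1 (Rlin_lim h cI).
have c3 : prim g (x + d^-1) @[d --> +oo] --> prim g x.
  by apply: cvg_comp xc _; apply: cvg_at_right_filter; exact: pc.
have c4 : psi (mx_Rintegral `[x + d^-1, d] f) + prim g (x + d^-1) @[d --> +oo] -->
    psi (improper_integral x^'+ +oo f) + prim g x by exact: cvgD c2 c3.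
(* The primitive from 0 has a limit at infinity. Its part up to [x] is the lower series, so
   cancelling [prim g x] at the end leaves the upper identity. *)
have c5 : prim g d @[d --> +oo] --> psi (improper_integral x^'+ +oo f) + prim g x.
  apply: cvg_trans c4; apply: near_eq_cvg; have nI := c1 _ nearI.
  near=> d.
  have d1 : x + 1 <= d by near: d; apply: nbhs_pinfty_ge; exact: num_real.
  have d0 : 0 < d by lra.
  have d11 : 1 <= d by lra.
  have dV : 0 < d^-1 <= 1 by rewrite invr_gt0 d0 invf_le1.
  have fi : mx_integrable `[x + d^-1, d] f by near: d; exact: nI.
  rewrite /= (Rlin_Rintegral (mitv _) (mx_integrable_mxI (mitv _) fi) h).
  have -> : \int[mu]_(t in `[x + d^-1, d]) psi (f t) = \int[mu]_(t in `[x + d^-1, d]) g t.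
    apply: eq_Rint => t; rewrite in_itv/= => /andP[t1 t2].
    by apply: (Rlin_integrand hcomm pP pQ h); apply: cR; lra.
  have dy : 0 < d + 1 by lra.
  rewrite (@primB _ g (d + 1) (gi _ dy)) ?subrK//; try lra.
  by move=> t /andP[t0 _]; exact: gc.
have H := upper_gamma_sum hP hQ cPQ DP DQ gD (cvgP _ ca) h c5.
have e1 : limn (series a) = LL + LE by exact: cvg_mx_lim ca.
rewrite -/a e1 (RlinD _ _ h) LLE addrC in H; exact: addIr H.
Unshelve. all: by end_near. Qed.

End UpperCoefficients.

Theorem theorem3p5 (R : realType) (N r s : nat) (P Q : 'M[R[i]]_N)
    (A : 'I_r -> 'M[R[i]]_N) (B : 'I_s -> 'M[R[i]]_N) (x : R) (z : R[i])
    (hcomm : forall X Y : 'M[R[i]]_N,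
       X \in [:: P, Q & codom A ++ codom B] ->
       Y \in [:: P, Q & codom A ++ codom B] -> comm_mx X Y)
    (hP : mx_Re_gt0 P) (hQ : mx_Re_gt0 Q)
    (hA : forall i : 'I_r, mx_Re_gt0 (A i))
    (hB : forall j : 'I_s, mx_Re_gt0 (B j))
    (hx : 0 < x) :
  (cvgn (series (rEs_term A B x P Q z)) ->
   (forall t : R, x < t -> cvgn (series (rRs_term A B P Q z t))) ->
   improper_cvg x^'+ +oo (rRs_integrand A B P Q z) ->
   rEs A B x P Q z = improper_integral x^'+ +oo (rRs_integrand A B P Q z))
  /\
  (cvgn (series (res_term A B x P Q z)) ->
   (forall t : R, 0 < t -> t < x -> cvgn (series (rRs_term A B P Q z t))) ->
   improper_cvg 0^'+ x^'- (rRs_integrand A B P Q z) ->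
   res A B x P Q z = improper_integral 0^'+ x^'- (rRs_integrand A B P Q z)).
Proof.
split; first exact: upper_case.
by apply: lower_case => //; exact: posmx_Re.
Qed.
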